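(* Let $V=(J,(V_j)_{j\in J},d,H)$ be a hypergraph system and let $(\nu_e)_{e\in H}$ be a pseudorandom system of measures on $V$. For each $e\in H$ let $E_e\in\mathcal{A}_e$ be such that $$\mathbb{E}\Big(\prod_{e\in H}1_{E_e}(x)\,\nu_e(\pi_e(x))\ \Big|\ x\in V_J\Big)\le\delta$$ for some $0<\delta<1$. Then, if $N$ is sufficiently large depending on $\delta$ and $J$, for each $e\in H$ there is a set $E'_e\in\mathcal{A}_e$ such that $\bigcap_{e\in H}E'_e=\emptyset$ and $$\mathbb{E}\big(1_{E_e\setminus E'_e}(x)\,\nu_e(\pi_e(x))\mid x\in V_J\big)=o_{\delta\to0}(1)+o_{N\to\infty;\delta}(1)\quad\text{for all }e\in H.$$ Furthermore, there exist $\sigma$-algebras $\mathcal{B}_{e'}\subseteq\mathcal{A}_{e'}$ for every $e'\subseteq J$ with $|e'|<d$, such that $|\mathcal{B}_{e'}|=O_\delta(1)$ for all such $e'$ and $E'_e\in\bigvee_{e'\subsetneq e}\mathcal{B}_{e'}$ for all $e\in H$.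
   Context: A hypergraph system is a quadruple $V=(J,(V_j)_{j\in J},d,H)$ where $J$ is a finite set, each $V_j$ is a finite nonempty set, $d\ge1$ is an integer and $H\subseteq\binom{J}{d}:=\{e\subseteq J:|e|=d\}$. For $e\subseteq J$ put $V_e:=\prod_{j\in e}V_j$, let $\pi_e:V_J\to V_e$ be the coordinate projection and $\mathcal{A}_e:=\{\pi_e^{-1}(E):E\subseteq V_e\}$ (a $\sigma$-algebra on $V_J$). $\bigvee$ denotes the smallest $\sigma$-algebra containing the given ones; $|\mathcal{B}|$ is the number of sets in the finite $\sigma$-algebra $\mathcal{B}$. For a finite nonempty set $Z$ and $f:Z\to\mathbb{R}$, $\mathbb{E}(f(x)\mid x\in Z):=|Z|^{-1}\sum_{x\in Z}f(x)$; constraints written after the bar mean uniform averaging over all tuples satisfying them. All objects ($V_j$, $\nu_e$, $E_e$, …) depend on a parameter $N$ ranging over a sequence tending to infinity, while $J,d,H$ are fixed; all implicit constants may depend on $J$. $o_{x\to 0;y}(X)$ denotes a quantity bounded in magnitude by $c(x,y)X$ where $c(x,y)\to0$ as $x\to0$ for each fixed $y$; $O_y(X)$ denotes a quantity bounded by $C(y)X$. Cube notation: for a finite set $e$, $\{0,1\}^e$ is the set of tuples $\omega=(\omega_j)_{j\in e}$ with $\omega_j\in\{0,1\}$, and $0^e$ is the all-zero tuple; for $x^{(0)}_J,x^{(1)}_J\in V_J$, $e\subseteq J$ and $\omega\in\{0,1\}^e$, set $x^{(\omega)}_e:=(x^{(\omega_j)}_j)_{j\in e}\in V_e$ and $x^{(a)}_e:=(x^{(a)}_j)_{j\in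 e}$ for $a\in\{0,1\}$. A system of measures is a family of functions $\nu_e:V_e\to[0,\infty)$, $e\in H$, with $\mathbb{E}(\nu_e(x_e)\mid x_e\in V_e)=1+o_{N\to\infty}(1)$. For $e\in H$ and $f:V_e\to\mathbb{R}$, the dual function is $\mathcal{D}_ef(x^{(0)}_e):=\mathbb{E}\big(\prod_{\omega\in\{0,1\}^e,\ \omega\neq 0^e}f(x^{(\omega)}_e)\mid x^{(1)}_e\in V_e\big)$. The system is pseudorandom if: (i) $\mathcal{D}_e(\nu_e+1)(x_e)=O(1)$ for all $e\in H$, $x_e\in V_e$; (ii) for every choice of exponents $n_{e,\omega}\in\{0,1\}$, $\mathbb{E}\big(\prod_{e\in H}\prod_{\omega\in\{0,1\}^e}\nu_e(x^{(\omega)}_e)^{n_{e,\omega}}\mid x^{(0)}_J,x^{(1)}_J\in V_J\big)=1+o_{N\to\infty}(1)$; (iii) for every $e\in H$, $j\in e$, every choice of $n_{e,\omega}\in\{0,1\}$ and every integer $K\ge0$, $\mathbb{E}\Big(\mathbb{E}\big(\prod_{\omega\in\{0,1\}^e}\nu_e(x^{(\omega)}_e)^{n_{e,\omega}}\mid x^{(0)}_j,x^{(1)}_j\in V_j\big)^K\ \Big|\ x^{(0)}_{e\setminus\{j\}},x^{(1)}_{e\setminus\{j\}}\in V_{e\setminus\{j\}}\Big)=O_K(1)$. *)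

(* Defs.v *)
From HB Require Import structures.
From mathcomp Require Import all_boot all_order all_algebra.
From mathcomp Require Import reals.
Set Implicit Arguments. Unset Strict Implicit. Unset Printing Implicit Defensive.
Import Order.TTheory GRing.Theory Num.Theory.
Local Open Scope ring_scope.

Section HypergraphDefs.
Variable R : realType.

Definition avg (T : finType) (f : T -> R) : R := (#|T|%:R)^-1 * \sum_(x : T) f x.

Definition tends_to (u : nat -> R) (l : R) : Prop :=
  forall eps : R, 0 < eps -> exists N0 : nat, forall N, (N0 <= N)%N -> `|u N - l| <= eps.

Definition tends_to0_at0 (c : R -> R) : Prop :=
  forall eps : R, 0 < eps -> exists eta : R, 0 < eta /\
    forall delta : R, 0 < delta -> delta < eta -> `|c delta| <= eps.

Variables (J : finType) (V : nat -> J -> finType).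

Definition VJ (N : nat) : finType := {dffun forall j : J, V N j}.
Definition Ve (N : nat) (e : {set J}) : finType :=
  {dffun forall i : {j : J | j \in e}, V N (val i)}.

Definition proj (N : nat) (e : {set J}) (x : VJ N) : Ve N e :=
  [ffun i : {j : J | j \in e} => x (val i)].

Definition cube (e : {set J}) : finType := {ffun {j : J | j \in e} -> bool}.

Definition cubept (N : nat) (e : {set J}) (y0 y1 : Ve N e) (w : cube e) : Ve N e :=
  [ffun i => if w i then y1 i else y0 i].

Definition upd (N : nat) (x : VJ N) (j : J) (a : V N j) : VJ N :=
  [ffun i => dfwith (fun k => x k) a i].

Definition in_A (N : nat) (e : {set J}) (S : {set VJ N}) : Prop :=
  exists E : {set Ve N e}, S = [set x | proj e x \in E].

Definition is_sigma (T : finType) (B : {set {set T}}) : bool :=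
  [&& set0 \in B, [forall S in B, (~: S) \in B] &
      [forall S1 in B, [forall S2 in B, (S1 :|: S2) \in B]]].

Definition sigma_gen (T : finType) (G : {set {set T}}) : {set {set T}} :=
  [set S | [forall B : {set {set T}}, (is_sigma B && (G \subset B)) ==> (S \in B)]].

Variable nu : forall (N : nat) (e : {set J}), Ve N e -> R.
Variable H : {set {set J}}.

Definition dual (N : nat) (e : {set J}) (f : Ve N e -> R) (y0 : Ve N e) : R :=
  avg (fun y1 : Ve N e =>
         \prod_(w : cube e | w != [ffun=> false]) f (cubept y0 y1 w)).

Definition system_of_measures : Prop :=
  (forall N e (y : Ve N e), e \in H -> 0 <= nu y) /\
  (forall e, e \in H -> tends_to (fun N => avg (fun y : Ve N e => nu y)) 1).

Definition pseudorandom : Prop :=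
  (exists C : R, forall N e (y : Ve N e), e \in H ->
      dual (fun z : Ve N e => nu z + 1) y <= C) /\
  (forall n : forall e : {set J}, cube e -> bool,
     tends_to (fun N => avg (fun p : VJ N * VJ N =>
        \prod_(e in H) \prod_(w : cube e)
           (if n e w then nu (cubept (proj e p.1) (proj e p.2) w) else 1))) 1) /\
  (* (iii): the outer average over pairs in V_{e\{j}} is written as an average
     over pairs in V_J of a quantity depending only on the coordinates in e\{j} *)
  (forall (e : {set J}) (j : J) (n : cube e -> bool) (K : nat), e \in H -> j \in e ->
     exists C : R, forall N,
       avg (fun p : VJ N * VJ N =>
         (avg (fun ab : V N j * V N j =>
            \prod_(w : cube e)
              (if n w then nu (cubept (proj e (upd p.1 ab.1)) (proj e (upd p.2 ab.2)) w)
               else 1))) ^+ K) <= C).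

End HypergraphDefs.

(* Main.v *)
(* The weights nu_e are first removed by a transference argument. The cells of a bounded
   partition of V_J by sets in the A_{e \ j}, j in e, are cut out by functions that do not
   depend on all coordinates of e, so a pseudorandom nu_e has mean 1 + o(1) relative to
   them; this lets a weak regularity lemma, run with an energy of linear growth, produce
   functions 0 <= g_e <= 1 with 1_{E_e} nu_e - g_e small in cut norm. A relative counting
   lemma then compares the averages of the products of the 1_{E_e} nu_e and of the g_e: one
   edge at a time, the weight nu_{e0} is traded by Cauchy-Schwarz for a square of densities
   averaged over the coordinates outside e0, and the resulting errors are controlled by the
   linear forms condition (ii). Finally the removal lemma for dense hypergraphs is applied
   to the sets {g_e >= eta}.

   The dense removal lemma follows Tao: a tower of strong regularity lemmas, from faces of
   size d down to points, followed by a counting lemma for the cells. The counting lemma is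
   proved for configurations living on several copies of the vertex classes, since its error
   term is bounded by Cauchy-Schwarz, which doubles the configuration. The set E'_e consists
   of the points whose lower-dimensional cells contain a regular point of E_e: if all the
   E'_e met, the counting lemma would give the E_e an intersection of size more than delta. *)
Require Import Defs.
From HB Require Import structures.
From mathcomp Require Import all_boot all_order all_algebra.
From mathcomp Require Import boolp reals.
From mathcomp Require Import ring lra.
Set Implicit Arguments. Unset Strict Implicit. Unset Printing Implicit Defensive.
Import Order.TTheory GRing.Theory Num.Theory.
Local Open Scope ring_scope.

(** * Averages and product spaces *)

(** The constants are fixed in an order that makes the transference work. The tolerance determines
    the dense removal constant [c] and the complexity [M] of the removing sets; these determine
    [delta], then the cut-norm error [kappa], small against the number of cells of complexity [M],
    and last the error allowed in the linear forms. Hence the error of [g_e] can be summed over all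
    cells outside [E'_e]. In the tower, the uniformity at one level must beat the densities of all
    lower levels, whose complexity is only known afterwards. The growth function of strong
    regularity settles this: it is computed from the tower below by induction. The mean-square
    errors cannot be made that small; they only have to beat the densities of their own level,
    because in Cauchy-Schwarz the weights of the lower levels cancel. The error functions of the
    statement come from a diagonal choice: each tolerance [1 / (k + 1)] has a threshold for [delta],
    and a given [delta] uses the best tolerance it admits. Since the threshold for [N] may depend on
    [delta], the second error function is zero. *)

Section Averages.
Variable R : realType.
Implicit Types T U : finType.

Lemma eq_avg T (f g : T -> R) : f =1 g -> avg f = avg g.
Proof. by move=> fg; rewrite /avg; congr (_ * _); apply: eq_bigr. Qed.

Lemma avgD T (f g : T -> R) : avg (fun x => f x + g x) = avg f + avg g.
Proof. by rewrite /avg big_split mulrDr. Qed.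

Lemma avgN T (f : T -> R) : avg (fun x => - f x) = - avg f.
Proof. by rewrite /avg sumrN mulrN. Qed.

Lemma avgB T (f g : T -> R) : avg (fun x => f x - g x) = avg f - avg g.
Proof. by rewrite avgD avgN. Qed.

Lemma avgZ T (c : R) (f : T -> R) : avg (fun x => c * f x) = c * avg f.
Proof. by rewrite /avg -mulr_sumr mulrCA. Qed.

Lemma avgZr T (c : R) (f : T -> R) : avg (fun x => f x * c) = avg f * c.
Proof. by rewrite /avg -mulr_suml mulrA. Qed.

Lemma avg0 T : avg (fun _ : T => 0 : R) = 0.
Proof. by rewrite /avg big1 ?mulr0. Qed.

Lemma avg_sum T (I : Type) (r : seq I) (P : pred I) (f : I -> T -> R) :
  avg (fun x => \sum_(i <- r | P i) f i x) = \sum_(i <- r | P i) avg (f i).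
Proof. by rewrite /avg exchange_big mulr_sumr. Qed.

Lemma avg_const T (c : R) : (0 < #|T|)%N -> avg (fun _ : T => c) = c.
Proof.
move=> T0; rewrite /avg sumr_const -[c *+ _]mulr_natl mulrA mulVf ?mul1r //.
by rewrite pnatr_eq0 -lt0n.
Qed.

Lemma ler_avg T (f g : T -> R) : (forall x, f x <= g x) -> avg f <= avg g.
Proof.
by move=> fg; rewrite /avg ler_wpM2l ?invr_ge0 ?ler0n //; apply: ler_sum.
Qed.

Lemma avg_ge0 T (f : T -> R) : (forall x, 0 <= f x) -> 0 <= avg f.
Proof. by move=> f0; rewrite -(avg0 T); apply: ler_avg. Qed.

(** The sign condition covers an empty [T], where every average is 0. *)
Lemma avg_le T (f : T -> R) (c : R) : 0 <= c -> (forall x, f x <= c) -> avg f <= c.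
Proof.
move=> c0 fc; case: (posnP #|T|) => [T0|T0].
  rewrite /avg big1 ?mulr0 // => x _.
  by have := card0_eq T0 x; rewrite inE.
by rewrite -[leRHS](avg_const c T0); apply: ler_avg.
Qed.

Lemma ler_norm_avg T (f : T -> R) : `|avg f| <= avg (fun x => `|f x|).
Proof.
rewrite /avg normrM ger0_norm ?invr_ge0 ?ler0n // ler_wpM2l ?invr_ge0 ?ler0n //.
exact: ler_norm_sum.
Qed.

Lemma avg_pair T U (f : T * U -> R) :
  avg f = avg (fun x => avg (fun y => f (x, y))).
Proof.
rewrite /avg -mulr_sumr mulrA card_prod natrM invfM; congr (_ * _).
by rewrite pair_big /=; apply: eq_bigr => -[].
Qed.

Lemma avg_exchange T U (f : T -> U -> R) :
  avg (fun x => avg (f x)) = avg (fun y => avg (fun x => f x y)).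
Proof.
rewrite /avg -!mulr_sumr mulrCA; congr (_ * (_ * _)).
exact: exchange_big.
Qed.

Lemma avg_bij T U (h : T -> U) (f : U -> R) : bijective h ->
  avg (fun x => f (h x)) = avg f.
Proof.
move=> hb; rewrite /avg (bij_eq_card hb); congr (_ * _).
by rewrite [RHS](reindex h) //; apply: onW_bij.
Qed.

Lemma avg_involutive T (h : T -> T) (f : T -> R) : involutive h ->
  avg (fun x => f (h x)) = avg f.
Proof. by move=> hi; apply: avg_bij; apply: inv_bij. Qed.

Lemma cauchy_schwarz_avg T (w f g : T -> R) : (forall x, 0 <= w x) ->
  avg (fun x => w x * (f x * g x)) ^+ 2 <=
  avg (fun x => w x * f x ^+ 2) * avg (fun x => w x * g x ^+ 2).
Proof.
move=> w0.
set a := avg (fun x => w x * f x ^+ 2); set c := avg (fun x => w x * g x ^+ 2).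
set b := avg _.
have a0 : 0 <= a by apply: avg_ge0 => x; rewrite mulr_ge0 // sqr_ge0.
have c0 : 0 <= c by apply: avg_ge0 => x; rewrite mulr_ge0 // sqr_ge0.
have quad s t : 0 <= s ^+ 2 * a - 2 * s * t * b + t ^+ 2 * c.
  suff -> : s ^+ 2 * a - 2 * s * t * b + t ^+ 2 * c =
      avg (fun x => w x * (s * f x - t * g x) ^+ 2).
    by apply: avg_ge0 => x; rewrite mulr_ge0 // sqr_ge0.
  rewrite /a /b /c -!avgZ -avgB -avgD; apply: eq_avg => x; ring.
have [c_0|c_n0] := eqVneq c 0; last first.
  have cp : 0 < c by rewrite lt_def c_n0.
  have := quad c b.
  have -> : c ^+ 2 * a - 2 * c * b * b + b ^+ 2 * c = c * (a * c - b ^+ 2) by ring.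
  by rewrite pmulr_rge0 // subr_ge0.
rewrite c_0 mulr0; have [->|bn0] := eqVneq b 0; first by rewrite expr0n.
(* With [c = 0] the form is affine in its second argument, and this value brings it down to
   [- a - 2], which is negative. *)
have := quad 1 ((a + 1) / b); rewrite c_0.
have -> : 1 ^+ 2 * a - 2 * 1 * ((a + 1) / b) * b + ((a + 1) / b) ^+ 2 * 0 = - a - 2
  by field.
lra.
Qed.

Lemma sqr_avg_le T (f : T -> R) : (0 < #|T|)%N -> avg f ^+ 2 <= avg (fun x => f x ^+ 2).
Proof.
move=> T0; have := @cauchy_schwarz_avg T (fun=> 1) f (fun=> 1) (fun=> ler01).
rewrite (@eq_avg _ (fun x => 1 * (f x * 1)) f); last by move=> x; ring.
rewrite (@eq_avg _ (fun x => 1 * f x ^+ 2) (fun x => f x ^+ 2)); last by move=> x; ring.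
by rewrite expr1n mulr1 avg_const // mulr1.
Qed.

End Averages.

Section ProductSpace.
Variables (K : finType) (W : K -> finType).
Local Notation X := ({dffun forall k : K, W k}).

(** Measurability with respect to the coordinates in [s], stated for functions so that it covers
    sets, densities and colourings alike. *)
Definition depends_on (Y : Type) (s : {set K}) (f : X -> Y) :=
  forall x y : X, {in s, forall k, x k = y k} -> f x = f y.

Definition mix (s : {set K}) (x y : X) : X :=
  [ffun k => if k \in s then x k else y k].

Lemma mixE s x y k : mix s x y k = if k \in s then x k else y k.
Proof. by rewrite ffunE. Qed.

Lemma mix_swapK s : involutive (fun p : X * X => (mix s p.1 p.2, mix s p.2 p.1)).
Proof.
by case=> x y /=; congr (_, _); apply/ffunP => k; rewrite !mixE; case: (k \in s).
Qed.

Lemma card_prod_space_gt0 : (forall k, 0 < #|W k|)%N -> (0 < #|{: X}|)%N.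
Proof.
move=> W0; apply/card_gt0P.
have P k : exists a : W k, true by have /card_gt0P[a _] := W0 k; exists a.
by exists [ffun k => xchoose (P k)].
Qed.

Variable R : realType.

(** [mix_swapK] permutes the pairs of points and has [mix s x y] as first component, so mixing two
    independent uniform points gives a uniform point. *)
Lemma avg_mix (F : X -> R) s :
  avg (fun x => avg (fun y => F (mix s x y))) = avg F.
Proof.
case: (posnP #|{: X}|) => [X0|X0].
  by rewrite /avg !big1 // => x; have := card0_eq X0 x; rewrite inE.
rewrite -(avg_pair (fun p : X * X => F (mix s p.1 p.2))).
rewrite (avg_involutive (fun p : X * X => F p.1) (@mix_swapK s)).
by rewrite avg_pair; apply: eq_avg => x /=; rewrite avg_const.
Qed.

End ProductSpace.

(** * Conditional expectations and energy *)

Section CondExp.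
Variables (R : realType) (T : finType).

Definition invariant_under (C Y : Type) (c : T -> C) (h : T -> Y) :=
  forall x y, c x = c y -> h x = h y.

Definition condexp (C : eqType) (c : T -> C) (f : T -> R) (x : T) : R :=
  (\sum_(y | c y == c x) f y) / #|[pred y | c y == c x]|%:R.

Lemma condexp_inv (C : eqType) (c : T -> C) f : invariant_under c (condexp c f).
Proof. by move=> x y cxy; rewrite /condexp cxy. Qed.

(** The left side is a sum over pairs of points in a common cell. There [h] is constant, so summing
    over the first point cancels the size of the cell. *)
Lemma avg_condexp (C : eqType) (c : T -> C) (f h : T -> R) :
  invariant_under c h ->
  avg (fun x => h x * condexp c f x) = avg (fun x => h x * f x).
Proof.
move=> hc; rewrite /avg; congr (_ * _).
rewrite (eq_bigr (fun x => \sum_(y | c y == c x)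
    h x * f y / #|[pred z | c z == c x]|%:R)); last first.
  by move=> x _; rewrite /condexp mulrA mulr_sumr mulr_suml.
rewrite (exchange_big_dep xpredT) //=; apply: eq_bigr => y _.
rewrite (eq_bigr (fun=> h y * f y / #|[pred z | c z == c y]|%:R)); last first.
  by move=> x /eqP cxy; rewrite (hc _ _ cxy) cxy.
rewrite sumr_const -[_ *+ _]mulr_natr.
have -> : #|[pred i | c y == c i]| = #|[pred z | c z == c y]|.
  by apply: eq_card => z; rewrite !inE eq_sym.
rewrite -mulrA mulVf ?mulr1 // pnatr_eq0 -lt0n.
by apply/card_gt0P; exists y; rewrite inE.
Qed.

Lemma avg_condexp1 (C : eqType) (c : T -> C) (f : T -> R) :
  avg (condexp c f) = avg f.
Proof.
have := @avg_condexp C c f (fun=> 1) (fun _ _ _ => erefl).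
by under eq_avg do rewrite mul1r; move=> ->; apply: eq_avg => x; rewrite mul1r.
Qed.

Lemma condexp_ge0 (C : eqType) (c : T -> C) (f : T -> R) x :
  (forall y, 0 <= f y) -> 0 <= condexp c f x.
Proof. by move=> f0; rewrite /condexp divr_ge0 ?ler0n ?sumr_ge0. Qed.

Lemma condexp_le (C : eqType) (c : T -> C) (f : T -> R) b x :
  (forall y, f y <= b) -> condexp c f x <= b.
Proof.
move=> fb; rewrite /condexp ler_pdivrMr; last first.
  by rewrite ltr0n; apply/card_gt0P; exists x; rewrite inE.
rewrite mulr_natr -sumr_const.
by rewrite (eq_bigl (fun y => y \in [pred y | c y == c x])) ?ler_sum.
Qed.

(* On each cell the average is at most [b]; an invariant set is a union of cells. *)
Lemma avg_cells_le (C : finType) (c : T -> C) (g : T -> R) (U : pred T) (b : R) :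
  0 <= b -> invariant_under c U ->
  (forall x0, avg (fun x => g x * (c x == c x0)%:R) <= b) ->
  avg (fun x => g x * (U x)%:R) <= #|C|%:R * b.
Proof.
move=> b0 Uc gb.
have -> : avg (fun x => g x * (U x)%:R) =
   \sum_(c0 : C) avg (fun x => g x * (U x && (c x == c0))%:R).
  rewrite -avg_sum; apply: eq_avg => x; rewrite (bigD1 (c x)) //= big1 ?addr0.
    by rewrite eqxx andbT.
  by move=> c0 /negbTE; rewrite eq_sym => ->; rewrite andbF mulr0.
apply: (@le_trans _ _ (\sum_(c0 : C) b)); last by rewrite sumr_const mulr_natl.
apply: ler_sum => c0 _.
have [[x0 /andP[Ux0 /eqP <-]]|no] := pselect (exists x0, U x0 && (c x0 == c0)).
  apply: le_trans (gb x0); rewrite le_eqVlt; apply/orP; left; apply/eqP.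
  apply: eq_avg => x; case: eqP => [/Uc ->|_]; first by rewrite Ux0.
  by rewrite andbF.
rewrite (@eq_avg _ _ _ (fun=> 0)) ?avg0 // => x.
by case: andP => [/andP Ux|_]; [case: no; exists x|rewrite mulr0].
Qed.

Lemma norm_avg_cells_le (C : finType) (c : T -> C) (g : T -> R) (U : pred T) (b : R) :
  0 <= b -> invariant_under c U ->
  (forall x0, `|avg (fun x => g x * (c x == c x0)%:R)| <= b) ->
  `|avg (fun x => g x * (U x)%:R)| <= #|C|%:R * b.
Proof.
move=> b0 Uc gb; rewrite ler_norml; apply/andP; split; last first.
  by apply: (avg_cells_le b0 Uc) => x0; apply: le_trans (gb x0); apply: ler_norm.
rewrite lerNl -avgN (@eq_avg _ _ _ (fun x => (- g x) * (U x)%:R)); last first.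
  by move=> x; rewrite mulNr.
apply: (avg_cells_le b0 Uc) => x0; apply: le_trans (gb x0).
rewrite -normrN -avgN (eq_avg (fun x => mulNr _ _)); exact: ler_norm.
Qed.

End CondExp.

Section Energy.
Variables (R : realType).

Definition trunc (t : R) : R := Num.min t 1.

(* Quadratic on [0, 1] and affine beyond: convex, hence monotone under refinement,
   but of linear growth, so that its averages stay bounded for functions that are
   only bounded in mean. *)
Definition energy_fun (t : R) : R := if t <= 1 then t ^+ 2 else 2 * t - 1.

Lemma truncE (t : R) : trunc t = if t <= 1 then t else 1.
Proof. by rewrite /trunc minEle. Qed.

(** The right side is the Bregman divergence of [energy_fun], whose derivative is [2 * trunc]. *)
Lemma energy_fun_bregman (a b : R) :
  (trunc b - trunc a) ^+ 2 <=
  energy_fun b - energy_fun a - 2 * trunc a * (b - a).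
Proof.
rewrite !truncE /energy_fun.
case: (lerP a 1) => a1; case: (lerP b 1) => b1; rewrite -subr_ge0.
- by rewrite le_eqVlt; apply/orP; left; apply/eqP; ring.
- have -> : 2 * b - 1 - a ^+ 2 - 2 * a * (b - a) - (1 - a) ^+ 2 =
    2 * ((b - 1) * (1 - a)) by ring.
  by rewrite mulr_ge0 // mulr_ge0 // subr_ge0 // ltW.
- by rewrite le_eqVlt; apply/orP; left; apply/eqP; ring.
- by rewrite le_eqVlt; apply/orP; left; apply/eqP; ring.
Qed.

Lemma energy_fun_ge0 (t : R) : 0 <= t -> 0 <= energy_fun t.
Proof. by rewrite /energy_fun; case: (lerP t 1) => t1 t0; [exact: sqr_ge0|lra]. Qed.

Lemma energy_fun_le (t : R) : 0 <= t -> energy_fun t <= 2 * t.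
Proof.
rewrite /energy_fun; case: (lerP t 1) => t1 t0; last by lra.
by rewrite expr2 ler_wpM2r //; lra.
Qed.

(** The first-order term of [energy_fun_bregman] averages to zero: its coefficient is invariant
    under the coarse colouring, and against such functions both conditional expectations have the
    same inner product. *)
Lemma energy_increment (T : finType) (C C' : eqType) (c : T -> C) (c' : T -> C')
    (f : T -> R) : invariant_under c' c ->
  avg (fun x => (trunc (condexp c' f x) - trunc (condexp c f x)) ^+ 2) <=
  avg (fun x => energy_fun (condexp c' f x)) - avg (fun x => energy_fun (condexp c f x)).
Proof.
move=> cc'.
have : avg (fun x => 2 * trunc (condexp c f x) * (condexp c' f x - condexp c f x)) = 0.
  have ic : invariant_under c (fun x => 2 * trunc (condexp c f x)).
    by move=> x y /(condexp_inv f) ->.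
  rewrite (eq_avg (fun x => mulrBr _ _ _)) avgB (avg_condexp f ic).
  by rewrite avg_condexp ?subrr // => x y /cc' /ic.
move=> z0; rewrite -[leRHS]subr0 -[X in _ - X]z0 -!avgB; apply: ler_avg => x.
exact: energy_fun_bregman.
Qed.

End Energy.

(** * Partitions by lower-dimensional faces *)

Section Colors.
Variable T : finType.
Implicit Types L : seq {set T}.

Definition color L (x : T) : seq bool := [seq x \in A | A : {set T} <- L].

Lemma color_eqP L x y :
  reflect (forall S, S \in L -> (x \in S) = (y \in S)) (color L x == color L y).
Proof.
apply: (iffP eqP) => [/eq_in_map h S|h]; first exact: h.
exact/eq_in_map.
Qed.

(** The partition of [color] with a finite colour type that depends only on the bound [n], so that
    cells can be counted. Positions beyond the end of the list read [set0] and distinguish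
    nothing. *)
Definition fcolor n L (x : T) : {ffun 'I_n -> bool} := [ffun i : 'I_n => x \in nth set0 L i].

Lemma fcolor_eq n L x y : (size L <= n)%N ->
  (fcolor n L x == fcolor n L y) = (color L x == color L y).
Proof.
move=> sL; apply/eqP/color_eqP => [/ffunP h S SL|h].
  have iS : (index S L < n)%N by apply: leq_trans sL; rewrite index_mem.
  by have := h (Ordinal iS); rewrite !ffunE /= nth_index.
apply/ffunP => i; rewrite !ffunE.
have [iL|iL] := ltnP i (size L); first by apply: h; apply: mem_nth.
by rewrite nth_default // !in_set0.
Qed.

Lemma card_fcolor n : #|{: {ffun 'I_n -> bool}}| = (2 ^ n)%N.
Proof. by rewrite card_ffun card_bool card_ord. Qed.

Lemma color_sub L L' x y : {subset L <= L'} ->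
  color L' x = color L' y -> color L x = color L y.
Proof. by move=> sL /eqP/color_eqP h; apply/eqP/color_eqP => S /sL/h. Qed.

End Colors.

Section Faces.
Variables (J : finType) (W : J -> finType).
Local Notation X := ({dffun forall j : J, W j}).

Implicit Types (e s : {set J}).

(** A partition for each face, given by generating sets; the length of the list is its
    complexity. *)
Definition face_system := {set J} -> seq {set X}.

Definition face_measurable (G : face_system) :=
  forall s S, S \in G s -> depends_on s (fun x => x \in S).

Definition boundary (G : face_system) (e : {set J}) : seq {set X} :=
  flatten [seq G (e :\ k) | k <- enum e].

Lemma boundaryP (G : face_system) e S :
  reflect (exists2 k, k \in e & S \in G (e :\ k)) (S \in boundary G e).
Proof.
apply: (iffP flatten_mapP) => -[k ke Sk]; exists k => //.
  by rewrite mem_enum in ke.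
by rewrite mem_enum.
Qed.

Lemma size_boundary (G : face_system) e m : (forall s, size (G s) <= m)%N ->
  (size (boundary G e) <= #|J| * m)%N.
Proof.
move=> Gm; apply: (@leq_trans (size (enum e) * m)); last first.
  by rewrite leq_mul2r -cardE max_card orbT.
rewrite /boundary; elim: (enum e) => //= k s IH.
by rewrite size_cat mulSn leq_add.
Qed.

Lemma depends_on_sub (Y : Type) (s s' : {set J}) (f : X -> Y) :
  s \subset s' -> depends_on s f -> depends_on s' f.
Proof. by move=> /subsetP ss df x y xy; apply: df => k /ss; apply: xy. Qed.

Lemma depends_on_color (G : face_system) s :
  face_measurable G -> depends_on s (color (G s)).
Proof.
by move=> mG x y xy; apply/eqP/color_eqP => S SG; apply: (mG s).
Qed.

Lemma depends_on_boundary (G : face_system) e :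
  face_measurable G -> depends_on e (color (boundary G e)).
Proof.
move=> mG x y xy; apply/eqP/color_eqP => S /boundaryP[k ke SG].
by apply: (mG _ _ SG) => i; rewrite inE => /andP[_ ie]; apply: xy.
Qed.

Variable R : realType.

Definition ind_faces (e : {set J}) (S : J -> {set X}) (x : X) : R :=
  \prod_(k in e) (x \in S k)%:R.

Lemma ind_facesE e S x : ind_faces e S x = [forall k in e, x \in S k]%:R.
Proof.
rewrite /ind_faces; case: forallP => [h|/forallP].
  by rewrite big1 // => k ke; have := h k; rewrite ke => /= ->.
rewrite negb_forall => /existsP[k]; rewrite negb_imply => /andP[ke xS].
by rewrite (bigD1 k) //= (negbTE xS) mul0r.
Qed.

Definition face_sets (e : {set J}) (S : J -> {set X}) :=
  forall k, k \in e -> depends_on (e :\ k) (fun x => x \in S k).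

(** A cut norm: the tests are products of one indicator per coordinate of [e], each independent of
    its own coordinate. *)
Definition cut_le (f : X -> R) (e : {set J}) (kappa : R) :=
  forall S, face_sets e S -> `|avg (fun x => f x * ind_faces e S x)| <= kappa.

(** A one-sided bound that every [f <= nu] inherits from [nu_cut]. It replaces the bound [f <= 1],
    under which it holds with [gamma = 0]. *)
Definition mean_bounded (f : X -> R) (e : {set J}) (gamma : R) :=
  forall S, face_sets e S ->
    avg (fun x => f x * ind_faces e S x) <= avg (ind_faces e S) + gamma.

(** A cell of the boundary partition is an intersection of one set per facet, hence an admissible
    test for [cut_le] and [mean_bounded]. *)
Lemma boundary_cell (G : face_system) e x0 : face_measurable G ->
  exists2 S, face_sets e S &
    forall x, ind_faces e S x = (color (boundary G e) x == color (boundary G e) x0)%:R.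
Proof.
move=> mG; exists (fun k => [set x | color (G (e :\ k)) x == color (G (e :\ k)) x0]).
  by move=> k ke x y xy; rewrite !inE (depends_on_color mG xy).
move=> x; rewrite ind_facesE; congr (nat_of_bool _)%:R; apply/forallP/color_eqP.
  move=> h S /boundaryP[k ke SG].
  by have := h k; rewrite ke inE => /color_eqP; apply.
move=> h k; apply/implyP => ke; rewrite inE; apply/color_eqP => S SG.
by apply: h; apply/boundaryP; exists k.
Qed.

Definition face_condexp (G : face_system) (e : {set J}) (f : X -> R) : X -> R :=
  condexp (color (boundary G e)) f.

Lemma depends_on_condexp (G : face_system) e f :
  face_measurable G -> depends_on e (face_condexp G e f).
Proof.
by move=> mG x y xy; apply: condexp_inv; apply: (depends_on_boundary mG).
Qed.

(* Only the excess of [f] over its mean bound survives in the truncation error. *)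
Lemma trunc_excess (G : face_system) e f gamma m :
  face_measurable G -> (forall s, size (G s) <= m)%N -> 0 <= gamma ->
  mean_bounded f e gamma ->
  avg (fun x => face_condexp G e f x - trunc (face_condexp G e f x)) <=
  (2 ^ (#|J| * m))%:R * gamma.
Proof.
move=> mG Gm g0 fg; set b := face_condexp G e f.
set c := fcolor (#|J| * m) (boundary G e).
have cc x y : (c x == c y) = (color (boundary G e) x == color (boundary G e) y).
  exact/fcolor_eq/size_boundary.
have bc : invariant_under c b.
  by move=> x y /eqP; rewrite cc => /eqP; apply: condexp_inv.
have bU : invariant_under (color (boundary G e)) (fun x => ((1 < b x)%R)%:R : R).
  by move=> x y xy; rewrite /b /face_condexp (condexp_inv f xy).
(* The excess lives on the set where [1 < b], a union of cells, and on such a set [b] may be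
   replaced by [f] under the average. *)
have -> : avg (fun x => b x - trunc (b x)) = avg (fun x => (f x - 1) * (1 < b x)%R%:R).
  transitivity (avg (fun x => (1 < b x)%R%:R * b x) - avg (fun x => (1 < b x)%R%:R) : R).
    rewrite -avgB; apply: eq_avg => x; rewrite truncE.
    by case: lerP => _; rewrite ?mul1r // mul0r !subrr.
  rewrite (avg_condexp f bU) -avgB; apply: eq_avg => x; ring.
rewrite -(card_fcolor (#|J| * m)).
apply: (avg_cells_le g0 (c := c)) => [x y /bc -> //|x0].
have [S fS SE] := boundary_cell e x0 mG.
rewrite (@eq_avg _ _ _ (fun x => f x * ind_faces e S x - ind_faces e S x)); last first.
  by move=> x; rewrite SE cc; ring.
by rewrite avgB lerBlDl; apply: fg.
Qed.

(** At most one [k] in [e] satisfies [s = e :\ k], so [pick] never has to choose. *)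
Definition add_faces (G : face_system) (e : {set J}) (S : J -> {set X}) : face_system :=
  fun s => if [pick k in e | s == e :\ k] is Some k then S k :: G s else G s.

Lemma add_faces_sub G e S s : {subset G s <= add_faces G e S s}.
Proof.
by move=> A AG; rewrite /add_faces; case: pickP => // k _; rewrite inE AG orbT.
Qed.

Lemma size_add_faces G e S s : (size (add_faces G e S s) <= (size (G s)).+1)%N.
Proof. by rewrite /add_faces; case: pickP => // k _ /=. Qed.

Lemma add_faces_measurable G e S : face_measurable G -> face_sets e S ->
  face_measurable (add_faces G e S).
Proof.
move=> mG fS s A; rewrite /add_faces; case: pickP => [k /andP[ke /eqP ->]|_].
  by rewrite inE => /predU1P[->|/mG//]; apply: fS.
exact: mG.
Qed.

Lemma add_faces_mem G e S k : k \in e -> S k \in add_faces G e S (e :\ k).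
Proof.
move=> ke; rewrite /add_faces; case: pickP => [k' /andP[k'e /eqP ek]|/(_ k)].
  suff -> : k = k' by rewrite mem_head.
  by apply/eqP; have := setD11 k e; rewrite ek !inE ke andbT => /negbFE.
by rewrite ke eqxx.
Qed.

Lemma boundary_sub G G' e : (forall s, {subset G s <= G' s}) ->
  {subset boundary G e <= boundary G' e}.
Proof.
by move=> sG S /boundaryP[k ke /sG SG]; apply/boundaryP; exists k.
Qed.

Lemma add_faces_invariant G e S :
  invariant_under (color (boundary (add_faces G e S) e)) (ind_faces e S).
Proof.
move=> x y /eqP/color_eqP xy; rewrite !ind_facesE; congr (nat_of_bool _)%:R.
apply: eq_forallb_in => k ke; apply: xy; apply/boundaryP; exists k => //.
exact: add_faces_mem.
Qed.

End Faces.

(** * Regularity lemmas *)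

Section Regularity.
Variables (R : realType) (J : finType).

Section OneSpace.
Variable W : J -> finType.
Local Notation X := ({dffun forall j : J, W j}).
Hypothesis W0 : forall j, (0 < #|W j|)%N.

Variables (T : finType) (e : T -> {set J}) (f : T -> X -> R).

Definition energy (G : face_system W) : R :=
  \sum_t avg (fun x => energy_fun (face_condexp G (e t) (f t) x)).

(** Every summand of the energy grows under refinement, so the total increment bounds that of the
    single index [t]. *)
Lemma energy_sub_at (G G' : face_system W) t : (forall s, {subset G s <= G' s}) ->
  avg (fun x => (trunc (face_condexp G' (e t) (f t) x) -
                 trunc (face_condexp G (e t) (f t) x)) ^+ 2) <= energy G' - energy G.
Proof.
move=> sG; rewrite /energy (bigD1 t) //= [X in _ - X](bigD1 t) //=.
apply: le_trans (energy_increment (f t) _) _.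
  by move=> x y; apply: color_sub; apply: boundary_sub.
rewrite opprD addrACA lerDl subr_ge0; apply: ler_sum => t' _; rewrite -subr_ge0.
apply: le_trans (energy_increment (f t') _); last first.
  by move=> x y; apply: color_sub; apply: boundary_sub.
by apply: avg_ge0 => x; apply: sqr_ge0.
Qed.

Hypothesis f_ge0 : forall t x, 0 <= f t x.
Hypothesis f_avg : forall t, avg (f t) <= 2.

Lemma energy_ge0 G : 0 <= energy G.
Proof.
apply: sumr_ge0 => t _; apply: avg_ge0 => x; apply: energy_fun_ge0.
exact: condexp_ge0.
Qed.

Lemma energy_le G : energy G <= 4 * #|T|%:R.
Proof.
rewrite /energy; apply: (@le_trans _ _ (\sum_(t : T) 4)); last first.
  by rewrite sumr_const [leRHS]mulr_natr.
apply: ler_sum => t _; apply: (@le_trans _ _ (2 * avg (f t))); last first.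
  by have := f_avg t; lra.
rewrite -(avg_condexp1 (color (boundary G (e t))) (f t)) -avgZ; apply: ler_avg => x.
by apply: energy_fun_le; apply: condexp_ge0.
Qed.

Variables (M : nat) (gamma kappa : R).
Hypothesis gamma0 : 0 <= gamma.
Hypothesis kappa0 : 0 < kappa.
Hypothesis f_mean : forall t, mean_bounded (f t) (e t) gamma.
Hypothesis gamma_small : (2 ^ (#|J| * M))%:R * gamma <= kappa / 2.

Definition all_cut_le G :=
  forall t, cut_le (fun x => f t x - trunc (face_condexp G (e t) (f t) x)) (e t) kappa.

(** Once added to the partition, a test that violates the cut bound no longer distinguishes [f] from
    its new conditional expectation. It therefore correlates with the difference of the old and new
    ones; the truncation excess costs at most [kappa / 2], and Cauchy-Schwarz turns the remaining
    [kappa / 2] into an energy gain. *)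
Lemma energy_add_faces G t S : face_measurable G -> (forall s, size (G s) < M)%N ->
  face_sets (e t) S ->
  kappa < `|avg (fun x => (f t x - trunc (face_condexp G (e t) (f t) x)) *
                          ind_faces R (e t) S x)| ->
  kappa ^+ 2 / 4 <= energy (add_faces G (e t) S) - energy G.
Proof.
move=> mG GM fS; set D := ind_faces R (e t) S.
set G' := add_faces G (e t) S.
have D01 x : 0 <= D x <= 1.
  by rewrite /D ind_facesE; case: [forall _ in _, _]; rewrite ?lexx ?ler01.
set a := face_condexp G _ _; set b := face_condexp G' (e t) (f t).
have -> : avg (fun x => (f t x - trunc (a x)) * D x) =
  avg (fun x => (trunc (b x) - trunc (a x)) * D x) + avg (fun x => (b x - trunc (b x)) * D x).
  rewrite -avgD (eq_avg (fun x => mulrBl _ _ _)) avgB.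
  have <- : avg (fun x => b x * D x) = avg (fun x => f t x * D x).
    rewrite (eq_avg (fun x => mulrC (b x) (D x))) avg_condexp.
      by apply: eq_avg => x; rewrite mulrC.
    exact: add_faces_invariant.
  by rewrite -avgB; apply: eq_avg => x; ring.
move=> big.
have ex : `|avg (fun x => (b x - trunc (b x)) * D x)| <= kappa / 2.
  have bt x : 0 <= b x - trunc (b x) by rewrite subr_ge0 /trunc ge_min lexx.
  rewrite ger0_norm; last first.
    by apply: avg_ge0 => x; rewrite mulr_ge0 //; have /andP[] := D01 x.
  apply: (@le_trans _ _ (avg (fun x => b x - trunc (b x)))).
    by apply: ler_avg => x; rewrite ler_piMr //; have /andP[] := D01 x.
  apply: le_trans gamma_small; apply: trunc_excess => //.
    exact: add_faces_measurable.
  by move=> s; apply: leq_trans (size_add_faces _ _ _ _) (GM s).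
have h : kappa / 2 <= `|avg (fun x => (trunc (b x) - trunc (a x)) * D x)|.
  by have := ler_normD (avg (fun x => (trunc (b x) - trunc (a x)) * D x))
    (avg (fun x => (b x - trunc (b x)) * D x)); lra.
have XT : (0 < #|{: X}|)%N by apply: card_prod_space_gt0.
apply: le_trans (energy_sub_at t _); last exact: add_faces_sub.
apply: (@le_trans _ _ (avg (fun x => ((trunc (b x) - trunc (a x)) * D x) ^+ 2))); last first.
  apply: ler_avg => x; rewrite exprMn ler_piMr ?sqr_ge0 //.
  by have /andP[D0 D1] := D01 x; rewrite expr_le1.
apply: le_trans (sqr_avg_le _ XT); rewrite -[leRHS]real_normK ?num_real //.
have -> : kappa ^+ 2 / 4 = (kappa / 2) ^+ 2 by field.
by rewrite ler_sqr ?nnegrE ?divr_ge0 // ltW.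
Qed.

(** [p] counts the refinements still available: each gains [kappa ^+ 2 / 4], and the energy never
    exceeds [4 * #|T|%:R]. *)
Lemma weak_regularity_iter p G : face_measurable G ->
  (forall s, size (G s) + p <= M)%N ->
  4 * #|T|%:R < energy G + p%:R * (kappa ^+ 2 / 4) ->
  exists G', [/\ face_measurable G', forall s, (size (G' s) <= M)%N,
    forall s, {subset G s <= G' s} & all_cut_le G'].
Proof.
elim: p G => [|p IH] G mG GM en.
  by have := energy_le G; rewrite mul0r addr0 in en; lra.
have [ok|] := pselect (all_cut_le G).
  exists G; split => // s; last by move=> A.
  by apply: leq_trans (leq_addr _ _) (GM s).
move=> /existsNP[t] /existsNP[S] /not_implyP[fS] /negP; rewrite -ltNge => big.
have GltM s : (size (G s) < M)%N.
  by apply: leq_trans (GM s); rewrite addnS ltnS leq_addr.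
have inc := energy_add_faces mG GltM fS big.
have [] := IH (add_faces G (e t) S).
- exact: add_faces_measurable.
- move=> s; apply: leq_trans (GM s); rewrite addnS -addSn leq_add2r.
  exact: size_add_faces.
- by move: en inc; rewrite -natr1; lra.
move=> G' [mG' G'M sG cutG']; exists G'; split => // s A AG.
exact/sG/add_faces_sub.
Qed.

End OneSpace.

Lemma weak_regularity (n m : nat) (kappa : R) : 0 < kappa ->
  exists (M : nat) (gamma0 : R), 0 < gamma0 /\
  forall (W : J -> finType), (forall j, (0 < #|W j|)%N) ->
  forall (T : finType) (e : T -> {set J}) (f : T -> {dffun forall j, W j} -> R) gamma,
    (#|T| <= n)%N -> (forall t x, 0 <= f t x) -> (forall t, avg (f t) <= 2) ->
    0 <= gamma <= gamma0 -> (forall t, mean_bounded (f t) (e t) gamma) ->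
  forall G : face_system W, face_measurable G -> (forall s, size (G s) <= m)%N ->
  exists G', [/\ face_measurable G', forall s, (size (G' s) <= M)%N,
    forall s, {subset G s <= G' s} & all_cut_le e f kappa G'].
Proof.
move=> k0.
have k4 : 0 < kappa ^+ 2 / 4 by rewrite divr_gt0 // exprn_gt0.
(* Enough steps to exhaust the energy bound. Each lengthens a list by at most one, whence the
   complexity [m + p]; the second witness keeps the truncation excess below [kappa / 2] at that
   complexity. *)
pose p := (Num.bound (4 * n%:R / (kappa ^+ 2 / 4))).
exists (m + p)%N, (kappa / 2 / (2 ^ (#|J| * (m + p)))%:R).
have p2 : 0 < (2 ^ (#|J| * (m + p)))%:R :> R by rewrite ltr0n expn_gt0.
split; first by rewrite divr_gt0 // divr_gt0.
move=> W W0 T e f gamma Tn f0 f2 /andP[g0 gs] fm G mG Gm.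
have gk : (2 ^ (#|J| * (m + p)))%:R * gamma <= kappa / 2.
  by rewrite mulrC -ler_pdivlMr.
apply: (weak_regularity_iter W0 f0 f2 g0 k0 fm gk (p := p)) => //.
- by move=> s; rewrite leq_add2r.
apply: (@lt_le_trans _ _ (p%:R * (kappa ^+ 2 / 4))); last first.
  by rewrite lerDr energy_ge0.
rewrite -ltr_pdivrMr //; apply: le_lt_trans (archi_boundP _).
  by rewrite ler_pM2r ?invr_gt0 // ler_pM2l // ler_nat.
by apply: divr_ge0; [apply: mulr_ge0|apply: ltW].
Qed.

Lemma mean_bounded_le1 (W : J -> finType) (f : {dffun forall j, W j} -> R) e :
  (forall x, f x <= 1) -> mean_bounded f e 0.
Proof.
move=> f1 S fS; rewrite addr0; apply: ler_avg => x; rewrite ind_facesE.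
by case: [forall _ in _, _]; rewrite ?mulr0 // mulr1.
Qed.

Lemma trunc_id (t : R) : t <= 1 -> trunc t = t.
Proof. by rewrite truncE => ->. Qed.

(** Weak regularity is applied with tolerance [F m] at the current complexity [m], until a
    refinement gains at most [zeta]; the last two partitions are then close in mean square. The
    number [p] bounds the gains still possible. For [f <= 1] truncation changes nothing. *)
Lemma strong_regularity (n : nat) (zeta : R) (F : nat -> R) : 0 < zeta ->
  (forall m, 0 < F m) ->
  exists M : nat, forall (W : J -> finType), (forall j, (0 < #|W j|)%N) ->
  forall (T : finType) (e : T -> {set J}) (f : T -> {dffun forall j, W j} -> R),
    (#|T| <= n)%N -> (forall t x, 0 <= f t x <= 1) ->
  exists (m : nat) (G1 G2 : face_system W), [/\ face_measurable G1, face_measurable G2,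
    (m <= M)%N, forall s, (size (G1 s) <= m)%N & forall t,
    avg (fun x => (face_condexp G2 (e t) (f t) x - face_condexp G1 (e t) (f t) x) ^+ 2)
      <= zeta /\
    cut_le (fun x => f t x - face_condexp G2 (e t) (f t) x) (e t) (F m)].
Proof.
move=> z0 F0.
suff main p m : exists M : nat, forall (W : J -> finType), (forall j, (0 < #|W j|)%N) ->
  forall (T : finType) (e : T -> {set J}) (f : T -> {dffun forall j, W j} -> R),
    (#|T| <= n)%N -> (forall t x, 0 <= f t x <= 1) ->
  forall G, face_measurable G -> (forall s, size (G s) <= m)%N ->
    4 * n%:R < energy e f G + p%:R * zeta ->
  exists (m : nat) (G1 G2 : face_system W), [/\ face_measurable G1, face_measurable G2,
    (m <= M)%N, forall s, (size (G1 s) <= m)%N & forall t,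
    avg (fun x => (face_condexp G2 (e t) (f t) x - face_condexp G1 (e t) (f t) x) ^+ 2)
      <= zeta /\
    cut_le (fun x => f t x - face_condexp G2 (e t) (f t) x) (e t) (F m)].
  have [M HM] := main (Num.bound (4 * n%:R / zeta)) 0%N.
  exists M => W W0 T e f Tn f01; apply: (HM W W0 T e f Tn f01 (fun=> [::])) => //.
  apply: (@lt_le_trans _ _ ((Num.bound (4 * n%:R / zeta))%:R * zeta)).
    rewrite -ltr_pdivrMr //; apply: archi_boundP.
    by apply: divr_ge0; [apply: mulr_ge0|apply: ltW].
  by rewrite lerDr energy_ge0 // => t x; have /andP[] := f01 t x.
elim: p m => [|p IH] m.
  exists 0%N => W W0 T e f Tn f01 G mG Gm; rewrite mul0r addr0 => en.
  have f0 t x : 0 <= f t x by have /andP[] := f01 t x.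
  have f2 t : avg (f t) <= 2.
    by apply: avg_le => // x; have /andP[_ f1] := f01 t x; lra.
  have := energy_le e f0 f2 G.
  have : #|T|%:R <= n%:R :> R by rewrite ler_nat.
  lra.
have [M1 [g0 [g0p HM1]]] := weak_regularity n m (F0 m).
have [M2 HM2] := IH M1.
exists (maxn m M2) => W W0 T e f Tn f01 G mG Gm en.
have f0 t x : 0 <= f t x by have /andP[] := f01 t x.
have f1 t x : f t x <= 1 by have /andP[] := f01 t x.
have f2 t : avg (f t) <= 2 by apply: avg_le => // x; have := f1 t x; lra.
have g00 : 0 <= (0 : R) <= g0 by rewrite lexx ltW.
have [G' [mG' G'M sG cutG']] := HM1 W W0 T e f 0 Tn f0 f2 g00
  (fun t => mean_bounded_le1 (f1 t)) G mG Gm.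
have t1 G0 t x : trunc (face_condexp G0 (e t) (f t) x) = face_condexp G0 (e t) (f t) x.
  by apply: trunc_id; apply: condexp_le.
have [small|large] := lerP (energy e f G' - energy e f G) zeta.
  exists m, G, G'; split => //; first exact: leq_maxl.
  move=> t; split.
    apply: le_trans small; apply: le_trans (@energy_sub_at W T e f G G' t sG).
    by apply: ler_avg => x; rewrite !t1.
  move=> S fS; apply: le_trans (cutG' t S fS); rewrite le_eqVlt; apply/orP; left.
  by apply/eqP; congr (`|_|); apply: eq_avg => x; rewrite t1.
have [] := HM2 W W0 T e f Tn f01 G' mG' G'M.
  by move: en large; rewrite -natr1; lra.
move=> m' [G1 [G2 [mG1 mG2 m'M G1m' ok]]]; exists m', G1, G2; split => //.
by apply: leq_trans m'M _; apply: leq_maxr.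
Qed.

End Regularity.

Lemma positive_lower_bound (R : realType) (c : nat -> R) (M : nat) :
  (forall m, 0 < c m) -> exists2 b, 0 < b & forall m, (m <= M)%N -> b <= c m.
Proof.
move=> c0; elim: M => [|M [b b0 bc]]; first by exists (c 0%N) => // m; rewrite leqn0 => /eqP ->.
exists (Num.min b (c M.+1)); first by rewrite lt_min b0 c0.
move=> m; rewrite leq_eqVlt => /predU1P[->|]; first by rewrite ge_min lexx orbT.
by rewrite ltnS => /bc h; rewrite ge_min h.
Qed.

(** * Simultaneous regularity for faces of all sizes *)

Section MultiLevel.
Variables (R : realType) (J : finType) (eta zeta : nat -> R) (n : nat).
Hypothesis eta_gt0 : forall m, 0 < eta m.
Hypothesis zeta_gt0 : forall m, 0 < zeta m.

Definition ind_color (W : J -> finType) m (L : seq {set {dffun forall j, W j}})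
  (sigma : {ffun 'I_m -> bool}) (x : {dffun forall j, W j}) : R :=
  (fcolor m L x == sigma)%:R.

(* The level [i] of the tower colours the faces of size [i]; [Gf i] is the finer
   system relative to which the colours of level [i + 1] are uniform. *)
Definition regular_tower (W : J -> finType) (j : nat) (a : R)
    (Gc Gf : nat -> face_system W) (ms : nat -> nat) :=
  [/\ forall i, (i <= j)%N -> face_measurable (Gc i),
      forall i, (i <= j)%N -> forall s, (size (Gc i s) <= ms i)%N,
      forall i, face_measurable (Gf i) &
      forall i, (i < j)%N -> forall s sigma,
        let f := ind_color (m := ms i.+1) (Gc i.+1 s) sigma in
        avg (fun x => (face_condexp (Gf i) s f x - face_condexp (Gc i) s f x) ^+ 2)
          <= zeta (ms i.+1) /\
        cut_le (fun x => f x - face_condexp (Gf i) s f x) s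
          (a * (\prod_(i < j) eta (ms i.+1)) ^+ n)].

(** Induction on the height, from the top level down. The factor [a] collects the thresholds of the
    levels already built, so that every level is measured against the product over the whole
    tower. *)
Lemma regular_tower_exists (j m : nat) (a : R) : 0 < a ->
  exists (c : R) (M : nat), 0 < c /\
  forall (W : J -> finType), (forall j, (0 < #|W j|)%N) ->
  forall G : face_system W, face_measurable G -> (forall s, size (G s) <= m)%N ->
  exists (Gc Gf : nat -> face_system W) (ms : nat -> nat),
    [/\ Gc j = G, ms j = m, forall i, (i <= j)%N -> (ms i <= M)%N,
        c <= \prod_(i < j) eta (ms i.+1) & regular_tower j a Gc Gf ms].
Proof.
elim: j m a => [|j IH] m a a0.
  exists 1, m; split => // W W0 G mG Gm.
  exists (fun=> G), (fun=> fun=> [::]), (fun=> m); split => //.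
  by rewrite big_ord0.
have am0 : 0 < a * eta m ^+ n by rewrite mulr_gt0 // exprn_gt0.
have /choice[cM /all_and2[c0 HcM]] m' : exists cM : R * nat, 0 < cM.1 /\
    forall (W : J -> finType), (forall j, (0 < #|W j|)%N) ->
    forall G : face_system W, face_measurable G -> (forall s, size (G s) <= m')%N ->
    exists (Gc Gf : nat -> face_system W) (ms : nat -> nat),
      [/\ Gc j = G, ms j = m', forall i, (i <= j)%N -> (ms i <= cM.2)%N,
        cM.1 <= \prod_(i < j) eta (ms i.+1) &
        regular_tower j (a * eta m ^+ n) Gc Gf ms].
  by have [c [M [c0 H]]] := IH m' _ am0; exists (c, M).
(* [(cM m').1] bounds from below the product of the thresholds of a tower whose top has complexity
   [m']. So [F m'] is small enough whatever complexities appear below. *)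
pose F m' := a * eta m ^+ n * (cM m').1 ^+ n.
have F0 m' : 0 < F m' by rewrite mulr_gt0 // exprn_gt0.
have [M0 HM0] := strong_regularity J #|{: {set J} * {ffun 'I_m -> bool}}| (zeta_gt0 m) F0.
have [b b0 bc] := positive_lower_bound M0 c0.
exists (b * eta m), (maxn m (\max_(m' < M0.+1) (cM m').2)).
split; first by rewrite mulr_gt0.
move=> W W0 G mG Gm.
have f01 (t : {set J} * {ffun 'I_m -> bool}) x : 0 <= ind_color (G t.1) t.2 x <= 1.
  by rewrite /ind_color; case: (_ == _); rewrite ?lexx ?ler01.
have [m' [G1 [G2 [mG1 mG2 m'M G1m' HG]]]] :=
  HM0 W W0 _ (fun t => t.1) (fun t => ind_color (G t.1) t.2) (leqnn _) f01.
have [Gc [Gf [ms [Gcj msj msM cms [mGc Gcms mGf reg]]]]] := HcM m' W W0 G1 mG1 G1m'.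
pose ms' i := if i == j.+1 then m else ms i.
have prodE : \prod_(i < j.+1) eta (ms' i.+1) = \prod_(i < j) eta (ms i.+1) * eta m.
  rewrite big_ord_recr /= /ms' eqxx; congr (_ * _); apply: eq_bigr => i _.
  by rewrite eqSS ltn_eqF.
exists (fun i => if i == j.+1 then G else Gc i), (fun i => if i == j then G2 else Gf i), ms'.
have ltj i : (i <= j.+1)%N -> i != j.+1 -> (i <= j)%N.
  by move=> ij ne; move: ij; rewrite leq_eqVlt (negbTE ne).
rewrite /ms' eqxx; split => //.
- move=> i ij; case: eqVneq => [_|ne]; first exact: leq_maxl.
  apply: leq_trans (msM i (ltj i ij ne)) _; apply: leq_trans (leq_maxr _ _).
  have m'M' : (m' < M0.+1)%N by [].
  exact: (leq_bigmax (F := fun m' : 'I_M0.+1 => (cM m').2) (Ordinal m'M')).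
- rewrite [leRHS]prodE ler_pM2r //; apply: le_trans cms; exact: bc.
rewrite -/ms'; split.
- by move=> i ij; case: eqVneq => // ne; apply: mGc; apply: ltj.
- by move=> i ij; rewrite /ms'; case: eqVneq => // ne; apply: Gcms; apply: ltj.
- by move=> i; case: eqP.
move=> i ij s; rewrite prodE exprMn [X in a * X]mulrC mulrA /ms' eqSS.
have [->|ne] := eqVneq i j.
  rewrite ltn_eqF // => sigma; have [h1 h2] := HG (s, sigma).
  split; first by rewrite Gcj.
  move=> S fS; apply: le_trans (h2 S fS) _.
  rewrite /F ler_pM2l // lerXn2r // ?nnegrE //; first exact: ltW.
  by apply: prodr_ge0 => k _; apply: ltW.
move=> sigma; have ij' : (i < j)%N by rewrite ltn_neqAle ne -ltnS.
rewrite (_ : i == j.+1 = false); last by rewrite ltn_eqF // ltnW.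
exact: reg.
Qed.

End MultiLevel.

(** * The counting lemma *)

Section BundlePoints.
Variables (R : realType) (J : finType) (W : J -> finType).
Local Notation X := ({dffun forall j : J, W j}).
Hypothesis W0 : forall j, (0 < #|W j|)%N.

Section OneBundle.
Variable I : finType.

(** [I] indexes the copies of each vertex class, and [v.2] is the class of the vertex [v]. *)
Definition bundle_space := {dffun forall v : I * J, W v.2}.
Local Notation XI := bundle_space.
Implicit Types (g h : {set I * J}) (x y : XI) (z : X).

Definition single_valued g := {in g &, injective snd}.

Definition base g : {set J} := [set v.2 | v in g].

(* [z] only supplies the coordinates outside [base g]. *)
Definition point g z x : X :=
  finfun (fun j : J => if [pick i | (i, j) \in g] is Some i then x (i, j) : W j else z j).

Definition implant g x z : XI :=
  finfun (fun v : I * J => if v \in g then z v.2 else x v).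

Lemma point_in g z x i j : single_valued g -> (i, j) \in g -> point g z x j = x (i, j).
Proof.
move=> vg ij; rewrite ffunE; case: pickP => [i' i'j|/(_ i)]; last by rewrite ij.
by have [->] := vg _ _ i'j ij erefl.
Qed.

Lemma point_out g z x j : j \notin base g -> point g z x j = z j.
Proof.
move=> jg; rewrite ffunE; case: pickP => // i ij.
by case/negP: jg; apply/imsetP; exists (i, j).
Qed.

Lemma implantE g x z v : implant g x z v = if v \in g then z v.2 else x v.
Proof. by rewrite ffunE. Qed.

Lemma baseP g j : reflect (exists i, (i, j) \in g) (j \in base g).
Proof.
apply: (iffP imsetP) => [[[i k] ik ->]|[i ij]]; first by exists i.
by exists (i, j).
Qed.

(** Exchanging the coordinates along [g] with those of an independent point is an involution; it
    yields both averaging identities [avg_point] and [avg_implant]. *)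
Lemma implant_pointK g : single_valued g ->
  involutive (fun p : XI * X => (implant g p.1 p.2, point g p.2 p.1)).
Proof.
move=> vg [x z] /=; congr (_, _).
  apply/ffunP => -[i j]; rewrite implantE; case: ifP => ij.
    by rewrite (point_in _ _ vg ij).
  by rewrite implantE ij.
apply/ffunP => j; have [/baseP[i ij]|jg] := boolP (j \in base g).
  by rewrite (point_in _ _ vg ij) implantE ij.
by rewrite !point_out.
Qed.

Lemma bundle_space_gt0 : (0 < #|{: XI}|)%N.
Proof. by apply: card_prod_space_gt0 => v. Qed.

Lemma space_gt0 : (0 < #|{: X}|)%N.
Proof. exact: card_prod_space_gt0. Qed.

Lemma point_dep g z z' x (Y : Type) (F : X -> Y) : single_valued g ->
  depends_on (base g) F -> F (point g z x) = F (point g z' x).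
Proof.
move=> vg dF; apply: dF => j /baseP[i ij].
by rewrite !(point_in _ _ vg ij).
Qed.

Lemma avg_point g z0 (F : X -> R) : single_valued g -> depends_on (base g) F ->
  avg (fun x => F (point g z0 x)) = avg F.
Proof.
move=> vg dF.
transitivity (avg (fun p : XI * X => F (point g p.2 p.1))).
  rewrite avg_pair; apply: eq_avg => x /=.
  rewrite (@eq_avg _ _ _ (fun=> F (point g z0 x))); last by move=> z; apply: point_dep.
  by rewrite avg_const ?space_gt0.
rewrite (avg_involutive (fun p : XI * X => F p.2) (implant_pointK vg)).
rewrite avg_pair (@eq_avg _ _ _ (fun=> avg F)) ?avg_const ?bundle_space_gt0 //.
Qed.

Lemma avg_implant g (F : XI -> R) : single_valued g ->
  avg (fun x => avg (fun z => F (implant g x z))) = avg F.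
Proof.
move=> vg; rewrite -(avg_pair (fun p : XI * X => F (implant g p.1 p.2))).
rewrite (avg_involutive (fun p : XI * X => F p.1) (implant_pointK vg)) avg_pair.
by apply: eq_avg => x /=; rewrite avg_const ?space_gt0.
Qed.

Lemma point_eq g z x y : {in g, forall v, x v = y v} -> point g z x = point g z y.
Proof.
move=> xy; apply/ffunP => j; rewrite !ffunE; case: pickP => // i ij.
exact: (xy (i, j)).
Qed.

Lemma single_valued_sub g h : h \subset g -> single_valued g -> single_valued h.
Proof. by move=> /subsetP hg vg u v /hg ug /hg; apply: vg. Qed.

Lemma baseS g h : h \subset g -> base h \subset base g.
Proof. exact: imsetS. Qed.

Lemma card_base g : single_valued g -> #|base g| = #|g|.
Proof. by move=> vg; apply: card_in_imset. Qed.

End OneBundle.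

Section Transport.
Variables (I I' : finType) (psi : I * J -> I').
Hypothesis psi_inj : forall i i' j, psi (i, j) = psi (i', j) -> i = i'.

(** [psi] may depend on the whole vertex: in a doubling, the second copy is glued to the first along
    the vertices of one face. *)
Definition transport (h : {set I * J}) : {set I' * J} := [set (psi v, v.2) | v in h].

Lemma transport_inj_vertex : injective (fun v : I * J => (psi v, v.2)).
Proof. by move=> [i j] [i' j'] [/= + jj']; rewrite jj' => /psi_inj ->. Qed.

Lemma transport_inj : injective transport.
Proof. exact/imset_inj/transport_inj_vertex. Qed.

Lemma base_transport h : base (transport h) = base h.
Proof. by rewrite /base /transport -imset_comp; apply: eq_imset. Qed.

Lemma card_transport h : #|transport h| = #|h|.
Proof. exact/card_imset/transport_inj_vertex. Qed.

Lemma single_valued_transport h : single_valued h -> single_valued (transport h).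
Proof.
move=> vh u v /imsetP[u0 u0h ->] /imsetP[v0 v0h ->] /= uv.
by rewrite (vh _ _ u0h v0h uv).
Qed.

Lemma transport_sub h (k : {set I' * J}) : k \subset transport h ->
  exists2 h' : {set I * J}, h' \subset h & k = transport h'.
Proof.
move=> /subsetP kh; exists [set v in h | (psi v, v.2) \in k].
  by apply/subsetP => v; rewrite inE => /andP[].
apply/setP => u; apply/idP/imsetP => [uk|[v]].
  have /imsetP[v vh uE] := kh _ uk.
  by exists v => //; rewrite inE vh -uE.
by rewrite inE => /andP[_ vk] ->.
Qed.

Lemma point_transport h z (x : bundle_space I) (x' : bundle_space I') :
  single_valued h -> {in h, forall v, x v = x' (psi v, v.2)} ->
  point (transport h) z x' = point h z x.
Proof.
move=> vh xx'; have vh' := single_valued_transport vh.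
apply/ffunP => j; have [/baseP[i ij]|jh] := boolP (j \in base h).
  have ij' : (psi (i, j), j) \in transport h by apply/imsetP; exists (i, j).
  by rewrite (point_in _ _ vh ij) (point_in _ _ vh' ij') (xx' _ ij).
by rewrite !point_out // base_transport.
Qed.

End Transport.

Section Doubling.
Variable I : finType.
Local Notation XI := (bundle_space I).
Local Notation I2 := (bool * I)%type.

Definition join_points (x y : XI) : bundle_space I2 :=
  finfun (fun u : I2 * J => if u.1.1 then y (u.1.2, u.2) : W u.2 else x (u.1.2, u.2)).

Definition left_copy (v : I * J) : I2 := (false, v.1).

Definition glued_copy (g0 : {set I * J}) (v : I * J) : I2 := (v \notin g0, v.1).

Lemma left_copy_inj i i' (j : J) : left_copy (i, j) = left_copy (i', j) -> i = i'.
Proof. by case. Qed.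

Lemma glued_copy_inj g0 i i' (j : J) : glued_copy g0 (i, j) = glued_copy g0 (i', j) -> i = i'.
Proof. by case. Qed.

Lemma avg_join (F : bundle_space I2 -> R) :
  avg (fun x => avg (fun y => F (join_points x y))) = avg F.
Proof.
rewrite -(avg_pair (fun p : XI * XI => F (join_points p.1 p.2))).
apply: avg_bij.
pose back (w : bundle_space I2) : XI * XI :=
  (finfun (fun v : I * J => w ((false, v.1), v.2) : W v.2),
   finfun (fun v : I * J => w ((true, v.1), v.2) : W v.2)).
exists back => [[x y]|w].
  by congr (_, _); apply/ffunP => -[i j]; rewrite !ffunE.
by apply/ffunP => -[[[] i] j]; rewrite !ffunE.
Qed.

Lemma point_left h z x y : single_valued h ->
  point (transport left_copy h) z (join_points x y) = point h z x.
Proof.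
move=> vh; apply: point_transport => // v vh'.
by rewrite ffunE /=; case: v vh'.
Qed.

Lemma point_glued g0 h z x y : single_valued h ->
  point (transport (glued_copy g0) h) z (join_points x y) = point h z (mix g0 x y).
Proof.
move=> vh; apply: point_transport => // v vh'.
rewrite [RHS]ffunE mixE /=; case: (v \in g0); by case: v vh'.
Qed.

End Doubling.
End BundlePoints.

(** Arithmetic of the induction step in [config_bounds]: [m] is the main term, [s] and [t] are the
    two errors, each at most an eighth of the lower bound [x]. *)
Lemma config_step_bounds (R : realType) (x y c m s t : R) :
  x <= m -> m <= y -> 0 < x -> x <= c -> c <= y ->
  - (x / 8) <= s -> s <= x / 8 -> - (x / 8) <= t -> t <= x / 8 ->
  x / 2 <= m + t + s <= 2 * y.
Proof. by move=> *; apply/andP; split; lra. Qed.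

Section Counting.
Variables (R : realType) (J : finType) (W : J -> finType).
Local Notation X := ({dffun forall j : J, W j}).
Hypothesis W0 : forall j, (0 < #|W j|)%N.
Variables (z0 : X) (D : {set {set J}}) (A : {set J} -> {set X}) (delta : {set J} -> R).
Variables (err unif : {set J} -> X -> R) (eta : nat -> R) (p kappa : R) (Nm : nat).

Definition lower_cell (e : {set J}) (z : X) : bool :=
  [forall f : {set J}, (f \proper e) ==> (z \in A f)].

Hypothesis D_down : forall e f : {set J}, e \in D -> f \subset e -> f \in D.
Hypothesis A_dep : forall e, e \in D -> depends_on e (fun x => x \in A e).
Hypothesis A_set0 : A set0 = setT.
Hypothesis delta_set0 : delta set0 = 1.
Hypothesis err_dep : forall e, e \in D -> depends_on e (err e).
Hypothesis unif_dep : forall e, e \in D -> depends_on e (unif e).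
Hypothesis decomposition : forall e, e \in D -> e != set0 -> forall z, lower_cell e z ->
  (z \in A e)%:R = delta e + err e z + unif e z.
Hypothesis eta_bounds : forall e, e \in D -> e != set0 -> eta #|e| <= delta e.
Hypothesis eta_gt0 : forall j, 0 < eta j.
Hypothesis eta_le1 : forall j, eta j <= 1.
Hypothesis p_gt0 : 0 < p.
Hypothesis p_bound : forall e, e \in D -> p <= delta e.
Hypothesis p_le1 : p <= 1.
(** In the exponent of [1/2], [3 * Nm] pays for the upper bounds of the two configurations produced
    by Cauchy-Schwarz, and [2 * Nm + 4] is the square of the wanted factor [(1/2) ^+ (Nm + 2)]. *)
Definition err_tolerance j : R := (1/2) ^+ (5 * Nm + 4) * eta j ^+ (2 * Nm).
Hypothesis err_small : forall e, e \in D -> e != set0 ->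
  avg (fun z => (lower_cell e z)%:R * err e z ^+ 2) <=
  err_tolerance #|e| * avg (fun z => (lower_cell e z)%:R).
Hypothesis unif_small : forall e, e \in D -> e != set0 -> cut_le (unif e) e kappa.
Hypothesis kappa_small : kappa <= (1/2) ^+ (Nm + 2) * p ^+ Nm.

Lemma delta_gt0 e : e \in D -> 0 < delta e.
Proof. by move=> eD; apply: lt_le_trans p_gt0 (p_bound eD). Qed.

Section Bundles.
Variable I : finType.
Local Notation XI := (bundle_space W I).
Implicit Types (G L : {set {set I * J}}) (g h : {set I * J}).

(** Hypergraph bundles over [D]: a class of configurations that is closed under the doubling caused
    by Cauchy-Schwarz. *)
Definition bundle G := forall g, g \in G ->
  [/\ single_valued g, base g \in D & forall h, h \subset g -> h \in G].

Definition in_config G (x : XI) : bool :=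
  [forall g : {set I * J}, (g \in G) ==> (point g z0 x \in A (base g))].

Definition config_avg G : R := avg (fun x => (in_config G x)%:R).

Definition config_weight G : R := \prod_(g in G) delta (base g).

Lemma in_configP G x :
  reflect (forall g, g \in G -> point g z0 x \in A (base g)) (in_config G x).
Proof. by apply: (iffP forallP) => h g; [move=> gG; have := h g; rewrite gG|apply/implyP/h]. Qed.

Lemma in_configU G L x : in_config (G :|: L) x = in_config G x && in_config L x.
Proof.
apply/in_configP/andP => [h|[/in_configP hG /in_configP hL] g].
  by split; apply/in_configP => g gG; apply: h; rewrite inE gG ?orbT.
by rewrite inE => /orP[/hG|/hL].
Qed.

Lemma config_weight_gt0 G : bundle G -> 0 < config_weight G.
Proof. by move=> bG; apply: prodr_gt0 => g /bG[_ /delta_gt0]. Qed.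

Lemma config_weight_ge G : bundle G -> (#|G| <= Nm)%N -> p ^+ Nm <= config_weight G.
Proof.
move=> bG GN; apply: (@le_trans _ _ (p ^+ #|G|)).
  by apply: ler_wiXn2l => //; apply: ltW.
rewrite -prodr_const; apply: ler_prod => g /bG[_ gD _].
by rewrite p_bound // ltW.
Qed.

Lemma bundle_sub_D1 G g0 : bundle G -> (forall g, g \in G -> g0 \subset g -> g = g0) ->
  bundle (G :\ g0).
Proof.
move=> bG g0max g; rewrite inE => /andP[gg0 gG]; have [vg gD gdown] := bG g gG.
split => // h hg; rewrite !inE gdown // andbT.
by apply: contraNneq gg0 => hg0; rewrite inE; apply/eqP; apply: (g0max g gG); rewrite -?hg0.
Qed.

Lemma point_restrict g h x : single_valued g -> h \subset g -> base h \in D ->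
  (point h z0 x \in A (base h)) = (point g z0 x \in A (base h)).
Proof.
move=> vg hg hD; apply: (A_dep hD) => j /baseP[i ij].
by rewrite (point_in _ _ (single_valued_sub hg vg) ij)
  (point_in _ _ vg (subsetP hg _ ij)).
Qed.

(** On a single-valued [g], projection to [J] identifies the proper subfaces of [g] with the proper
    subsets of [base g]. *)
Lemma lower_config g x : single_valued g -> base g \in D ->
  in_config [set h : {set I * J} | h \proper g] x = lower_cell (base g) (point g z0 x).
Proof.
move=> vg gD; apply/in_configP/forallP => [hyp f|hyp h].
  apply/implyP => fg; pose h := [set v in g | v.2 \in f].
  have hg : h \subset g by apply/subsetP => v; rewrite inE => /andP[].
  have bh : base h = f.
    apply/setP => j; apply/baseP/idP => [[i]|jf]; first by rewrite inE => /andP[].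
    have /baseP[i ij] := subsetP (proper_sub fg) _ jf.
    by exists i; rewrite inE ij.
  have hpg : h \proper g.
    rewrite properEneq hg andbT; apply: contraTneq fg => hg'.
    by rewrite -bh hg' properxx.
  have := hyp h; rewrite inE => /(_ hpg); rewrite (point_restrict _ vg) ?bh //.
  exact: D_down gD (proper_sub fg).
rewrite inE => hg; have hg' := proper_sub hg.
rewrite (point_restrict _ vg hg'); last exact: D_down gD (baseS hg').
have := hyp (base h); rewrite properEcard baseS //=.
by rewrite !card_base ?proper_card //; apply: single_valued_sub vg.
Qed.

(* With the coordinates outside [g0] frozen, every other member of the configuration
   misses a coordinate of [g0], so only the cut norm of [f] matters. *)
Lemma cut_config G g0 (f : X -> R) (c : R) : single_valued g0 -> (forall g, g \in G -> single_valued g) ->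
  (forall g, g \in G -> base g \in D) ->
  (forall g, g \in G -> ~~ (g0 \subset g)) ->
  depends_on (base g0) f -> cut_le f (base g0) c ->
  `|avg (fun x => f (point g0 z0 x) * (in_config G x)%:R)| <= c.
Proof.
move=> vg0 vG GD Gg0 fdep cf.
have c0 : 0 <= c.
  apply: le_trans (cf (fun=> setT) _); first exact: normr_ge0.
  by move=> k _ x y _; rewrite !inE.
rewrite -(@avg_implant _ _ _ W0 _ g0) //.
apply: le_trans (ler_norm_avg _) _; apply: avg_le => // y.
have fE z : f (point g0 z0 (implant g0 y z)) = f z.
  apply: fdep => j /baseP[i ij]; by rewrite (point_in _ _ vg0 ij) implantE ij.
(* [S k] imposes the members that miss the vertex of [g0] over [k]. Every member misses some vertex
   of [g0], so the sets [S k] together impose the whole configuration. *)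
pose S k := [set z | [forall g : {set I * J},
   ((g \in G) && [forall v : I * J, ((v \in g0) && (v.2 == k)) ==> (v \notin g)]) ==>
   (point g z0 (implant g0 y z) \in A (base g))]].
have fS : face_sets (base g0) S.
  move=> k kg0 z z' zz'; rewrite !inE; apply: eq_forallb => g.
  case: andP => // -[gG /forallP gk] /=.
  suff -> : point g z0 (implant g0 y z) = point g z0 (implant g0 y z') by [].
  apply: point_eq => v vg; rewrite !implantE; case: ifP => // vg0'.
  apply: (zz' v.2); rewrite !inE; apply/andP; split.
    by have := gk v; rewrite vg0' /=; case: eqP => //= _; rewrite vg.
  by apply/imsetP; exists v.
apply: le_trans (cf S fS); rewrite le_eqVlt; apply/orP; left; apply/eqP.
congr (`|_|); apply: eq_avg => z; rewrite fE ind_facesE; congr (_ * (nat_of_bool _)%:R).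
apply/in_configP/forall_inP => [h k kg0|h g gG].
  by rewrite inE; apply/forallP => g; apply/implyP => /andP[/h].
have /subsetPn[v vg0' vg] := Gg0 g gG.
have /h : v.2 \in base g0 by apply/imsetP; exists v.
rewrite inE => /forallP/(_ g); rewrite gG /= => /implyP; apply.
apply/forallP => u; apply/implyP => /andP[ug0 /eqP uv].
by rewrite (vg0 _ _ ug0 vg0' uv).
Qed.

End Bundles.

Section Doubled.
Variable I : finType.
Variables (L : {set {set I * J}}) (g0 : {set I * J}).

Definition outer : {set {set I * J}} := [set h in L | ~~ (h \subset g0)].

(** The two copies share the members inside [g0]; only the outer ones are duplicated, which is why
    the weight in [doubled_weight] is not a full square. *)
Definition doubled : {set {set (bool * I) * J}} :=
  [set transport (@left_copy J I) h | h in L] :|: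
  [set transport (glued_copy g0) h | h in outer].

Lemma transport_glued_sub (h : {set I * J}) : h \subset g0 ->
  transport (glued_copy g0) h = transport (@left_copy J I) h.
Proof.
move=> /subsetP hg; apply: eq_in_imset => v /hg vg.
by rewrite /glued_copy vg.
Qed.

Lemma doubled_bundle : bundle L -> bundle doubled.
Proof.
move=> bL g; rewrite inE => /orP[] /imsetP[h hL ->].
  have [vh hD hdown] := bL h hL; split; first exact: single_valued_transport.
    by rewrite base_transport.
  move=> k /transport_sub[h' h'h ->]; rewrite inE; apply/orP; left.
  by apply: imset_f; apply: hdown.
have hL' : h \in L by move: hL; rewrite inE => /andP[].
have [vh hD hdown] := bL h hL'; split; first exact: single_valued_transport.
  by rewrite base_transport.
move=> k /transport_sub[h' h'h ->]; rewrite inE; have h'L := hdown h' h'h.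
have [h'g|h'g] := boolP (h' \subset g0).
  by rewrite transport_glued_sub // imset_f.
by rewrite [X in _ || X]imset_f ?orbT // inE h'L.
Qed.

(** The glued copy of an outer member has a vertex in the second copy, which no left copy has. *)
Lemma doubled_disjoint : [disjoint [set transport (@left_copy J I) h | h in L] &
  [set transport (glued_copy g0) h | h in outer]].
Proof.
rewrite disjoints_subset; apply/subsetP => g /imsetP[h hL ->]; rewrite inE.
apply/negP => /imsetP[h' + E]; rewrite inE => /andP[_ /subsetPn[v vh' vg]].
have : (glued_copy g0 v, v.2) \in transport (@left_copy J I) h.
  by rewrite E; apply/imsetP; exists v.
by case/imsetP => u _ [] /negbFE; rewrite (negbTE vg).
Qed.

Lemma card_doubled : (#|doubled| <= 2 * #|L|)%N.
Proof.
rewrite mul2n -addnn (leq_trans (leq_card_setU _ _)) // leq_add //.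
  exact: leq_imset_card.
apply: leq_trans (leq_imset_card _ _) _; apply: subset_leq_card.
by apply/subsetP => h; rewrite inE => /andP[].
Qed.

Lemma doubled_weight : config_weight doubled = config_weight L * config_weight outer.
Proof.
rewrite /config_weight /doubled.
rewrite (eq_bigl (fun g => (g \in [set transport (@left_copy J I) h | h in L]) ||
   (g \in [set transport (glued_copy g0) h | h in outer]))); last first.
  by move=> g; rewrite inE.
rewrite bigU ?doubled_disjoint //; congr (_ * _).
- rewrite big_imset /=; last by move=> h h' _ _; apply/transport_inj/left_copy_inj.
  by apply: eq_bigr => h _; rewrite base_transport.
- rewrite big_imset /=; last by move=> h h' _ _; apply/transport_inj/glued_copy_inj.
  by apply: eq_bigr => h _; rewrite base_transport.
Qed.

Lemma doubled_config (x y : bundle_space W I) : bundle L ->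
  in_config doubled (join_points x y) = in_config L x && in_config L (mix g0 x y).
Proof.
move=> bL; rewrite in_configU.
have -> : in_config [set transport (@left_copy J I) h | h in L] (join_points x y) =
    in_config L x.
  apply/in_configP/in_configP => [H h hL|H g /imsetP[h hL ->]].
    have [vh _ _] := bL h hL; have := H _ (imset_f _ hL).
    by rewrite base_transport point_left.
  have [vh _ _] := bL h hL.
  by rewrite base_transport point_left //; apply: H.
case: (boolP (in_config L x)) => //= /in_configP Lx.
apply/in_configP/in_configP => [H h hL|H g /imsetP[h hL ->]].
  have [vh hD _] := bL h hL; have [hg|hg] := boolP (h \subset g0).
    rewrite (@point_eq _ _ _ _ _ _ x) ?Lx // => v vh'.
    by rewrite mixE (subsetP hg).
  have ho : h \in outer by rewrite inE hL.
  by have := H _ (imset_f _ ho); rewrite base_transport point_glued.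
have hL' : h \in L by move: hL; rewrite inE => /andP[].
have [vh _ _] := bL h hL'.
by rewrite base_transport point_glued //; apply: H.
Qed.

Lemma avg_doubled : bundle L ->
  avg (fun x => avg (fun y => (in_config L x && in_config L (mix g0 x y))%:R)) =
  config_avg doubled.
Proof.
move=> bL; rewrite /config_avg -avg_join; apply: eq_avg => x; apply: eq_avg => y.
by rewrite doubled_config.
Qed.

(* Cauchy-Schwarz in the coordinates off [g0]; squaring the inner average produces the
   doubled configuration. *)
Lemma cs_config (f : X -> R) : single_valued g0 -> base g0 \in D -> bundle L ->
  (forall h : {set I * J}, h \proper g0 -> h \in L) -> depends_on (base g0) f ->
  avg (fun x => `|f (point g0 z0 x)| * (in_config L x)%:R) ^+ 2 <=
  avg (fun z => (lower_cell (base g0) z)%:R * f z ^+ 2) * config_avg doubled.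
Proof.
move=> vg0 g0D bL Lg0 fdep.
pose lo := [set h : {set I * J} | h \proper g0].
pose Q x : R := avg (fun y => (in_config L (mix g0 x y))%:R).
have ptm x y : point g0 z0 (mix g0 x y) = point g0 z0 x.
  by apply: point_eq => v vg; rewrite mixE vg.
have loE x y : in_config lo (mix g0 x y) = in_config lo x.
  by rewrite !lower_config // ptm.
have Llo x : in_config L x -> in_config lo x.
  by move=> /in_configP H; apply/in_configP => h; rewrite inE => /Lg0/H.
(* The conditions on proper subfaces of [g0] are implied by [L] and involve only the coordinates of
   [g0], so they can serve as the weight in Cauchy-Schwarz. This keeps the error relative to the
   lower cell. *)
have QE x : (in_config lo x)%:R * Q x = Q x.
  rewrite /Q -avgZ; apply: eq_avg => y; rewrite -(loE x y).
  case: (boolP (in_config L _)) => [/Llo ->|_]; first by rewrite mulr1.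
  by rewrite mulr0.
have -> : avg (fun x => `|f (point g0 z0 x)| * (in_config L x)%:R) =
    avg (fun x => (in_config lo x)%:R * (`|f (point g0 z0 x)| * Q x)).
  rewrite -(avg_mix _ g0); apply: eq_avg => x; rewrite mulrCA QE -avgZ.
  by apply: eq_avg => y; rewrite ptm.
apply: le_trans (cauchy_schwarz_avg _ _ _) _; first by move=> x; apply: ler0n.
apply: ler_pM.
- by apply: avg_ge0 => x; rewrite mulr_ge0 ?ler0n ?sqr_ge0.
- by apply: avg_ge0 => x; rewrite mulr_ge0 ?ler0n ?sqr_ge0.
- have Fdep : depends_on (base g0) (fun z => (lower_cell (base g0) z)%:R * f z ^+ 2).
    move=> z z' zz' /=; rewrite (fdep _ _ zz'); congr (_%:R * _).
    congr nat_of_bool; apply: eq_forallb => e; case: (boolP (e \proper _)) => //= eg.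
    apply: A_dep; first exact: D_down g0D (proper_sub eg).
    by move=> k ke; apply: zz'; apply: (subsetP (proper_sub eg)).
  rewrite -(avg_point W0 z0 vg0 Fdep) le_eqVlt; apply/orP; left; apply/eqP.
  by apply: eq_avg => x /=; rewrite lower_config // real_normK ?num_real.
rewrite -avg_doubled // le_eqVlt; apply/orP; left; apply/eqP.
rewrite -[RHS](avg_mix _ g0); apply: eq_avg => x.
rewrite expr2 mulrA QE /Q -avgZ; under eq_avg do rewrite mulrC -avgZ.
rewrite avg_exchange; apply: eq_avg => y; apply: eq_avg => y'.
have -> : mix g0 (mix g0 x y) y' = mix g0 x y'.
  by apply/ffunP => v; rewrite !mixE; case: (v \in g0).
by case: (in_config L _); case: (in_config L _); rewrite ?mulr0 ?mulr1 ?mul0r.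
Qed.

End Doubled.

(** Induction on the largest size of a member, then on the number of members: a largest [g0] is
    removed and its indicator replaced by [delta + err + unif]. The [err] term doubles the
    configuration but leaves only members of smaller size, so the budget [#|G| * 2 ^ j <= Nm] pays
    for all doublings still to come. The upper bound is part of the induction because the [err]
    estimate consumes it. *)
Lemma config_bounds j (I : finType) (G : {set {set I * J}}) : bundle G ->
  (forall g, g \in G -> (#|g| <= j)%N) -> (#|G| * 2 ^ j <= Nm)%N ->
  (1/2) ^+ #|G| * config_weight G <= config_avg G <= 2 ^+ #|G| * config_weight G.
Proof.
have [h hdef] : exists h : R, 1/2 = h by exists (1/2).
have h0 : 0 < h by lra.
have h1 : h <= 1 by lra.
have ks := kappa_small; rewrite hdef in ks *.
elim: j I G => [|j IHj] I G.
  move=> bG Gj _; have G0 g : g \in G -> g = set0.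
    by move=> /Gj; rewrite leqn0 cards_eq0 => /eqP.
  have b0 : base (set0 : {set I * J}) = set0 by rewrite /base imset0.
  have -> : config_avg G = 1.
    rewrite /config_avg (@eq_avg _ _ _ (fun=> 1)) ?avg_const ?bundle_space_gt0 // => x.
    suff -> : in_config G x by [].
    by apply/in_configP => g /G0 ->; rewrite b0 A_set0 inE.
  have -> : config_weight G = 1.
    by rewrite /config_weight big1 // => g /G0 ->; rewrite b0.
  by rewrite !mulr1 (exprn_ile1 _ (ltW h0) h1) exprn_ege1 // ler1n.
have [n] := ubnP #|G|; elim: n G => // n IHn G; rewrite ltnS => Gn bG Gj GN.
have [/existsP[g0 /andP[g0G /eqP g0j]]|] :=
  boolP [exists g0 : {set I * J}, (g0 \in G) && (#|g0| == j.+1)]; last first.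
  rewrite negb_exists => /forallP notop; apply: IHj => //.
    move=> g gG; have := notop g; rewrite gG /= => ne.
    by have := Gj g gG; rewrite leq_eqVlt (negbTE ne).
  by apply: leq_trans GN; rewrite leq_mul2l leq_exp2l ?leqnSn ?orbT.
have [vg0 g0D g0down] := bG g0 g0G.
have g0max g : g \in G -> g0 \subset g -> g = g0.
  by move=> gG g0g; apply/eqP; rewrite eq_sym eqEcard g0g g0j Gj.
set G0 := G :\ g0; have bG0 : bundle G0 by apply: bundle_sub_D1.
have cG : #|G| = #|G0|.+1 by rewrite (cardsD1 g0) g0G.
pose L := [set g in G | (#|g| <= j)%N].
have LG g : g \in L -> g \in G by rewrite inE => /andP[].
have LcG : (#|L| <= #|G|)%N by apply/subset_leq_card/subsetP.
have bL : bundle L.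
  move=> g gL; have [vg gD gdown] := bG g (LG g gL); split => // k hg.
  rewrite inE gdown //=; apply: leq_trans (subset_leq_card hg) _.
  by move: gL; rewrite inE => /andP[].
have Lg0 (k : {set I * J}) : k \proper g0 -> k \in L.
  move=> hg; rewrite inE g0down ?proper_sub //=.
  by rewrite -ltnS -g0j proper_card.
have GNm : (#|G| <= Nm)%N by apply: leq_trans GN; rewrite leq_pmulr // expn_gt0.
have e0n : base g0 != set0 by rewrite -cards_eq0 card_base // g0j.
have ebase : #|base g0| = j.+1 by rewrite card_base.
set e0 := base g0 in g0D e0n ebase.
have P0 := config_weight_gt0 bG0; set P0w := config_weight G0 in P0.
have PE : config_weight G = delta e0 * P0w.
  rewrite /config_weight (bigD1 g0) //=; congr (_ * _); apply: eq_bigl => g.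
  by rewrite !inE andbC.
have P_gt0 := config_weight_gt0 bG.
have GltG0 : (#|G0| < n)%N by rewrite -cG.
have G0j g : g \in G0 -> (#|g| <= j.+1)%N by rewrite inE => /andP[_ /Gj].
have G0N : (#|G0| * 2 ^ j.+1 <= Nm)%N.
  by apply: leq_trans GN; rewrite leq_mul2r cG leqnSn orbT.
have /andP[lo0 hi0] := IHn G0 GltG0 bG0 G0j G0N.
(* Having the largest size, [g0] is contained in no other member, so [cut_config] applies. *)
have unT : `|avg (fun x => unif e0 (point g0 z0 x) * (in_config G0 x)%:R)| <=
    h ^+ (#|G| + 2) * config_weight G.
  apply: (@le_trans _ _ kappa).
    apply: cut_config => //; last exact: unif_small; last exact: unif_dep.
    - by move=> g /bG0[].
    - by move=> g /bG0[].
    - move=> g gG0; apply/negP => g0g.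
      move: gG0; rewrite inE => /andP[/negP gg0 gG]; apply: gg0.
      by rewrite inE; apply/eqP/g0max.
  apply: le_trans ks _; apply: ler_pM.
  - exact/exprn_ge0/ltW.
  - exact/exprn_ge0/ltW.
  - by apply: ler_wiXn2l; [exact: ltW|exact: h1|rewrite leq_add2r].
  - exact: config_weight_ge.
(* All members of size [j.+1] are dropped first, so that the doubled configuration falls under the
   induction hypothesis for [j]. *)
have erT : `|avg (fun x => err e0 (point g0 z0 x) * (in_config G0 x)%:R)| <=
    h ^+ (#|G| + 2) * config_weight G.
  apply: (@le_trans _ _ (avg (fun x => `|err e0 (point g0 z0 x)| * (in_config L x)%:R))).
    apply: le_trans (ler_norm_avg _) _; apply: ler_avg => x; rewrite normrM.
    rewrite ler_wpM2l // ger0_norm ?ler0n // ler_nat.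
    case: (boolP (in_config G0 x)) => //= /in_configP HG.
    suff -> : in_config L x by [].
    apply/in_configP => g gL; apply: HG; rewrite !inE LG // andbT.
    by apply: contraTneq gL => ->; rewrite inE g0j ltnn andbF.
  have B0 : 0 <= h ^+ (#|G| + 2) * config_weight G.
    by apply: mulr_ge0; [exact/exprn_ge0/ltW|exact: ltW].
  rewrite -ler_sqr ?nnegrE //; last first.
    by apply: avg_ge0 => x; rewrite mulr_ge0 ?ler0n.
  apply: le_trans (cs_config vg0 g0D bL Lg0 (err_dep g0D)) _.
  pose lo := [set k : {set I * J} | k \proper g0].
  have loL : lo \subset L by apply/subsetP => k; rewrite inE => /Lg0.
  have blo : bundle lo.
    move=> k; rewrite inE => kg0; have [vk kD _] := bL k (Lg0 k kg0); split => // k' k'k.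
    by rewrite inE; apply: sub_proper_trans k'k kg0.
  have loj k : k \in lo -> (#|k| <= j)%N by move=> /(subsetP loL); rewrite inE => /andP[].
  have Lj2 : (2 * #|L| * 2 ^ j <= Nm)%N.
    apply: leq_trans GN; rewrite expnS [(2 * #|L|)%N]mulnC -mulnA.
    by rewrite leq_mul2r LcG orbT.
  have loN : (#|lo| * 2 ^ j <= Nm)%N.
    apply: leq_trans Lj2; rewrite leq_mul2r; apply/orP; right.
    by apply: leq_trans (subset_leq_card loL) _; rewrite leq_pmull.
  have /andP[_ hilo] := IHj I lo blo loj loN.
  have bdL : bundle (doubled L g0) by apply: doubled_bundle.
  have dLj g : g \in doubled L g0 -> (#|g| <= j)%N.
    rewrite inE => /orP[] /imsetP[k kL ->]; rewrite card_transport.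
    - by move: kL; rewrite inE => /andP[].
    - exact: left_copy_inj.
    - by move: kL; rewrite !inE => /andP[/andP[]].
    - exact: glued_copy_inj.
  have dLN : (#|doubled L g0| * 2 ^ j <= Nm)%N.
    by apply: leq_trans Lj2; rewrite leq_mul2r card_doubled orbT.
  have /andP[_ hid] := IHj _ _ bdL dLj dLN.
  have lowE : avg (fun z => (lower_cell e0 z)%:R) = config_avg lo.
    have dl : depends_on e0 (fun z => (lower_cell e0 z)%:R : R).
      move=> z z' zz'; congr (nat_of_bool _)%:R.
      apply: eq_forallb => e; case: (boolP (e \proper _)) => //= eg.
      apply: A_dep; first exact: D_down g0D (proper_sub eg).
      by move=> k ke; apply: zz'; apply: (subsetP (proper_sub eg)).
    rewrite -(avg_point W0 z0 vg0 dl); apply: eq_avg => x.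
    by rewrite lower_config.
  have wlo := config_weight_gt0 blo.
  have wL := config_weight_gt0 bL.
  have wo : 0 < config_weight (outer L g0).
    apply: prodr_gt0 => k; rewrite inE => /andP[/bL[_ kD _] _]; exact: delta_gt0.
  (* By this identity the Cauchy-Schwarz bound contains [config_weight L] as an exact square, so
     [err_tolerance] need not beat any density of a lower level. *)
  have wLE : config_weight L = config_weight lo * config_weight (outer L g0).
    rewrite /config_weight (bigID (fun k : {set I * J} => k \subset g0)) /=.
    congr (_ * _); apply: eq_bigl => k; last by rewrite [in RHS]inE.
    rewrite [in RHS]inE; apply/andP/idP => [[kL kg0]|kg0]; last by rewrite Lg0 // proper_sub.
    rewrite properEcard kg0 g0j ltnS.
    by move: kL; rewrite inE => /andP[].
  (* The dropped members all have size [j.+1], number at most [Nm], and have density at least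
     [eta j.+1]. *)
  have PLge : eta j.+1 ^+ Nm * config_weight L <= config_weight G.
    rewrite /config_weight [leRHS](bigID (fun g => g \in L)) /= mulrC.
    have -> : \prod_(g in G | g \in L) delta (base g) = config_weight L.
      by apply: eq_bigl => g; case: (boolP (g \in L)) => [/LG ->|]; rewrite ?andbF.
    rewrite ler_wpM2l ?(ltW wL) //.
    pose top := [set g in G | g \notin L].
    rewrite (eq_bigl (fun g => g \in top)); last by move=> g; rewrite [in RHS]inE.
    apply: (@le_trans _ _ (eta j.+1 ^+ #|top|)).
      apply: ler_wiXn2l => //; first exact: ltW.
      apply: leq_trans GNm; apply/subset_leq_card/subsetP => g.
      by rewrite inE => /andP[].
    rewrite -prodr_const; apply: ler_prod => g; rewrite inE => /andP[gG gL].
    rewrite ltW //=; have [vg gD _] := bG g gG.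
    have gj : #|base g| = j.+1.
      rewrite card_base //; apply/eqP; move: gL; rewrite inE gG /= -ltnNge => gj.
      by rewrite eqn_leq gj Gj.
    by rewrite -gj; apply: eta_bounds; rewrite // -cards_eq0 gj.
  have eN : 0 < eta j.+1 ^+ Nm by rewrite exprn_gt0.
  apply: (@le_trans _ _ (err_tolerance j.+1 * (2 ^+ Nm * config_weight lo) *
     (2 ^+ (2 * Nm) * (config_weight L * config_weight (outer L g0))))).
    have tol0 : 0 <= err_tolerance j.+1.
      by rewrite /err_tolerance hdef; apply: mulr_ge0; apply: exprn_ge0; apply: ltW.
    apply: ler_pM.
    - by apply: avg_ge0 => z; rewrite mulr_ge0 ?ler0n ?sqr_ge0.
    - by apply: avg_ge0 => z; rewrite ler0n.
    - apply: le_trans (err_small g0D e0n) _; rewrite ebase lowE ler_wpM2l //.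
      apply: le_trans hilo _; rewrite ler_pM2r // ler_eXn2l ?ltr1n //.
      by apply: leq_trans loN; rewrite leq_pmulr // expn_gt0.
    apply: le_trans hid _; rewrite doubled_weight ler_pM2r ?mulr_gt0 //.
    rewrite ler_eXn2l ?ltr1n //.
    apply: leq_trans (card_doubled _ _) _; rewrite leq_mul2l /=.
    exact: leq_trans LcG GNm.
  have -> : err_tolerance j.+1 * (2 ^+ Nm * config_weight lo) *
     (2 ^+ (2 * Nm) * (config_weight L * config_weight (outer L g0))) =
     (h ^+ (Nm + 2) * (eta j.+1 ^+ Nm * config_weight L)) ^+ 2.
    have hN : h ^+ Nm * 2 ^+ Nm = 1.
      have h2 : h * 2 = 1 by rewrite -hdef; field.
      by rewrite -exprMn h2 expr1n.
    have -> : err_tolerance j.+1 = (h ^+ Nm) ^+ 5 * h ^+ 4 * (eta j.+1 ^+ Nm) ^+ 2.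
      by rewrite /err_tolerance hdef exprD -!exprM [(Nm * 5)%N]mulnC [(Nm * 2)%N]mulnC.
    have -> : (2 : R) ^+ (2 * Nm) = (2 ^+ Nm) ^+ 2 by rewrite -exprM mulnC.
    rewrite wLE exprD.
    move: hN; set hn := h ^+ Nm; set tn := 2 ^+ Nm; set en := eta j.+1 ^+ Nm => hN.
    transitivity ((hn * tn) ^+ 3 * (hn ^+ 2 * h ^+ 4 * en ^+ 2 *
      (config_weight lo * config_weight (outer L g0)) ^+ 2)); first by ring.
    by rewrite hN; ring.
  have hN0 m : 0 <= h ^+ m by apply/exprn_ge0/ltW.
  have eL0 : 0 <= eta j.+1 ^+ Nm * config_weight L by apply/ltW/mulr_gt0.
  rewrite ler_sqr ?nnegrE //; last exact: mulr_ge0.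
  apply: ler_pM => //.
  by apply: ler_wiXn2l; [exact: ltW|exact: h1|rewrite leq_add2r].
have split : config_avg G = delta e0 * config_avg G0 +
    avg (fun x => err e0 (point g0 z0 x) * (in_config G0 x)%:R) +
    avg (fun x => unif e0 (point g0 z0 x) * (in_config G0 x)%:R).
  rewrite /config_avg -avgZ -!avgD; apply: eq_avg => x.
  have -> : in_config G x = (point g0 z0 x \in A e0) && in_config G0 x.
    apply/in_configP/andP => [H|[H0 /in_configP H] g gG].
      split; first exact: H.
      by apply/in_configP => g; rewrite inE => /andP[_ /H].
    have [->//|ne] := eqVneq g g0.
    by apply: H; rewrite !inE ne.
  case: (boolP (in_config G0 x)) => [/in_configP H|_]; last first.
    by rewrite andbF !mulr0 !addr0.
  rewrite andbT !mulr1; apply: decomposition => //.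
  rewrite -lower_config //; apply/in_configP => k; rewrite inE => kg0.
  apply: H; rewrite !inE LG ?Lg0 // andbT.
  by apply: contraTneq kg0 => ->; rewrite properxx.
move: split unT erT; set u := avg _; set v := avg _ => split.
rewrite !ler_norml => /andP[u1 u2] /andP[v1 v2].
have d0 := delta_gt0 g0D.
have lo1 : delta e0 * (h ^+ #|G0| * P0w) <= delta e0 * config_avg G0 by rewrite ler_pM2l.
have hi1 : delta e0 * config_avg G0 <= delta e0 * (2 ^+ #|G0| * P0w) by rewrite ler_pM2l.
rewrite split; rewrite cG in u1 u2 v1 v2 *; rewrite PE in u1 u2 v1 v2 P_gt0 *.
have hE : h ^+ (#|G0|.+1 + 2) = h ^+ #|G0| / 8.
  by rewrite addn2 !exprS; move: (h ^+ #|G0|) => q; rewrite -hdef; field.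
rewrite hE in u1 u2 v1 v2.
have hP : 0 < h ^+ #|G0| * (delta e0 * P0w) by rewrite mulr_gt0 // exprn_gt0.
have h1P : h ^+ #|G0| * (delta e0 * P0w) <= delta e0 * P0w.
  by apply: ler_piMl; [exact: ltW|apply: exprn_ile1; [exact: ltW|exact: h1]].
have h2P : delta e0 * P0w <= 2 ^+ #|G0| * (delta e0 * P0w).
  by apply: ler_peMl; [exact: ltW|apply: exprn_ege1; rewrite ler1n].
rewrite !exprS.
move: (h ^+ #|G0|) (2 ^+ #|G0|) lo1 hi1 hP h1P h2P u1 u2 v1 v2 => a b.
clear split; move: (config_avg G0) (delta e0) (P0w : R) (u : R) (v : R) => w d q s t.
have -> : d * (a * q) = a * (d * q) by ring.
have -> : d * (b * q) = b * (d * q) by ring.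
have -> : a / 8 * (d * q) = a * (d * q) / 8 by field.
have -> : h * a * (d * q) = a * (d * q) / 2 by rewrite -hdef; field.
rewrite -[2 * b * _]mulrA; move: (a * (d * q)) (b * (d * q)) (d * q) => x y c.
exact: config_step_bounds.
Qed.

End Counting.

(** * The dense removal lemma *)

Section BadCells.
Variables (R : realType) (T : finType) (S : finType) (C : eqType).
Variables (sigma : T -> S) (c : T -> C).

(** A colour occupies at most a share [eta] of the cells in which its density is below [eta]; the
    bounds add up over the colours. *)
Lemma avg_sparse_color (eta : R) : 0 <= eta ->
  avg (fun x => (condexp c (fun y => (sigma y == sigma x)%:R) x < eta)%R%:R : R) <=
  #|S|%:R * eta.
Proof.
move=> eta0; pose ce s := condexp c (fun y => (sigma y == s)%:R : R).
apply: (@le_trans _ _ (\sum_(s : S) avg (fun x => (ce s x < eta)%R%:R * (sigma x == s)%:R))).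
  rewrite -avg_sum; apply: ler_avg => x; rewrite (bigD1 (sigma x)) //= eqxx mulr1.
  by rewrite lerDl sumr_ge0 // => s _; rewrite mulr_ge0.
apply: (@le_trans _ _ (\sum_(s : S) eta)); last by rewrite sumr_const mulr_natl.
apply: ler_sum => s _.
rewrite -(@avg_condexp _ _ _ c); last by move=> x y /(condexp_inv _) ; rewrite /ce => ->.
apply: avg_le => // x; rewrite -/(ce s); case: (ltrP (ce s x) eta) => h.
  by rewrite mul1r ltW.
by rewrite mul0r.
Qed.

(** Markov's inequality for each colour, summed over the colours. *)
Lemma avg_large_condexp (g : S -> T -> R) (theta b : R) : 0 < theta ->
  (forall s x, 0 <= g s x) -> (forall s, avg (g s) <= b) ->
  avg (fun x => (theta < condexp c (g (sigma x)) x)%R%:R : R) <= #|S|%:R * (b / theta).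
Proof.
move=> theta0 g0 gb.
apply: (@le_trans _ _ (\sum_(s : S) avg (fun x => (theta < condexp c (g s) x)%R%:R))).
  rewrite -avg_sum; apply: ler_avg => x; rewrite (bigD1 (sigma x)) //=.
  by rewrite lerDl sumr_ge0.
apply: (@le_trans _ _ (\sum_(s : S) b / theta)); last by rewrite sumr_const mulr_natl.
apply: ler_sum => s _.
apply: (@le_trans _ _ (avg (fun x => condexp c (g s) x / theta))).
  apply: ler_avg => x; case: (ltrP theta (condexp c (g s) x)) => h /=.
    by rewrite ler_pdivlMr // mul1r ltW.
  by rewrite divr_ge0 ?condexp_ge0 // ltW.
by rewrite avgZr avg_condexp1 ler_pM2r ?invr_gt0.
Qed.

End BadCells.

Section LowerFaces.
Variables (J : finType) (W : J -> finType).

(** Unlike [boundary], this uses proper subfaces of every size: the cells in which the counting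
    lemma measures its error. *)
Definition lower_sets (G : face_system W) (e : {set J}) : seq {set {dffun forall j, W j}} :=
  flatten [seq G f | f <- enum [set f : {set J} | f \proper e]].

Lemma lower_setsP (G : face_system W) (e : {set J}) A :
  reflect (exists2 f : {set J}, f \proper e & A \in G f) (A \in lower_sets G e).
Proof.
apply: (iffP flatten_mapP) => -[f fe Af]; exists f => //.
  by rewrite mem_enum inE in fe.
by rewrite mem_enum inE.
Qed.

Lemma lower_colorP (G : face_system W) (e : {set J}) x y :
  reflect (forall f : {set J}, f \proper e -> color (G f) x = color (G f) y)
    (color (lower_sets G e) x == color (lower_sets G e) y).
Proof.
apply: (iffP (color_eqP _ _ _)) => [h f fe|h A /lower_setsP[f fe]].
  by apply/eqP/color_eqP => A Af; apply: h; apply/lower_setsP; exists f.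
by move: (h f fe) => /eqP/color_eqP; apply.
Qed.

End LowerFaces.

Lemma depends_on_set0 (J : finType) (W : J -> finType) (Y : Type)
  (f : {dffun forall j, W j} -> Y) x y : depends_on set0 f -> f x = f y.
Proof. by move=> df; apply: df => k; rewrite inE. Qed.

Lemma half_ge0 (R : realType) : 0 <= (1/2 : R).
Proof. lra. Qed.

Lemma half_le1 (R : realType) : (1/2 : R) <= 1.
Proof. lra. Qed.

Section DenseRemoval.
Variables (R : realType) (J : finType) (d : nat) (H : {set {set J}}).
Hypothesis H_card : forall e, e \in H -> #|e| = d.

Section Tower.
Variables (eps1 : R) (W : J -> finType) (F : {set J} -> {set {dffun forall j, W j}}).
Local Notation X := ({dffun forall j : J, W j}).
Hypothesis W0 : forall j, (0 < #|W j|)%N.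
Hypothesis eps1_gt0 : 0 < eps1.
Hypothesis eps1_le1 : eps1 <= 1.

Implicit Types (e f h s : {set J}).

Let Nm := (#|{set J}| * 2 ^ d)%N.

(** At complexity [m] there are [2 ^ m] colours, so those rarer than this threshold cover at most
    [eps1] of the space. *)
Definition density_threshold (m : nat) : R := eps1 / (2 ^ m)%:R.

Definition err_threshold (m : nat) : R :=
  (1/2) ^+ (5 * Nm + 4) * density_threshold m ^+ (2 * Nm).

(** Markov's inequality at level [err_threshold m], summed over [2 ^ m] colours, again loses
    [eps1]. *)
Definition tower_error (m : nat) : R := eps1 * err_threshold m / (2 ^ m)%:R.

Lemma density_threshold_gt0 m : 0 < density_threshold m.
Proof. by rewrite divr_gt0 // ltr0n expn_gt0. Qed.

Lemma density_threshold_le1 m : density_threshold m <= 1.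
Proof.
rewrite ler_pdivrMr ?ltr0n ?expn_gt0 // mul1r (le_trans eps1_le1) //.
by rewrite ler1n expn_gt0.
Qed.

Lemma err_threshold_gt0 m : 0 < err_threshold m.
Proof.
have h0 : 0 < (1/2 : R) by lra.
by rewrite mulr_gt0 ?exprn_gt0 ?density_threshold_gt0.
Qed.

Lemma tower_error_gt0 m : 0 < tower_error m.
Proof.
apply: divr_gt0; last by rewrite ltr0n expn_gt0.
by apply: mulr_gt0 => //; apply: err_threshold_gt0.
Qed.

Variables (Gc Gf : nat -> face_system W) (ms : nat -> nat).
Hypothesis tower :
  regular_tower density_threshold tower_error Nm d ((1/2) ^+ (Nm + 2)) Gc Gf ms.
Hypothesis Gc_top : forall e, e \in H -> Gc d e = [:: F e].

Definition coarse : face_system W := fun s => if (#|s| <= d)%N then Gc #|s| s else [::].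

Lemma coarse_measurable : face_measurable coarse.
Proof.
move=> s A; rewrite /coarse; case: ifP => // sd; have [mG _ _ _] := tower.
exact: mG.
Qed.

Lemma size_coarse s : (#|s| <= d)%N -> (size (coarse s) <= ms #|s|)%N.
Proof. by move=> sd; rewrite /coarse sd; have [_ + _ _] := tower; apply. Qed.

Definition face_color (f : {set J}) (x : X) := fcolor (ms #|f|) (coarse f) x.

Definition color_ind (f : {set J}) sigma (x : X) : R :=
  ind_color R (m := ms #|f|) (coarse f) sigma x.

Lemma face_color_eq f x y : (#|f| <= d)%N ->
  (face_color f x == face_color f y) = (color (coarse f) x == color (coarse f) y).
Proof. by move=> fd; apply/fcolor_eq/size_coarse. Qed.

Definition color_density f x : R :=
  face_condexp coarse f (color_ind (face_color f x)) x.

Definition color_err f sigma (x : X) : R :=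
  face_condexp (Gf #|f|.-1) f (color_ind (f := f) sigma) x -
  face_condexp coarse f (color_ind sigma) x.

Definition color_unif f sigma (x : X) : R :=
  color_ind (f := f) sigma x - face_condexp (Gf #|f|.-1) f (color_ind sigma) x.

Definition bad (f : {set J}) (x : X) : bool :=
  (color_density f x < density_threshold (ms #|f|)) ||
  (err_threshold (ms #|f|) <
    condexp (color (lower_sets coarse f)) (fun y => color_err (face_color f x) y ^+ 2) x).

Lemma face_condexp_coarse f (g : X -> R) : (0 < #|f| <= d)%N ->
  face_condexp coarse f g = face_condexp (Gc #|f|.-1) f g.
Proof.
move=> /andP[f0 fd]; rewrite /face_condexp; congr (condexp (color _) g).
rewrite /boundary; congr flatten; apply/eq_in_map => k; rewrite mem_enum => kf.
have ck : #|f :\ k| = #|f|.-1 by rewrite (cardsD1 k f) kf.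
by rewrite /coarse ck (leq_trans (leq_pred _) fd).
Qed.

Lemma tower_level f sigma : (0 < #|f| <= d)%N ->
  avg (fun x => color_err (f := f) sigma x ^+ 2) <= tower_error (ms #|f|) /\
  cut_le (color_unif (f := f) sigma) f
    ((1/2) ^+ (Nm + 2) * (\prod_(i < d) density_threshold (ms i.+1)) ^+ Nm).
Proof.
move=> fd; have [_ _ _ reg] := tower; have /andP[f0 fd'] := fd.
have fE : #|f|.-1.+1 = #|f| by rewrite prednK.
have fd1 : (#|f|.-1 < d)%N by rewrite fE.
have := reg _ fd1 f; rewrite fE => /(_ sigma)[].
rewrite /color_unif /color_err face_condexp_coarse // /color_ind.
by have -> : coarse f = Gc #|f| f by rewrite /coarse fd'.
Qed.

Lemma avg_bad f : (0 < #|f| <= d)%N -> avg (fun x => (bad f x)%:R : R) <= 2 * eps1.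
Proof.
move=> fd; have two0 : 0 < (2 ^ ms #|f|)%:R :> R by rewrite ltr0n expn_gt0.
have h1 := avg_sparse_color (face_color f) (color (boundary coarse f))
  (ltW (density_threshold_gt0 (ms #|f|))).
have h2 := avg_large_condexp (face_color f) (color (lower_sets coarse f))
  (g := fun c x => color_err (f := f) c x ^+ 2) (err_threshold_gt0 (ms #|f|))
  (fun c x => sqr_ge0 _) (fun c => (tower_level c fd).1).
rewrite card_fcolor in h1 h2.
have -> : 2 * eps1 = (2 ^ ms #|f|)%:R * density_threshold (ms #|f|) +
    (2 ^ ms #|f|)%:R * (tower_error (ms #|f|) / err_threshold (ms #|f|)).
  rewrite /tower_error /density_threshold; have := err_threshold_gt0 (ms #|f|).
  move: two0; move: (2 ^ ms #|f|)%:R (err_threshold _) => a b a0 b0.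
  by field; rewrite !gt_eqF.
apply: le_trans (lerD h1 h2); rewrite -avgD; apply: ler_avg => x.
rewrite -natrD ler_nat /bad /color_density /face_condexp /color_ind /ind_color /face_color.
by case: (_ < _); case: (_ < _).
Qed.

Definition cover_set (e : {set J}) : {set X} :=
  [set x | [exists y, [&& y \in F e, color (lower_sets coarse e) y == color (lower_sets coarse e) x &
     [forall f : {set J}, ((f \subset e) && (f != set0)) ==> ~~ bad f y]]]].

(** A point of [F e] outside its cover cannot be its own witness, so it is bad for some nonempty
    subface of [e]. *)
Lemma avg_uncovered e : e \in H ->
  avg (fun x => (x \in F e :\: cover_set e)%:R : R) <= #|{set J}|%:R * (2 * eps1).
Proof.
move=> eH; apply: (@le_trans _ _
    (\sum_(f : {set J} | (f \subset e) && (f != set0)) avg (fun x => (bad f x)%:R : R))).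
  rewrite -avg_sum; apply: ler_avg => x.
  have [] := boolP (x \in _); last by move=> _; apply: sumr_ge0.
  rewrite in_setD inE negb_exists => /andP[/forallP/(_ x) + xF].
  rewrite xF eqxx /= negb_forall => /existsP[f]; rewrite negb_imply negbK => /andP[fe bf].
  by rewrite (bigD1 f) //= bf lerDl sumr_ge0.
apply: (@le_trans _ _ (\sum_(f : {set J} | (f \subset e) && (f != set0)) 2 * eps1)).
  apply: ler_sum => f /andP[fe f0]; apply: avg_bad.
  by rewrite card_gt0 f0 -(H_card eH) subset_leq_card.
rewrite sumr_const -[leLHS]mulr_natl; apply: ler_wpM2r; last by rewrite ler_nat max_card.
by apply: mulr_ge0 => //; apply: ltW.
Qed.

Lemma coverP e x : reflect (exists y, [/\ y \in F e,
    forall f : {set J}, f \proper e -> color (coarse f) y = color (coarse f) x &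
    forall f : {set J}, f \subset e -> f != set0 -> ~~ bad f y]) (x \in cover_set e).
Proof.
rewrite inE; apply: (iffP existsP) => [[y /and3P[yF /lower_colorP yx /forallP nb]]|].
  by exists y; split => // f fe f0; have := nb f; rewrite fe f0.
move=> [y [yF yx nb]]; exists y; apply/and3P; split => //; first exact/lower_colorP.
by apply/forallP => f; apply/implyP => /andP[]; apply: nb.
Qed.

(** Each cover set through [x] supplies a regular point of [F e] with the lower cells of [x]. These
    witnesses agree on all lower cells, so together they select one cell per face, and the counting
    lemma applies to the selection. *)
Lemma cover_sets_meet x : (forall e, e \in H -> x \in cover_set e) ->
  (1/2) ^+ Nm * (\prod_(i < d) density_threshold (ms i.+1)) ^+ Nm <=
  avg (fun z => \prod_(e in H) (z \in F e)%:R : R).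
Proof.
move=> xH.
have /choice[y Hy] (e : {set J}) : exists y : X, e \in H -> [/\ y \in F e,
    forall f : {set J}, f \proper e -> color (coarse f) y = color (coarse f) x &
    forall f : {set J}, f \subset e -> f != set0 -> ~~ bad f y].
  have [/xH/coverP[y Hy]|_] := boolP (e \in H); first by exists y.
  by exists x.
pose D := [set f : {set J} | [exists e in H, f \subset e]].
have /choice[top Htop] (f : {set J}) : exists e : {set J}, f \in D -> e \in H /\ f \subset e.
  have [|_] := boolP (f \in D); last by exists set0.
  by rewrite inE => /existsP[e /andP[eH fe]]; exists e.
(* A face takes its cell from the witness of one edge containing it; below size [d] every witness
   gives the cell of [x]. *)
pose b f := y (top f).
have D_card f : f \in D -> (#|f| <= d)%N.
  by move=> /Htop[tH fs]; rewrite -(H_card tH) subset_leq_card.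
have b_color f h : f \in D -> h \proper f ->
    color (coarse h) (b f) = color (coarse h) x.
  move=> /Htop[tH fs] hf; have [_ + _] := Hy _ tH; apply.
  exact: proper_sub_trans hf fs.
have D_down (e f : {set J}) : e \in D -> f \subset e -> f \in D.
  rewrite !inE => /existsP[e' /andP[eH ee']] fe; apply/existsP; exists e'.
  by rewrite eH (subset_trans fe).
have b_lower f h : f \in D -> h \proper f ->
    color (coarse h) (b h) = color (coarse h) x.
  move=> fD hf; have [tH hs] := Htop _ (D_down _ _ fD (proper_sub hf)).
  have [_ + _] := Hy _ tH; apply; rewrite properEcard hs (H_card tH).
  exact: leq_trans (proper_card hf) (D_card f fD).
pose A f := [set z | color (coarse f) z == color (coarse f) (b f)].
have A0 : A set0 = setT.
  apply/setP => z; rewrite !inE; apply/eqP; apply: depends_on_set0.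
  exact/depends_on_color/coarse_measurable.
pose delta f := if f == set0 then 1 else color_density f (b f).
pose p := \prod_(i < d) density_threshold (ms i.+1).
have p_gt0 : 0 < p by apply: prodr_gt0 => i _; apply: density_threshold_gt0.
have thr_ge0 m := ltW (density_threshold_gt0 m).
have thr_le1 := density_threshold_le1.
have p_le1 : p <= 1.
  by apply: prodr_ile1 => i _; rewrite thr_ge0 thr_le1.
have p_thr f : (0 < #|f| <= d)%N -> p <= density_threshold (ms #|f|).
  move=> /andP[f0 fd]; have fd1 : (#|f|.-1 < d)%N by rewrite prednK.
  rewrite /p (bigD1 (Ordinal fd1)) //= prednK // ler_piMr //.
  by apply: prodr_ile1 => i _; rewrite thr_ge0 thr_le1.
have cardf f : f \in D -> f != set0 -> (0 < #|f| <= d)%N.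
  by move=> fD f0; rewrite card_gt0 f0 D_card.
have good f : f \in D -> f != set0 -> ~~ bad f (b f).
  by move=> fD f0; have [tH fs] := Htop f fD; have [_ _ +] := Hy _ tH; apply.
have dens f : f \in D -> f != set0 -> density_threshold (ms #|f|) <= delta f.
  move=> fD f0; have := good f fD f0.
  by rewrite /bad negb_or -leNgt => /andP[+ _]; rewrite /delta (negbTE f0).
have lowerE f z : f \in D ->
    lower_cell A f z = (color (lower_sets coarse f) z == color (lower_sets coarse f) (b f)).
  move=> fD; apply/forallP/lower_colorP => [h g gf|h g].
    have := h g; rewrite gf inE => /eqP ->.
    by rewrite (b_lower _ _ fD gf) (b_color _ _ fD gf).
  apply/implyP => gf; rewrite inE h //.
  by rewrite (b_lower _ _ fD gf) (b_color _ _ fD gf).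
(* The original configuration is the bundle with a single copy of each vertex class. *)
pose emb (f : {set J}) : {set unit * J} := [set (tt, j) | j in f].
pose G : {set {set unit * J}} := [set emb f | f : {set J} in D].
have unit_base f : base (emb f) = f by rewrite /base -imset_comp imset_id.
have unit_single (g : {set unit * J}) : single_valued g.
  by move=> [[] j] [[] j'] _ _ /= ->.
have unit_set (g : {set unit * J}) : g = emb (base g).
  apply/setP => -[[] j]; apply/idP/imsetP => [gj|[j' /baseP[[] ?] [->]] //].
  by exists j => //; apply/baseP; exists tt.
have bG : bundle D G.
  move=> g /imsetP[f fD ->]; rewrite unit_base; split => // h.
  move=> hf; rewrite (unit_set h); apply: imset_f; apply: D_down fD _.
  by rewrite -(unit_base f) baseS.
have Gcard : (#|G| <= #|{set J}|)%N.
  by apply: leq_trans (leq_imset_card _ _) _; apply: max_card.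
have Gd g : g \in G -> (#|g| <= d)%N.
  by move=> /imsetP[f fD ->]; rewrite card_imset ?D_card // => j j' [].
have GN : (#|G| * 2 ^ d <= Nm)%N by rewrite leq_mul2r Gcard orbT.
have GNm : (#|G| <= Nm)%N by apply: leq_trans GN; rewrite leq_pmulr // expn_gt0.
have p_delta f : f \in D -> p <= delta f.
  move=> fD; have [f0|f0] := eqVneq f set0; first by rewrite /delta f0 eqxx.
  exact: le_trans (p_thr f (cardf f fD f0)) (dens f fD f0).
have A_dep f : f \in D -> depends_on f (fun z => z \in A f).
  move=> fD z z' zz'; rewrite !inE.
  by rewrite (depends_on_color coarse_measurable zz').
have main : (1/2) ^+ #|G| * config_weight delta G <= config_avg R x A G.
  suff /andP[] : (1/2) ^+ #|G| * config_weight delta G <= config_avg R x A G <=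
    2 ^+ #|G| * config_weight delta G by [].
  apply: (@config_bounds R J W W0 x D A delta
    (fun f => color_err (face_color f (b f))) (fun f => color_unif (face_color f (b f)))
    (fun j => density_threshold (ms j)) p ((1/2) ^+ (Nm + 2) * p ^+ Nm) Nm
    D_down A_dep A0) => //.
  - by rewrite /delta eqxx.
  - move=> f fD z z' zz'; rewrite /color_err.
    have [_ _ mGf _] := tower.
    by rewrite (depends_on_condexp _ (mGf _) zz')
      (depends_on_condexp _ coarse_measurable zz').
  - move=> f fD z z' zz'; rewrite /color_unif /color_ind /ind_color.
    have [_ _ mGf _] := tower; rewrite (depends_on_condexp _ (mGf _) zz').
    rewrite (_ : fcolor _ _ z = fcolor (ms #|f|) (coarse f) z') //.
    apply/eqP; rewrite fcolor_eq; last exact/size_coarse/D_card.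
    by rewrite (depends_on_color coarse_measurable zz').
  - move=> f fD f0 z; rewrite lowerE // => /lower_colorP zb.
    rewrite /delta (negbTE f0) /color_unif /color_err /color_density inE.
    have -> : face_condexp coarse f (color_ind (face_color f (b f))) z =
        face_condexp coarse f (color_ind (face_color f (b f))) (b f).
      apply: condexp_inv; apply/eqP/color_eqP => S /boundaryP[k kf].
      have := zb (f :\ k) (properD1 kf) => /eqP/color_eqP; exact.
    rewrite {2 4}/color_ind /ind_color -/(face_color f z) face_color_eq ?D_card //.
    by ring.
  - by move=> j; apply: density_threshold_gt0.
  - move=> f fD f0 /=; rewrite -/(err_threshold _).
    have := good f fD f0; rewrite /bad negb_or -!leNgt => /andP[_].
    rewrite /condexp ler_pdivrMr; last first.
      by rewrite ltr0n; apply/card_gt0P; exists (b f); rewrite inE.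
    rewrite /avg mulrCA => h; apply: ler_wpM2l; first by rewrite invr_ge0.
    move: h; congr (_ <= _ * _).
      rewrite [LHS]big_mkcond; apply: eq_bigr => z _; rewrite lowerE //.
      by case: (_ == _); rewrite ?mul1r ?mul0r.
    rewrite -sum1_card natr_sum big_mkcond; apply: eq_bigr => z _; rewrite lowerE //.
    by rewrite inE; case: (_ == _).
  - by move=> f fD f0; have [_] := tower_level (face_color f (b f)) (cardf f fD f0).
  - exact: Gd.
  - exact: GN.
apply: le_trans (le_trans main _).
  apply: ler_pM.
  - exact/exprn_ge0/half_ge0.
  - exact/exprn_ge0/ltW.
  - by apply: ler_wiXn2l; [exact: half_ge0|exact: half_le1|exact: GNm].
  exact: (config_weight_ge p_gt0 p_delta p_le1 bG GNm).
(* Reading a point along [full] identifies the one-copy space with the original one. *)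
pose full : {set unit * J} := setT.
have fullE : base full = setT.
  by apply/setP => j; rewrite inE; apply/baseP; exists tt; rewrite inE.
have Fdep : depends_on (base full) (fun z => \prod_(e in H) (z \in F e)%:R : R).
  by move=> z z' zz'; have -> : z = z' by apply/ffunP => j; apply: zz'; rewrite fullE inE.
rewrite -(avg_point W0 x (unit_single full) Fdep); apply: ler_avg => w /=.
have [|_] := boolP (in_config x A G w); last by apply: prodr_ge0.
move=> /in_configP inG; rewrite big1 // => e eH.
have eD : e \in D by rewrite inE; apply/existsP; exists e; rewrite eH subxx.
have := inG _ (imset_f emb eD).
rewrite (point_restrict x A_dep w (unit_single full) (subsetT _)) unit_base //.
have [tH es] := Htop e eD.
(* All edges have size [d], so an edge takes its cell from its own witness, which lies in [F e]. *)
have te : top e = e by apply/eqP; rewrite eq_sym eqEcard es (H_card tH) (H_card eH) leqnn.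
have [yF _ _] := Hy e eH.
rewrite inE /b te /coarse (H_card eH) leqnn Gc_top //= => /eqP[->].
by rewrite yF.
Qed.

End Tower.
Lemma dense_removal (eps : R) : 0 < eps -> exists (c : R) (M : nat), 0 < c /\
  forall W : J -> finType, (forall j, (0 < #|W j|)%N) ->
  forall F : {set J} -> {set {dffun forall j : J, W j}},
    (forall e, e \in H -> depends_on e (fun x => x \in F e)) ->
    avg (fun x => \prod_(e in H) (x \in F e)%:R : R) < c ->
  exists (G : face_system W) (E : {set J} -> {set {dffun forall j : J, W j}}),
    [/\ face_measurable G, forall s, (size (G s) <= M)%N,
      forall e, e \in H -> invariant_under (color (lower_sets G e)) (fun x => x \in E e),
      forall x, exists2 e, e \in H & x \notin E e &
      forall e, e \in H -> avg (fun x => (x \in F e :\: E e)%:R : R) <= eps].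
Proof.
move=> eps0; pose K := #|{set J}|; pose Nm := (K * 2 ^ d)%N.
have K0 : (0 < K)%N by apply/card_gt0P; exists set0.
have KR : 0 < K%:R :> R by rewrite ltr0n.
have [eps1 [eps1_gt0 eps1_le1 Keps]] : exists eps1 : R,
    [/\ 0 < eps1, eps1 <= 1 & K%:R * (2 * eps1) <= eps].
  (* [avg_uncovered] loses [2 * eps1] for each of at most [K] subfaces. *)
  exists (Num.min eps 1 / (2 * K%:R)); have m0 : 0 < Num.min eps 1 by rewrite lt_min eps0 ltr01.
  have m1 : Num.min eps 1 <= 1 by rewrite ge_min lexx orbT.
  have me : Num.min eps 1 <= eps by rewrite ge_min lexx.
  have K1 : 1 <= K%:R :> R by rewrite ler1n.
  split.
  - by apply: divr_gt0 => //; apply: mulr_gt0.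
  - by rewrite ler_pdivrMr ?mulr_gt0 //; lra.
  apply: le_trans me; rewrite le_eqVlt; apply/orP; left; apply/eqP.
  by field; rewrite gt_eqF.
have a0 : 0 < (1/2 : R) ^+ (Nm + 2) by apply: exprn_gt0; lra.
have [c [M [c0 HM]]] := regular_tower_exists J Nm
  (density_threshold_gt0 eps1_gt0) (tower_error_gt0 eps1_gt0) d 1 a0.
exists ((1/2) ^+ Nm * c ^+ Nm), M; split.
  by apply: mulr_gt0; apply: exprn_gt0 => //; lra.
move=> W W0 F Fdep small.
(* The top of the tower, of complexity 1: each edge is coloured by [F e] itself. *)
pose G0 : face_system W := fun s => if s \in H then [:: F s] else [::].
have mG0 : face_measurable G0.
  move=> s A; rewrite /G0; case: ifP => // sH; rewrite inE => /eqP ->.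
  exact: Fdep.
have sG0 s : (size (G0 s) <= 1)%N by rewrite /G0; case: ifP.
have [Gc [Gf [ms [Gcd msd msM cms tower]]]] := HM W W0 G0 mG0 sG0.
have Gc_top e : e \in H -> Gc d e = [:: F e] by move=> eH; rewrite Gcd /G0 eH.
exists (coarse Gc), (cover_set eps1 F Gc Gf ms); split.
- exact: coarse_measurable tower.
- move=> s; have [sd|sd] := leqP #|s| d.
    exact: leq_trans (size_coarse tower sd) (msM _ sd).
  by rewrite /coarse; case: ifP => // sd'; rewrite ltnNge sd' in sd.
- move=> e eH x y /eqP/lower_colorP xy; apply/coverP/coverP => -[z [zF zc zb]];
    exists z; split => // f fe; by rewrite zc // xy.
- move=> x; apply: contrapT => no.
  have xH e : e \in H -> x \in cover_set eps1 F Gc Gf ms e.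
    by move=> eH; apply: contrapT => xE; apply: no; exists e => //; apply/negP.
  have := cover_sets_meet W0 eps1_gt0 eps1_le1 tower Gc_top xH.
  rewrite leNgt => /negP; apply; apply: lt_le_trans small _.
  apply: ler_pM.
  - exact/exprn_ge0/half_ge0.
  - exact/exprn_ge0/ltW.
  - exact: lexx.
  apply: lerXn2r cms; rewrite nnegrE; first exact: ltW.
  by apply: prodr_ge0 => i _; apply/ltW/density_threshold_gt0.
- by move=> e eH; apply: le_trans Keps; apply: (avg_uncovered _ eps1_gt0 tower).
Qed.

End DenseRemoval.

(** * A weighted Gowers-Cauchy-Schwarz inequality *)

Section Doubling.
Variables (R : realType) (J : finType) (W : J -> finType).
Local Notation X := ({dffun forall j : J, W j}).
Hypothesis W0 : forall j, (0 < #|W j|)%N.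
Implicit Types (F Phi Psi : X * X -> R) (k j : J) (l : seq J).

(** Coordinate [k] of the second point is the fresh variable of the Cauchy-Schwarz step in [k];
    [free_snd] says that it has not been used yet. *)
Definition swap_coord k (p : X * X) : X * X := (mix [set k] p.2 p.1, p.2).

Definition coord_double k F p : R := F p * F (swap_coord k p).

Definition coord_doubles l F := foldr coord_double F l.

Definition free_fst k F := forall x y z, F (mix [set k] z x, y) = F (x, y).
Definition free_snd k F := forall x y z, F (x, mix [set k] z y) = F (x, y).

Lemma mix1_mix1 k (x y z : X) : mix [set k] z (mix [set k] y x) = mix [set k] z x.
Proof. by apply/ffunP => j; rewrite !mixE; case: (j \in _). Qed.

Lemma mix1_mixl k (x y z : X) : mix [set k] (mix [set k] z y) x = mix [set k] z x.
Proof. by apply/ffunP => j; rewrite !mixE; case: (j \in _). Qed.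

Lemma mix1C k j (x y z : X) : k != j ->
  mix [set k] y (mix [set j] z x) = mix [set j] z (mix [set k] y x).
Proof.
move=> kj; apply/ffunP => i; rewrite !mixE !inE; case: eqP => // ->.
by rewrite (negbTE kj).
Qed.

Lemma mix1_mix_neq k j (x y z : X) : k != j ->
  mix [set k] (mix [set j] z y) x = mix [set k] y x.
Proof.
move=> kj; apply/ffunP => i; rewrite !mixE !inE; case: eqP => // ->.
by rewrite (negbTE kj).
Qed.

(** Cauchy-Schwarz in coordinate [k]: [Psi] ignores it, so only [Phi] is averaged over it, and the
    square of that average unfolds into [coord_double]. The majorant [Psih] serves as the weight,
    since [Psi] need not be bounded. *)
Lemma double_step k Phi Psi Psih : free_snd k Phi ->
  free_fst k Psi -> free_snd k Psi -> free_fst k Psih -> free_snd k Psih ->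
  (forall p, `|Psi p| <= Psih p) ->
  avg (fun p => Phi p * Psi p) ^+ 2 <= avg Psih * avg (fun p => Psih p * coord_double k Phi p).
Proof.
move=> Phi1 Psi0 Psi1 Psih0 Psih1 bound.
have Psih_ge0 p : 0 <= Psih p by apply: le_trans (bound p).
pose phi (p : X * X) := avg (fun z => Phi (mix [set k] z p.1, p.2)).
have avg_swap (F : X * X -> R) : avg F =
    avg (fun p => avg (fun z => F (mix [set k] z p.1, p.2))).
  rewrite avg_pair avg_exchange [RHS]avg_pair [RHS]avg_exchange; apply: eq_avg => y /=.
  by rewrite avg_exchange (avg_mix (fun x => F (x, y))).
have avg_swap2 (F : X * X -> R) : avg F =
    avg (fun p => avg (fun z => F (p.1, mix [set k] z p.2))).
  rewrite avg_pair [RHS]avg_pair; apply: eq_avg => x /=.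
  by rewrite avg_exchange (avg_mix (fun y => F (x, y))).
have -> : avg (fun p => Phi p * Psi p) = avg (fun p => Psi p * phi p).
  rewrite avg_swap; apply: eq_avg => -[x y] /=; rewrite /phi /= -avgZ.
  by apply: eq_avg => z; rewrite Psi0 mulrC.
have -> : avg (fun p => Psih p * coord_double k Phi p) = avg (fun p => Psih p * phi p ^+ 2).
  transitivity (avg (fun p : X * X =>
    avg (fun z => Psih p * (Phi p * Phi (mix [set k] z p.1, p.2))))).
    rewrite avg_swap2; apply: eq_avg => -[x y] /=; apply: eq_avg => z.
    by rewrite /coord_double /swap_coord /= Psih1 Phi1 mix1_mixl Phi1.
  rewrite avg_swap; apply: eq_avg => -[x y] /=; rewrite /phi /=.
  rewrite expr2 -[X in _ * X]avgZr -avgZ; apply: eq_avg => z.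
  rewrite -!avgZ; apply: eq_avg => z'.
  by rewrite Psih0 mix1_mix1.
have -> : avg (fun p => Psih p * phi p ^+ 2) =
    avg (fun p => Psih p * `|phi p| ^+ 2).
  by apply: eq_avg => p; rewrite real_normK ?num_real.
apply: (@le_trans _ _ (avg (fun p => Psih p * (1 * `|phi p|)) ^+ 2)).
  rewrite -[leLHS]real_normK ?num_real // lerXn2r ?nnegrE //.
    by apply: avg_ge0 => p; rewrite !mulr_ge0.
  apply: le_trans (ler_norm_avg _) _; apply: ler_avg => p.
  by rewrite normrM mul1r ler_wpM2r.
apply: le_trans (cauchy_schwarz_avg _ _ Psih_ge0) _.
by rewrite le_eqVlt; apply/orP; left; apply/eqP; congr (_ * _); apply: eq_avg => p; ring.
Qed.

Lemma double_mul k F G : coord_double k (fun p => F p * G p) =1 (fun p => coord_double k F p * coord_double k G p).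
Proof. by move=> p; rewrite /coord_double; ring. Qed.

Lemma double_prod (I : Type) (r : seq I) (P : pred I) (F : I -> X * X -> R) k p :
  coord_double k (fun p => \prod_(i <- r | P i) F i p) p = \prod_(i <- r | P i) coord_double k (F i) p.
Proof. by rewrite /coord_double -big_split. Qed.

Lemma free_fst_doubles k l F : free_fst k F -> free_fst k (coord_doubles l F).
Proof.
move=> Fk; elim: l => //= j l IH x y z; rewrite /coord_double /swap_coord /= IH; congr (_ * _).
have [->|jk] := eqVneq j k; first by rewrite mix1_mix1.
by rewrite mix1C // IH.
Qed.

Lemma free_snd_doubles k l F : k \notin l -> free_snd k F -> free_snd k (coord_doubles l F).
Proof.
move=> + Fk; elim: l => //= j l IH; rewrite inE negb_or => /andP[kj /IH {}IH] x y z.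
by rewrite /coord_double /swap_coord /= IH mix1_mix_neq 1?eq_sym // IH.
Qed.

Lemma doubles_le l F G : (forall p, `|F p| <= G p) -> forall p, `|coord_doubles l F p| <= coord_doubles l G p.
Proof.
by move=> FG; elim: l => //= k l IH p; rewrite /coord_double normrM ler_pM.
Qed.

Section GowersCauchySchwarz.
Variables (I : finType) (P : pred I) (face : I -> {set J}) (e0 : {set J}).
Variables (A : X * X -> R) (h hh : I -> X * X -> R).
Hypothesis A_snd : forall k, k \in e0 -> free_snd k A.
Hypothesis h_fst : forall i k, P i -> k \in e0 -> k \notin face i -> free_fst k (h i).
Hypothesis h_snd : forall i k, P i -> k \in e0 -> free_snd k (h i).
Hypothesis hh_fst : forall i k, P i -> k \in e0 -> k \notin face i -> free_fst k (hh i).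
Hypothesis hh_snd : forall i k, P i -> k \in e0 -> free_snd k (hh i).
Hypothesis h_bound : forall i p, P i -> `|h i p| <= hh i p.

(* The coordinates in [l] are already doubled; a factor whose face misses one of them has
   been replaced by its majorant and is not doubled any further in that coordinate. *)
Definition gcs_factor l i : X * X -> R :=
  coord_doubles [seq k <- l | k \in face i] (if all (fun k => k \in face i) l then h i else hh i).

Definition gcs_avg l : R := avg (fun p => coord_doubles l A p * \prod_(i | P i) gcs_factor l i p).

Definition gcs_weight l k : R :=
  avg (fun p => \prod_(i | P i && (k \notin face i))
    coord_doubles [seq k <- l | k \in face i] (hh i) p).

Lemma norm_hh_ge i p : P i -> `|hh i p| <= hh i p.
Proof.
by move=> Pi; rewrite ger0_norm //; apply: le_trans (h_bound p Pi).
Qed.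

(** The factors whose face misses [k] form the weight and survive as majorants; all others are
    doubled. *)
Lemma gcs_step l k : k \in e0 -> k \notin l ->
  gcs_avg l ^+ 2 <= gcs_weight l k * gcs_avg (k :: l).
Proof.
move=> ke kl.
pose Phi p := coord_doubles l A p * \prod_(i | P i && (k \in face i)) gcs_factor l i p.
pose Psi p := \prod_(i | P i && (k \notin face i)) gcs_factor l i p.
pose Psih p := \prod_(i | P i && (k \notin face i)) coord_doubles [seq k <- l | k \in face i] (hh i) p.
have kf i : k \notin [seq j <- l | j \in face i] by rewrite mem_filter (negbTE kl) andbF.
have -> : gcs_avg l = avg (fun p => Phi p * Psi p).
  apply: eq_avg => p; rewrite (bigID (fun i => k \in face i)) /=.
  by rewrite mulrA.
have -> : gcs_avg (k :: l) = avg (fun p => Psih p * coord_double k Phi p).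
  apply: eq_avg => p; rewrite (bigID (fun i => k \in face i)) /= double_mul double_prod.
  rewrite [RHS]mulrC -[RHS]mulrA; congr (_ * (_ * _)).
    by apply: eq_bigr => i /andP[_ ki]; rewrite /gcs_factor /= ki.
  by apply: eq_bigr => i /andP[_ ki]; rewrite /gcs_factor /= (negbTE ki).
apply: double_step.
- move=> x y z; rewrite /Phi (free_snd_doubles kl (A_snd ke)); congr (_ * _).
  apply: eq_bigr => i /andP[Pi _]; apply: free_snd_doubles => //.
  by case: ifP => _; [exact: h_snd|exact: hh_snd].
- move=> x y z; apply: eq_bigr => i /andP[Pi ki]; apply: free_fst_doubles.
  by case: ifP => _; [exact: h_fst|exact: hh_fst].
- move=> x y z; apply: eq_bigr => i /andP[Pi ki]; apply: free_snd_doubles => //.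
  by case: ifP => _; [exact: h_snd|exact: hh_snd].
- by move=> x y z; apply: eq_bigr => i /andP[Pi ki]; apply: free_fst_doubles; apply: hh_fst.
- by move=> x y z; apply: eq_bigr => i /andP[Pi ki]; apply: free_snd_doubles => //; apply: hh_snd.
move=> p; rewrite normr_prod; apply: ler_prod => i /andP[Pi ki]; rewrite normr_ge0 /=.
apply: doubles_le => q; case: ifP => _; [exact: h_bound|exact: norm_hh_ge].
Qed.

(** Undoing one Cauchy-Schwarz step of weight at most 2 turns the bound [rho ^+ 2 / 2] into
    [rho]. *)
Fixpoint gcs_tolerance (n : nat) (rho : R) : R :=
  if n is n'.+1 then gcs_tolerance n' (rho ^+ 2 / 2) else rho.

Lemma gcs_tolerance_gt0 n rho : 0 < rho -> 0 < gcs_tolerance n rho.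
Proof. by elim: n rho => //= n IH rho rho0; apply: IH; rewrite divr_gt0 // exprn_gt0. Qed.

Lemma gowers_cauchy_schwarz rho : 0 < rho ->
  (forall l k, k \in e0 -> uniq (k :: l) -> {subset l <= e0} -> 0 <= gcs_weight l k <= 2) ->
  (forall l, uniq l -> l =i e0 -> `|gcs_avg l| <= gcs_tolerance #|e0| rho) ->
  `|gcs_avg [::]| <= rho.
Proof.
move=> rho0 weight final.
suff main r l : 0 < rho -> uniq (r ++ l) -> r ++ l =i e0 ->
    (forall l, uniq l -> l =i e0 -> `|gcs_avg l| <= gcs_tolerance (size r) rho) ->
    `|gcs_avg l| <= rho.
  have := main (enum e0) [::]; rewrite cats0 -cardE; apply => //; first exact: enum_uniq.
  exact: mem_enum.
clear final; elim: r l rho {rho0} => [|k r IH] l rho rho0 /= unq mem final.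
  exact: final.
have unq' : uniq (r ++ k :: l) by rewrite uniq_catC /= mem_cat orbC -mem_cat uniq_catC.
have mem' : r ++ k :: l =i e0.
  by move=> j; rewrite -mem !mem_cat !inE mem_cat orbCA.
have ke : k \in e0 by rewrite -mem inE eqxx.
have h2 : `|gcs_avg (k :: l)| <= rho ^+ 2 / 2.
  by apply: IH => //; rewrite divr_gt0 // exprn_gt0.
have kl : k \notin l by move: unq; rewrite mem_cat negb_or => /andP[/andP[]].
have /andP[w0 w2] : 0 <= gcs_weight l k <= 2.
  apply: weight => //=; first by rewrite kl; move: unq; rewrite cat_uniq => /and4P[].
  by move=> j jl; rewrite -mem inE mem_cat jl !orbT.
rewrite -ler_sqr ?nnegrE ?(ltW rho0) ?normr_ge0 // real_normK ?num_real //.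
apply: le_trans (gcs_step ke kl) _.
have := ler_norm (gcs_avg (k :: l)); set b := gcs_avg (k :: l) in h2 *; move=> hb.
apply: (@le_trans _ _ (gcs_weight l k * `|b|)); first by apply: ler_wpM2l.
apply: (@le_trans _ _ (2 * (rho ^+ 2 / 2))); first exact: ler_pM.
by rewrite le_eqVlt; apply/orP; left; apply/eqP; field.
Qed.

End GowersCauchySchwarz.
End Doubling.

(** * Linear forms and the pseudorandomness of the weights relative to lower faces *)

Section LinearForms.
Variables (R : realType) (J : finType) (H : {set {set J}}) (W : J -> finType).
Local Notation X := ({dffun forall j : J, W j}).
Hypothesis W0 : forall j, (0 < #|W j|)%N.
Variable nu : {set J} -> X -> R.
Implicit Types (w e : {set J}) (p : X * X) (l : seq J).

(** Condition (ii) at a fixed [N] with an explicit error. A vertex of the cube over [e] is encoded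
    by the set [w] of coordinates taken from the second point. *)
Definition linear_forms (gamma : R) := forall n : {set J} -> {set J} -> bool,
  `|avg (fun p => \prod_(e in H) \prod_(w : {set J} | w \subset e)
      (if n e w then nu e (mix w p.2 p.1) else 1)) - 1| <= gamma.

Definition monomial (L : {set J} -> seq {set J}) (p : X * X) : R :=
  \prod_(e in H) \prod_(w <- L e) nu e (mix w p.2 p.1).

(** Lists without repetition correspond to exponents 0 and 1, the only ones that condition (ii)
    controls. *)
Definition admissible (L : {set J} -> seq {set J}) :=
  forall e, e \in H -> uniq (L e) /\ forall w, w \in L e -> w \subset e.

Variable gamma : R.
Hypothesis LF : linear_forms gamma.

Lemma avg_monomial L : admissible L -> `|avg (monomial L) - 1| <= gamma.
Proof.
move=> aL; apply: le_trans (LF (fun e w => w \in L e)).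
rewrite le_eqVlt; apply/orP; left; apply/eqP; congr (`|_ - 1|); apply: eq_avg => p.
apply: eq_bigr => e eH; have [uL sL] := aL e eH.
rewrite big_uniq // big_mkcond [RHS]big_mkcond; apply: eq_bigr => w _.
by case: (boolP (w \in L e)) => [/sL ->|_] //; case: ifP.
Qed.

(* the vertices of the cube reached from [w0] by doubling the coordinates in [l] *)
Fixpoint shifts l w0 : seq {set J} :=
  if l is k :: l' then shifts l' w0 ++ [seq k |: w | w : {set J} <- shifts l' w0] else [:: w0].

Lemma mix_swap_coord k w p :
  mix w (swap_coord k p).2 (swap_coord k p).1 = mix (k |: w) p.2 p.1.
Proof.
by apply/ffunP => j; rewrite /swap_coord !mixE !inE; case: eqP; case: (j \in w).
Qed.

Lemma doubles_shifts (f : X -> R) l w0 p :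
  coord_doubles l (fun p => f (mix w0 p.2 p.1)) p = \prod_(w <- shifts l w0) f (mix w p.2 p.1).
Proof.
elim: l p => [|k l IH] p /=; first by rewrite big_seq1.
rewrite /coord_double !IH big_cat big_map; congr (_ * _).
by apply: eq_bigr => w _; rewrite mix_swap_coord.
Qed.

Lemma doubles_shifts0 (f : X -> R) l p :
  coord_doubles l (fun p => f p.1) p = \prod_(w <- shifts l set0) f (mix w p.2 p.1).
Proof.
rewrite -doubles_shifts; congr (coord_doubles l _ p); apply/funext => q.
by congr f; apply/ffunP => j; rewrite mixE inE.
Qed.

Lemma mem_shifts l w0 w : w \in shifts l w0 ->
  w0 \subset w /\ w \subset w0 :|: [set k in l].
Proof.
elim: l w => [|k l IH] w /=.
  by rewrite inE => /eqP ->; rewrite subxx subsetUl.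
have sub : w0 :|: [set i in l] \subset w0 :|: [set i in k :: l].
  by apply/setUS/subsetP => i; rewrite !inE orbC => ->.
rewrite mem_cat => /orP[/IH[w0w wl]|/mapP[v /IH[w0v vl] ->]].
  by split => //; apply: subset_trans wl sub.
split; first exact: subset_trans w0v (subsetUr _ _).
apply/subsetP => i; rewrite inE => /orP[/set1P ->|/(subsetP vl)/(subsetP sub)//].
by rewrite !inE eqxx orbT.
Qed.

Lemma size_shifts l w0 : size (shifts l w0) = (2 ^ size l)%N.
Proof. by elim: l => //= k l IH; rewrite size_cat size_map IH addnn -mul2n expnS. Qed.

Lemma shifts_uniq l w0 : uniq l -> {in l, forall k, k \notin w0} -> uniq (shifts l w0).
Proof.
elim: l => //= k l IH /andP[kl ul] kw0.
have nk w : w \in shifts l w0 -> k \notin w.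
  move=> /mem_shifts[_ /subsetP ws]; apply/negP => /ws.
  by rewrite !inE (negbTE kl) orbF; apply/negP/kw0; rewrite inE eqxx.
have uw : uniq (shifts l w0) by apply: IH => // j jl; apply: kw0; rewrite inE jl orbT.
rewrite cat_uniq uw /= map_inj_in_uniq ?uw ?andbT.
  apply/hasPn => w /mapP[v _ ->]; apply/negP => /nk.
  by rewrite !inE eqxx.
move=> w v /nk kw /nk kv E; rewrite -(setU1K kw) -(setU1K kv).
by rewrite E.
Qed.

(* inclusion-exclusion for the product of the factors [nu - 1] *)
Lemma avg_signed_monomial e0 (Lw : seq {set J}) L : e0 \in H ->
  (0 < size Lw)%N -> admissible L -> uniq (Lw ++ L e0) ->
  (forall w, w \in Lw -> w \subset e0) ->
  `|avg (fun p => (\prod_(w <- Lw) (nu e0 (mix w p.2 p.1) - 1)) * monomial L p)| <=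
  (2 ^ size Lw)%:R * gamma.
Proof.
move=> e0H; elim: Lw L => // w Lw IH L _ aL uL sL.
pose L' e := if e == e0 then w :: L e else L e.
have [uw uL0] : w \notin Lw ++ L e0 /\ uniq (Lw ++ L e0) by apply/andP.
have aL' : admissible L'.
  move=> e eH; have [u s] := aL e eH; rewrite /L'; case: eqP => // ee0; split => /=.
    by rewrite u andbT ee0; move: uw; rewrite mem_cat negb_or => /andP[].
  move=> v; rewrite inE => /predU1P[->|/s//].
  by rewrite ee0; apply: sL; rewrite inE eqxx.
have L'E p : monomial L' p = nu e0 (mix w p.2 p.1) * monomial L p.
  rewrite /monomial (bigD1 e0) //= [in RHS](bigD1 e0) //= mulrA {1}/L' eqxx big_cons.
  congr (_ * _); apply: eq_bigr => e /andP[_ ne]; by rewrite /L' (negbTE ne).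
have -> : avg (fun p => (\prod_(v <- w :: Lw) (nu e0 (mix v p.2 p.1) - 1)) * monomial L p) =
    avg (fun p => (\prod_(v <- Lw) (nu e0 (mix v p.2 p.1) - 1)) * monomial L' p) -
    avg (fun p => (\prod_(v <- Lw) (nu e0 (mix v p.2 p.1) - 1)) * monomial L p).
  by rewrite -avgB; apply: eq_avg => p; rewrite big_cons L'E; ring.
(* The induction ends at one signed factor, a difference of two monomials of average close to 1;
   without any signed factor the average is not small. *)
have [Lw0|Lw0] := posnP (size Lw).
  have {Lw0 IH} -> : Lw = [::] by apply: size0nil.
  rewrite /= expn1.
  have E M : avg (fun p => (\prod_(v <- [::]) (nu e0 (mix v p.2 p.1) - 1)) * monomial M p) =
    avg (monomial M) by apply: eq_avg => p; rewrite big_nil mul1r.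
  rewrite !E; have := avg_monomial aL; have := avg_monomial aL'.
  by rewrite !ler_norml => /andP[? ?] /andP[? ?]; apply/andP; split; lra.
apply: le_trans (ler_normB _ _) _ => /=.
rewrite expnS mul2n -addnn natrD mulrDl; apply: lerD; apply: IH => //.
- rewrite /L' eqxx -cat_rcons cat_uniq rcons_uniq.
  move: uL; rewrite /= mem_cat negb_or cat_uniq => /and4P[/andP[wLw wL] uLw /hasPn h uL1].
  rewrite uL1 wLw uLw !andbT /=; apply/hasPn => v vL.
  by rewrite mem_rcons inE negb_or h // andbT; apply: contraNneq wL => <-.
- by move=> v vL; apply: sL; rewrite inE vL orbT.
- by move=> v vL; apply: sL; rewrite inE vL orbT.
Qed.

End LinearForms.

Section Pseudorandomness.
Variables (R : realType) (J : finType) (d : nat) (H : {set {set J}}).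
Hypothesis H_card : forall e, e \in H -> #|e| = d.

(** [2 ^ (2 ^ d)] counts the terms of the inclusion-exclusion over the [2 ^ d] vertices of a cube;
    the bound by 1 keeps the Cauchy-Schwarz weights at most 2. *)
Definition lf_tolerance (rho : R) : R :=
  Num.min 1 (gcs_tolerance d rho / (2 ^ (2 ^ d))%:R).

Lemma lf_tolerance_gt0 rho : 0 < rho -> 0 < lf_tolerance rho.
Proof.
move=> rho0; rewrite lt_min ltr01 /= divr_gt0 ?gcs_tolerance_gt0 //.
by rewrite ltr0n expn_gt0.
Qed.

Section Space.
Variables (W : J -> finType) (nu : {set J} -> {dffun forall j, W j} -> R).
Local Notation X := ({dffun forall j : J, W j}).
Hypothesis W0 : forall j, (0 < #|W j|)%N.
Hypothesis nu_dep : forall e, e \in H -> depends_on e (nu e).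
Hypothesis nu_ge0 : forall e x, e \in H -> 0 <= nu e x.
Variables (gamma rho : R).
Hypothesis LF : linear_forms H nu gamma.
Hypothesis rho0 : 0 < rho.
Hypothesis gamma_le : gamma <= lf_tolerance rho.

Lemma pair_space_gt0 : (0 < #|{: X * X}|)%N.
Proof. by rewrite card_prod muln_gt0 card_prod_space_gt0. Qed.

Lemma avg_fst (f : X -> R) : avg (fun p : X * X => f p.1) = avg f.
Proof.
by rewrite avg_pair; apply: eq_avg => x /=; rewrite avg_const ?card_prod_space_gt0.
Qed.

Lemma gamma_le1 : gamma <= 1.
Proof. by apply: le_trans gamma_le _; rewrite ge_min lexx. Qed.

Lemma signed_tolerance (e0 : {set J}) l : e0 \in H -> uniq l -> l =i e0 ->
  (2 ^ size (shifts l set0))%:R * gamma <= gcs_tolerance #|e0| rho.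
Proof.
move=> e0H ul le0; have -> : size (shifts l set0) = (2 ^ d)%N.
  by rewrite size_shifts -(card_uniqP ul) (eq_card le0) H_card.
rewrite mulrC -ler_pdivlMr ?ltr0n ?expn_gt0 // H_card //.
by apply: le_trans gamma_le _; rewrite ge_min lexx orbT.
Qed.

Lemma shifts_set0_spec (e0 : {set J}) l : uniq l -> {subset l <= e0} ->
  uniq (shifts l set0) /\ forall w, w \in shifts l set0 -> w \subset e0.
Proof.
move=> ul le0; split; first by apply: shifts_uniq => // k _; rewrite inE.
move=> w /mem_shifts[_ /subset_trans]; apply; rewrite set0U; apply/subsetP => k.
by rewrite inE => /le0.
Qed.

Lemma doubles_mul (F G : X * X -> R) l p :
  coord_doubles l (fun p => F p * G p) p = coord_doubles l F p * coord_doubles l G p.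
Proof. by elim: l p => //= k l IH p; rewrite /coord_double !IH; ring. Qed.

Lemma doubles1 l (p : X * X) : coord_doubles l (fun=> 1 : R) p = 1.
Proof. by elim: l p => //= k l IH p; rewrite /coord_double !IH mulr1. Qed.

(** The factor at [k] ignores coordinate [k], so the step that doubles [k] replaces it by the
    majorant 1. In the end only the product of [nu - 1] over the whole cube is left, which the
    linear forms bound. *)
Lemma nu_cut e0 : e0 \in H -> cut_le (fun x => nu e0 x - 1) e0 rho.
Proof.
move=> e0H S fS.
pose A (p : X * X) := nu e0 p.1 - 1.
pose h k (p : X * X) : R := (p.1 \in S k)%:R.
pose hh (k : J) (p : X * X) : R := 1.
have -> : avg (fun x => (nu e0 x - 1) * ind_faces R e0 S x) =
    gcs_avg (mem e0) (fun k => e0 :\ k) A h hh [::].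
  by rewrite -avg_fst.
apply: (gowers_cauchy_schwarz (e0 := e0)) => //.
- move=> i k ie0 ke0; rewrite !inE ke0 andbT negbK => /eqP -> x y z; rewrite /h /=.
  rewrite (fS i ie0 _ x) // => j; rewrite mixE !inE => /andP[ji _].
  by rewrite (negbTE ji).
- by move=> i p ie0; rewrite /h /hh; case: (_ \in _); rewrite ?normr1 ?normr0.
- move=> l k ke0 ul le0; rewrite /gcs_weight.
  rewrite (@eq_avg _ _ _ (fun=> 1)) ?avg_const ?pair_space_gt0 ?ler01 ?ler1n // => p.
  by rewrite big1 // => i _; rewrite doubles1.
move=> l ul le0; have le0' : {subset l <= e0} by move=> k; rewrite le0.
have [us ss] := shifts_set0_spec ul le0'.
apply: le_trans (signed_tolerance e0H ul le0).
have step := @avg_signed_monomial _ _ H W nu gamma LF e0 (shifts l set0) (fun=> [::]) e0H.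
apply: le_trans (step _ _ _ ss) => //; last 2 first.
- by rewrite size_shifts expn_gt0.
- by rewrite cats0.
rewrite le_eqVlt; apply/orP; left; apply/eqP; congr (`|_|); apply: eq_avg => p.
congr (_ * _); first exact: (doubles_shifts0 (fun x => nu e0 x - 1)).
rewrite /monomial [RHS]big1; last by move=> e _; rewrite big_nil.
apply: big1 => k ke0; rewrite /gcs_factor.
have -> : all (fun j => j \in e0 :\ k) l = false.
  by apply/negbTE/allPn; exists k; rewrite ?le0 // !inE eqxx.
exact: doubles1.
Qed.

Section Relative.
Variables (e0 : {set J}) (h1 h2 : {set J} -> X -> R) (b1 b2 : {set J} -> bool).
Hypothesis e0H : e0 \in H.

Definition majorant (b : {set J} -> bool) (e : {set J}) (x : X) : R := if b e then nu e x else 1.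

Hypothesis h1_dep : forall e, e \in H -> depends_on e (h1 e).
Hypothesis h2_dep : forall e, e \in H -> depends_on e (h2 e).
Hypothesis h1_bound : forall e x, e \in H -> 0 <= h1 e x <= majorant b1 e x.
Hypothesis h2_bound : forall e x, e \in H -> 0 <= h2 e x <= majorant b2 e x.

(** The two points share the coordinates in [e0]; a product of two densities unfolds into such
    factors in [avg_densify2]. *)
Definition two_copies (f g : X -> R) (e : {set J}) (p : X * X) : R :=
  f p.1 * g (mix (e :\: e0) p.2 p.1).

Lemma two_copies_fst f g e k : depends_on e f -> depends_on e g -> k \notin e ->
  free_fst k (two_copies f g e).
Proof.
move=> df dg ke x y z; have nk j : j \in e -> j == k = false.
  by move=> je; apply: contraNF ke => /eqP <-.
rewrite /two_copies /=; congr (_ * _).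
  by apply: df => j je; rewrite mixE inE nk.
by apply: dg => j je; rewrite !mixE !inE nk.
Qed.

Lemma two_copies_snd f g e k : k \in e0 -> free_snd k (two_copies f g e).
Proof.
move=> ke x y z; rewrite /two_copies /=; congr (_ * g _).
apply/ffunP => j; rewrite !mixE !inE; case: eqP => // ->.
by rewrite ke.
Qed.

Definition majorant_cube (l : seq J) (e : {set J}) : seq {set J} :=
  (if b1 e then shifts l set0 else [::]) ++ (if b2 e then shifts l (e :\: e0) else [::]).

Lemma doubles_majorant l e p :
  coord_doubles l (two_copies (majorant b1 e) (majorant b2 e) e) p =
  \prod_(w <- majorant_cube l e) nu e (mix w p.2 p.1).
Proof.
rewrite doubles_mul big_cat /=; congr (_ * _); rewrite /majorant.
  by case: (b1 e); rewrite ?doubles_shifts0 // doubles1 big_nil.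
case: (b2 e); last by rewrite doubles1 big_nil.
by rewrite (doubles_shifts (nu e)).
Qed.

(** The two cubes are disjoint: vertices of the first lie in [e0], while those of the second contain
    the nonempty set [e :\: e0]. *)
Lemma majorant_cube_spec l e : e \in H -> e != e0 -> uniq l -> {subset l <= e0} ->
  let l' := [seq k <- l | k \in e] in
  uniq (majorant_cube l' e) /\ forall w, w \in majorant_cube l' e -> w \subset e.
Proof.
move=> eH ne ul le0 l'.
have ul' : uniq l' by rewrite filter_uniq.
have l'e : {subset l' <= e} by move=> k; rewrite mem_filter => /andP[].
have l'e0 : {subset l' <= e0} by move=> k; rewrite mem_filter => /andP[_ /le0].
have [u1 s1] := shifts_set0_spec ul' l'e.
have [_ s0] := shifts_set0_spec ul' l'e0.
have u2 : uniq (shifts l' (e :\: e0)).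
  by apply: shifts_uniq => // k /l'e0 ke0; rewrite inE ke0.
have s2 w : w \in shifts l' (e :\: e0) -> w \subset e.
  move=> /mem_shifts[_ /subset_trans]; apply; rewrite subUset subsetDl /=.
  by apply/subsetP => k; rewrite inE => /l'e.
have ne0 : ~~ (e \subset e0).
  by apply: contra ne => se; rewrite eqEcard se (H_card e0H) (H_card eH) leqnn.
have dis w : w \in shifts l' set0 -> w \in shifts l' (e :\: e0) -> False.
  move=> /s0 we0 /mem_shifts[ew _]; case/subsetPn: ne0 => k ke ke0.
  by case/negP: (ke0); apply/(subsetP we0)/(subsetP ew); rewrite inE ke0.
rewrite /majorant_cube; split; last first.
  by move=> w; rewrite mem_cat => /orP[]; case: ifP => // _; [apply: s1|apply: s2].
rewrite cat_uniq; case: (b1 e); case: (b2 e) => /=; rewrite ?u1 ?u2 ?andbT //.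
  by apply/hasPn => w w2; apply/negP => w1; apply: dis w1 w2.
by rewrite has_sym.
Qed.

Lemma majorant_ge0 b e x : e \in H -> 0 <= majorant b e x.
Proof. by move=> eH; rewrite /majorant; case: (b e) => //; apply: nu_ge0. Qed.

(** Every other edge misses a coordinate of [e0], so doubling all coordinates of [e0] turns its
    factor into majorants. What remains is a monomial multiplied by [nu e0 - 1] at every vertex of
    the cube over [e0]. *)
Lemma nu_relative : `|avg (fun p : X * X => (nu e0 p.1 - 1) *
   \prod_(e in H | e != e0) (h1 e p.1 * h2 e (mix (e :\: e0) p.2 p.1)))| <= rho.
Proof.
pose P (e : {set J}) := (e \in H) && (e != e0).
pose A (p : X * X) := nu e0 p.1 - 1.
pose h e := two_copies (h1 e) (h2 e) e.
pose hh e := two_copies (majorant b1 e) (majorant b2 e) e.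
have mdep b e : e \in H -> depends_on e (majorant b e).
  by move=> eH x y xy; rewrite /majorant (nu_dep eH xy).
rewrite -[X in `|X|]/(gcs_avg P id A h hh [::]).
apply: (gowers_cauchy_schwarz (e0 := e0)) => //.
- move=> e k /andP[eH _] ke0 ke; apply: two_copies_fst => //; [exact: h1_dep|exact: h2_dep].
- by move=> e k /andP[eH _] ke0; apply: two_copies_snd.
- by move=> e k /andP[eH _] ke0 ke; apply: two_copies_fst => //; apply: mdep.
- by move=> e k /andP[eH _] ke0; apply: two_copies_snd.
- move=> e p /andP[eH _]; rewrite /h /hh /two_copies.
  have /andP[h10 h11] := h1_bound p.1 eH.
  have /andP[h20 h21] := h2_bound (mix (e :\: e0) p.2 p.1) eH.
  by rewrite ger0_norm ?mulr_ge0 // ler_pM.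
- move=> l k ke0 /= /andP[kl ul] le0; rewrite /gcs_weight.
  pose L e := if (e == e0) || (k \in e) then [::] else majorant_cube [seq j <- l | j \in e] e.
  have aL : admissible H L.
    move=> e eH; rewrite /L; case: ifP => // /norP[ne _].
    exact: majorant_cube_spec.
  have -> : avg (fun p => \prod_(e | P e && (k \notin e))
      coord_doubles [seq j <- l | j \in e] (hh e) p) = avg (monomial H nu L).
    apply: eq_avg => p; rewrite /monomial big_mkcond [RHS]big_mkcond; apply: eq_bigr => e _.
    rewrite /P /L doubles_majorant; case: (e \in H) => //=.
    by case: eqP => [_|_] /=; rewrite ?big_nil //; case: (k \in e); rewrite ?big_nil.
  have := avg_monomial LF aL; have := gamma_le1; rewrite ler_norml => g1 /andP[? ?].
  by apply/andP; split; lra.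
move=> l ul le0; have le0' : {subset l <= e0} by move=> k; rewrite le0.
have [us ss] := shifts_set0_spec ul le0'.
pose L e := if e == e0 then [::] else majorant_cube [seq j <- l | j \in e] e.
have aL : admissible H L.
  move=> e eH; rewrite /L; case: ifP => // /negbT ne.
  exact: majorant_cube_spec.
apply: le_trans (signed_tolerance e0H ul le0).
have step := @avg_signed_monomial _ _ H W nu gamma LF e0 (shifts l set0) L e0H.
apply: le_trans (step _ aL _ ss).
- rewrite le_eqVlt; apply/orP; left; apply/eqP; congr (`|_|); apply: eq_avg => p.
  congr (_ * _); first exact: (doubles_shifts0 (fun x => nu e0 x - 1)).
  rewrite /monomial big_mkcond [RHS]big_mkcond; apply: eq_bigr => e _.
  rewrite /P /L; case: (boolP (e \in H)) => //= eH.
  case: eqVneq => [_|ne] /=; first by rewrite big_nil.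
  rewrite /gcs_factor -doubles_majorant.
  have -> // : all (fun j => j \in e) l = false.
  have : ~~ (e0 \subset e).
    by apply: contra ne => se; rewrite eq_sym eqEcard se (H_card e0H) (H_card eH) leqnn.
  case/subsetPn => k ke0 ke; apply/negbTE/allPn; exists k => //.
  by rewrite le0.
- by rewrite size_shifts expn_gt0.
- by rewrite /L eqxx cats0.
Qed.

End Relative.
End Space.
End Pseudorandomness.

(** * Relative counting by densification *)

Section CutFunctions.
Variables (R : realType) (J : finType) (W : J -> finType).
Local Notation X := ({dffun forall j : J, W j}).

Lemma depends_on_prod (I : finType) (P : pred I) (u : I -> X -> R) (s : {set J}) :
  (forall i, P i -> depends_on s (u i)) -> depends_on s (fun x => \prod_(i | P i) u i x).
Proof. by move=> du x y xy; apply: eq_bigr => i /du; apply. Qed.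

(* The average is affine in each [u k], so it is largest at indicator functions. *)
Lemma avg_cut_upper (f : X -> R) (e : {set J}) (kappa : R) (u : J -> X -> R) :
  depends_on e f ->
  (forall S, face_sets e S -> avg (fun x => f x * ind_faces R e S x) <= kappa) ->
  (forall k, k \in e -> depends_on (e :\ k) (u k)) ->
  (forall k x, k \in e -> 0 <= u k x <= 1) ->
  avg (fun x => f x * \prod_(k in e) u k x) <= kappa.
Proof.
move=> fdep cut udep u01.
suff main (r : seq J) : forall u : J -> X -> R, uniq r -> {subset r <= e} ->
    (forall k, k \in e -> depends_on (e :\ k) (u k)) ->
    (forall k x, k \in e -> 0 <= u k x <= 1) ->
    (forall k x, k \in e -> k \notin r -> u k x = (u k x == 1)%:R) ->
    avg (fun x => f x * \prod_(k in e) u k x) <= kappa.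
  apply: (main (enum e)) => //; first exact: enum_uniq.
    by move=> k; rewrite mem_enum.
  by move=> k x ke; rewrite mem_enum ke.
elim: r {u udep u01} => [|k r IH] u /= unq re udep u01 ind.
  apply: le_trans (cut (fun k => [set x | u k x == 1]) _); last first.
    by move=> k ke x y xy; rewrite !inE (udep k ke x y xy).
  rewrite le_eqVlt; apply/orP; left; apply/eqP; apply: eq_avg => x; congr (_ * _).
  by apply: eq_bigr => k ke; rewrite inE; apply: ind.
have ke : k \in e by apply: re; rewrite inE eqxx.
have /andP[kr ur] := unq.
pose F x := f x * \prod_(j in e | j != k) u j x.
pose c x := avg (fun z => F (mix [set k] z x)).
have udep_e j : j \in e -> depends_on e (u j).
  by move=> je; apply: depends_on_sub (subsetDl _ _) (udep j je).
have Fdep : depends_on e F.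
  move=> x y xy; rewrite /F (fdep x y xy); congr (_ * _).
  by apply: eq_bigr => j /andP[je _]; apply: udep_e.
have cdep : depends_on (e :\ k) c.
  move=> x y xy; apply: eq_avg => z; apply: Fdep => j je; rewrite !mixE inE.
  by case: eqVneq => // jk; apply: xy; rewrite !inE jk.
have avgF (v : X -> R) : depends_on (e :\ k) v -> avg (fun x => F x * v x) =
    avg (fun x => c x * v x).
  move=> vdep; rewrite -(avg_mix _ [set k]) avg_exchange; apply: eq_avg => x.
  rewrite /c -avgZr; apply: eq_avg => z; congr (_ * _); apply: vdep => j.
  by rewrite !inE mixE inE => /andP[/negbTE ->].
(* [c] is the coefficient of [u k] once coordinate [k] is averaged out; the maximising choice in
   [0, 1] is the indicator of [0 <= c]. *)
pose u' j := if j == k then fun x => (0 <= c x)%R%:R : R else u j.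
have prodE (w : J -> X -> R) x : (forall j, j != k -> w j = u j) ->
    f x * \prod_(j in e) w j x = F x * w k x.
  move=> wu; rewrite (bigD1 k) //= /F mulrA mulrAC; congr (_ * _ * _).
  by apply: eq_bigr => j /andP[_ jk]; rewrite wu.
have cpos : depends_on (e :\ k) (fun x => (0 <= c x)%R%:R : R).
  by move=> x y xy; rewrite (cdep x y xy).
apply: (@le_trans _ _ (avg (fun x => f x * \prod_(j in e) u' j x))).
  rewrite (eq_avg (fun x => prodE u x (fun _ _ => erefl))).
  have wu j : j != k -> u' j = u j by rewrite /u' => /negbTE ->.
  rewrite (eq_avg (fun x => prodE u' x wu)) /u' eqxx !avgF //; last exact: udep.
  apply: ler_avg => x; have /andP[u0 u1] := u01 k x ke.
  by case: (lerP 0 (c x)) => cx; rewrite ?mulr1 ?mulr0 ?ler_piMr // nmulr_rle0.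
apply: IH => //.
- by move=> j jr; apply: re; rewrite inE jr orbT.
- by move=> j je; rewrite /u'; case: eqVneq => [->|_] //; apply: udep.
- by move=> j x je; rewrite /u'; case: eqP => _; [case: (0 <= c x); rewrite ?lexx ?ler01|apply: u01].
- move=> j x je jr; rewrite /u'; case: eqVneq => [_|jk].
    by case: (0 <= c x); rewrite ?eqxx // eq_sym oner_eq0.
  by apply: ind => //; rewrite inE negb_or jk.
Qed.

Lemma avg_cut_le (f : X -> R) (e : {set J}) (kappa : R) (u : J -> X -> R) :
  depends_on e f -> cut_le f e kappa ->
  (forall k, k \in e -> depends_on (e :\ k) (u k)) ->
  (forall k x, k \in e -> 0 <= u k x <= 1) ->
  `|avg (fun x => f x * \prod_(k in e) u k x)| <= kappa.
Proof.
move=> fdep cut udep u01; rewrite ler_norml; apply/andP; split; last first.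
  apply: avg_cut_upper => // S fS; apply: le_trans (cut S fS); exact: ler_norm.
rewrite lerNl -avgN (eq_avg (fun x => esym (mulNr _ _))).
apply: avg_cut_upper => // [x y xy|S fS]; first by rewrite (fdep x y xy).
rewrite (eq_avg (fun x => mulNr _ _)) avgN; apply: le_trans (cut S fS).
by rewrite -normrN; apply: ler_norm.
Qed.

End CutFunctions.

Section RelativeCounting.
Variables (R : realType) (J : finType) (d : nat) (H : {set {set J}}).
Hypothesis H_card : forall e, e \in H -> #|e| = d.

Section Densify.
Variables (W : J -> finType).
Local Notation X := ({dffun forall j : J, W j}).
Hypothesis W0 : forall j, (0 < #|W j|)%N.
Variable e0 : {set J}.
Hypothesis e0H : e0 \in H.
Implicit Types (h : {set J} -> X -> R).

(** The conditional expectation of the other factors given the coordinates in [e0]. *)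
Definition densify h (x : X) : R := avg (fun y => \prod_(e in H | e != e0) h e (mix e0 x y)).

Lemma densify_dep h : depends_on e0 (densify h).
Proof.
move=> x x' xx'; apply: eq_avg => y.
suff -> : mix e0 x y = mix e0 x' y by [].
by apply/ffunP => j; rewrite !mixE; case: ifP => // /xx'.
Qed.

Lemma avg_densify h (q : X -> R) : depends_on e0 q ->
  avg (fun x => q x * densify h x) = avg (fun x => q x * \prod_(e in H | e != e0) h e x).
Proof.
move=> dq; rewrite -[RHS](avg_mix _ e0); apply: eq_avg => x.
rewrite -avgZ; apply: eq_avg => y; congr (_ * _); apply: dq => j je.
by rewrite mixE je.
Qed.

Lemma avg_densify2 h1 h2 (q : X -> R) : depends_on e0 q ->
  (forall e, e \in H -> depends_on e (h2 e)) ->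
  avg (fun x => q x * (densify h1 x * densify h2 x)) =
  avg (fun p : X * X => q p.1 *
    \prod_(e in H | e != e0) (h1 e p.1 * h2 e (mix (e :\: e0) p.2 p.1))).
Proof.
move=> dq dh2; rewrite avg_pair /=.
transitivity (avg (fun x => (q x * densify h2 x) * \prod_(e in H | e != e0) h1 e x)).
  rewrite -avg_densify; first by apply: eq_avg => x; ring.
  by move=> x y xy; rewrite (dq x y xy) (densify_dep h2 xy).
apply: eq_avg => x; rewrite mulrAC -avgZ; apply: eq_avg => y.
rewrite big_split /= mulrA; congr (_ * _); apply: eq_bigr => e /andP[eH _].
by apply: dh2 => // j je; rewrite !mixE inE je andbT; case: (j \in e0).
Qed.

Lemma densify_ge0 h x : (forall e y, e \in H -> 0 <= h e y) -> 0 <= densify h x.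
Proof. by move=> h0; apply: avg_ge0 => y; apply: prodr_ge0 => e /andP[/h0]. Qed.

Lemma densify_le h h' x : (forall e y, e \in H -> e != e0 -> 0 <= h e y <= h' e y) ->
  densify h x <= densify h' x.
Proof.
by move=> hh; apply: ler_avg => y; apply: ler_prod => e /andP[eH ne]; apply: hh.
Qed.

Lemma densify_le1 h x : (forall e y, e \in H -> e != e0 -> 0 <= h e y <= 1) -> densify h x <= 1.
Proof.
by move=> hh; apply: avg_le => // y; apply: prodr_ile1 => e /andP[eH ne]; apply: hh.
Qed.

(** For frozen coordinates outside [e0], each other edge misses a coordinate of [e0]; grouping the
    factors by a missed coordinate gives a test for the cut norm. *)
Lemma cut_densify (f : X -> R) h kappa : depends_on e0 f -> cut_le f e0 kappa ->
  (forall e, e \in H -> depends_on e (h e)) ->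
  (forall e x, e \in H -> 0 <= h e x <= 1) ->
  `|avg (fun x => f x * densify h x)| <= kappa.
Proof.
move=> fdep cut hdep h01.
have k0 : 0 <= kappa.
  apply: le_trans (normr_ge0 _) (cut (fun=> setT) _).
  by move=> k _ x y _; rewrite !inE.
pose miss (e : {set J}) := [pick k in e0 | k \notin e].
have missP e : e \in H -> e != e0 -> exists k, [/\ miss e = Some k, k \in e0 & k \notin e].
  move=> eH ne; rewrite /miss; case: pickP => [k /andP[ke0 ke]|no]; first by exists k.
  have : ~~ (e0 \subset e).
    by apply: contra ne => se; rewrite eq_sym eqEcard se (H_card e0H) (H_card eH) leqnn.
  by case/subsetPn => k ke0 ke; have := no k; rewrite /= ke0 ke.
have -> : avg (fun x => f x * densify h x) = avg (fun y => avg (fun x => f x *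
    \prod_(e in H | e != e0) h e (mix e0 x y))).
  by rewrite -avg_exchange; apply: eq_avg => x; rewrite -avgZ.
apply: le_trans (ler_norm_avg _) _; apply: avg_le => // y.
pose u k x := \prod_(e | [&& e \in H, e != e0 & miss e == Some k]) h e (mix e0 x y).
have -> : avg (fun x => f x * \prod_(e in H | e != e0) h e (mix e0 x y)) =
    avg (fun x => f x * \prod_(k in e0) u k x).
  apply: eq_avg => x; congr (_ * _).
  rewrite (exchange_big_dep (fun e => (e \in H) && (e != e0))) /=; last first.
    by move=> k e _ /and3P[-> ->].
  apply: eq_bigr => e /andP[eH ne]; have [k [mk ke0 ke]] := missP e eH ne.
  rewrite (big_pred1 k) // => j /=; rewrite eH ne mk /=.
  by apply/andP/eqP => [[_ /eqP[]] //|->].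
apply: avg_cut_le => //.
- move=> k ke0; apply: depends_on_prod => e /and3P[eH ne /eqP mk] x x' xx'.
  have [k' [mk' _ ke]] := missP e eH ne; move: mk'; rewrite mk => -[kk'].
  apply: (hdep e eH) => j je; rewrite !mixE; case: ifP => // je0; apply: xx'.
  by rewrite !inE je0 andbT; apply: contraNneq ke => jk; rewrite -kk' -jk.
- move=> k x ke0; rewrite prodr_ge0 /=; last by move=> e /and3P[/h01-/(_ (mix e0 x y))/andP[]].
  by apply: prodr_ile1 => e /and3P[/h01].
Qed.

Lemma prod_split (h : {set J} -> X -> R) x :
  \prod_(e in H) h e x = h e0 x * \prod_(e in H | e != e0) h e x.
Proof. by rewrite (bigD1 e0). Qed.

End Densify.

(** [S] holds the edges that still carry their weight; on the other edges the two families already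
    agree and are bounded by 1. *)
Definition sparse_pair (W : J -> finType) (nu : {set J} -> {dffun forall j, W j} -> R)
    (S : {set {set J}}) (kappa : R) (f g : {set J} -> {dffun forall j, W j} -> R) :=
  forall e, e \in H -> [/\ depends_on e (f e), depends_on e (g e), forall x, 0 <= f e x,
    forall x, 0 <= g e x <= 1 &
    if e \in S then (forall x, f e x <= nu e x) /\ cut_le (fun x => f e x - g e x) e kappa
    else forall x, f e x = g e x].

Definition pair_gap (W : J -> finType) (f g : {set J} -> {dffun forall j, W j} -> R) : R :=
  `|avg (fun x => \prod_(e in H) f e x) - avg (fun x => \prod_(e in H) g e x)|.

Section Step.
Variables (W : J -> finType) (nu : {set J} -> {dffun forall j, W j} -> R).
Local Notation X := ({dffun forall j : J, W j}).
Hypothesis W0 : forall j, (0 < #|W j|)%N.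
Hypothesis nu_dep : forall e, e \in H -> depends_on e (nu e).
Hypothesis nu_ge0 : forall e x, e \in H -> 0 <= nu e x.
Variables (gamma rho kappa eps' a : R) (S : {set {set J}}) (e0 : {set J}).
Hypothesis LF : linear_forms H nu gamma.
Hypothesis rho0 : 0 < rho.
Hypothesis gamma_le : gamma <= lf_tolerance d rho.
Hypothesis a0 : 0 < a.
Hypothesis e0S : e0 \in S.
Hypothesis e0H : e0 \in H.
Hypothesis IH : forall f g, sparse_pair nu (S :\ e0) kappa f g -> pair_gap f g <= eps'.
Variables f g : {set J} -> X -> R.
Hypothesis fg : sparse_pair nu S kappa f g.

Let F1 := densify e0 f.
Let G1 := densify e0 g.
Let b (e : {set J}) := e \in S :\ e0.
Let N1 := densify e0 (fun e => majorant nu b e).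

Let fdep e : e \in H -> depends_on e (f e). Proof. by move=> /fg[]. Qed.
Let gdep e : e \in H -> depends_on e (g e). Proof. by move=> /fg[]. Qed.
Let f_ge0 e x : e \in H -> 0 <= f e x. Proof. by move=> /fg[]. Qed.
Let g01 e x : e \in H -> 0 <= g e x <= 1. Proof. by move=> /fg[]. Qed.
Let g_ge0 e x : e \in H -> 0 <= g e x. Proof. by move=> eH; have /andP[] := g01 x eH. Qed.

Lemma pair_majorant e x : e \in H -> e != e0 -> 0 <= f e x <= majorant nu b e x.
Proof.
move=> eH ne; rewrite f_ge0 //= /majorant /b !inE ne /=; have [_ _ _ _] := fg eH.
by case: (e \in S) => [[+ _]|->]; [apply|have /andP[] := g01 x eH].
Qed.

Lemma majorant_dep e : e \in H -> depends_on e (majorant nu b e).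
Proof. by move=> eH x y xy; rewrite /majorant (nu_dep eH xy). Qed.

Let F1_ge0 x : 0 <= F1 x. Proof. by apply: densify_ge0 => e y; apply: f_ge0. Qed.
Let G1_ge0 x : 0 <= G1 x. Proof. by apply: densify_ge0 => e y; apply: g_ge0. Qed.
Let G1_le1 x : G1 x <= 1. Proof. by apply: densify_le1 => e y eH _; apply: g01. Qed.
Let F1_le x : F1 x <= N1 x. Proof. by apply: densify_le => e y; apply: pair_majorant. Qed.

Lemma nu_densify (h1 h2 : {set J} -> X -> R) (c1 c2 : {set J} -> bool) :
  (forall e, e \in H -> depends_on e (h1 e)) ->
  (forall e, e \in H -> depends_on e (h2 e)) ->
  (forall e x, e \in H -> e != e0 -> 0 <= h1 e x <= majorant nu c1 e x) ->
  (forall e x, e \in H -> e != e0 -> 0 <= h2 e x <= majorant nu c2 e x) ->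
  `|avg (fun x => (nu e0 x - 1) * (densify e0 h1 x * densify e0 h2 x))| <= rho.
Proof.
move=> d1 d2 m1 m2; rewrite avg_densify2 //; last first.
  by move=> x y xy; rewrite (nu_dep e0H xy).
(* The product skips [e0], so the factor there is reset to 0, for which the majorant bound is
   trivial. *)
pose t (h : {set J} -> X -> R) e := if e == e0 then (fun=> 0 : R) else h e.
have tdep h : (forall e, e \in H -> depends_on e (h e)) ->
    forall e, e \in H -> depends_on e (t h e).
  by move=> dh e eH; rewrite /t; case: eqP => // _; apply: dh.
have tm h c : (forall e x, e \in H -> e != e0 -> 0 <= h e x <= majorant nu c e x) ->
    forall e x, e \in H -> 0 <= t h e x <= majorant nu c e x.
  move=> mh e x eH; rewrite /t; case: eqVneq => [_|ne]; last exact: mh.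
  by rewrite lexx (majorant_ge0 nu_ge0).
apply: le_trans (nu_relative H_card nu_dep LF rho0 gamma_le e0H
  (tdep h1 d1) (tdep h2 d2) (tm h1 c1 m1) (tm h2 c2 m2)).
rewrite le_eqVlt; apply/orP; left; apply/eqP; congr (`|_|); apply: eq_avg => p.
by congr (_ * _); apply: eq_bigr => e /andP[_ ne]; rewrite /t (negbTE ne).
Qed.

(** The first two moments of [N1] are averages of monomials, each within [gamma] of 1, and [(1 +
    gamma) - 2 * (1 - gamma) + 1 = 3 * gamma]. *)
Lemma avg_density_sq : avg (fun x => (N1 x - 1) ^+ 2) <= 3 * gamma.
Proof.
have mono L : admissible H L -> 1 - gamma <= avg (monomial H nu L) <= 1 + gamma.
  move=> aL; have := avg_monomial LF aL; rewrite ler_norml => /andP[? ?].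
  by apply/andP; split; lra.
have be0 : b e0 = false by rewrite /b setD11.
have e1 : avg N1 = avg (monomial H nu (fun e => if b e then [:: set0] else [::])).
  transitivity (avg (fun x => 1 * N1 x)); first by apply: eq_avg => x; rewrite mul1r.
  rewrite avg_densify // -(avg_fst W0); apply: eq_avg => p; rewrite mul1r /monomial.
  rewrite [RHS](bigD1 e0) //= be0 big_nil mul1r.
  apply: eq_bigr => e _; rewrite /majorant; case: ifP => _; rewrite ?big_nil ?big_seq1 //.
  by congr nu; apply/ffunP => j; rewrite mixE inE.
have e2 : avg (fun x => N1 x ^+ 2) =
    avg (monomial H nu (fun e => if b e then [:: set0; e :\: e0] else [::])).
  transitivity (avg (fun x => 1 * (N1 x * N1 x))); first by apply: eq_avg => x; rewrite mul1r.
  rewrite avg_densify2 //; last exact: majorant_dep.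
  apply: eq_avg => p; rewrite mul1r /monomial.
  rewrite [RHS](bigD1 e0) //= be0 big_nil mul1r.
  apply: eq_bigr => e _; rewrite /majorant; case: ifP => _; rewrite ?big_nil ?mulr1 //.
  rewrite big_cons big_seq1; congr (nu _ _ * _).
  by apply/ffunP => j; rewrite mixE inE.
have X0 := card_prod_space_gt0 W0.
have -> : avg (fun x => (N1 x - 1) ^+ 2) = avg (fun x => N1 x ^+ 2) - 2 * avg N1 + 1.
  rewrite -avgZ -avgB -[X in _ + X](avg_const 1 X0) -avgD; apply: eq_avg => x; ring.
have a1 : admissible H (fun e => if b e then [:: set0] else [::]).
  move=> e eH; case: (b e); split => // w; rewrite inE => /eqP ->; exact: sub0set.
have a2 : admissible H (fun e => if b e then [:: set0; e :\: e0] else [::]).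
  move=> e eH; case: ifP => // be; split => /=; last first.
    by move=> w; rewrite !inE => /orP[] /eqP ->; rewrite ?sub0set ?subsetDl.
  rewrite inE andbT eq_sym setD_eq0; move: be; rewrite /b inE => /andP[ne _].
  by apply: contra ne => se; rewrite inE eqEcard se (H_card e0H) (H_card eH) leqnn.
have /andP[l1 u1] := mono _ a1; have /andP[l2 u2] := mono _ a2.
by rewrite e1 e2; lra.
Qed.

(** Putting a bounded [q] in place of the factor at [e0] removes [e0] from the weighted edges, so
    the induction hypothesis tests [F1 - G1] against [q]. *)
Lemma replace_edge (q : X -> R) : depends_on e0 q -> (forall x, 0 <= q x <= 1) ->
  `|avg (fun x => q x * F1 x) - avg (fun x => q x * G1 x)| <= eps'.
Proof.
move=> dq q01; pose r (h : {set J} -> X -> R) e := if e == e0 then q else h e.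
have sp : sparse_pair nu (S :\ e0) kappa (r f) (r g).
  move=> e eH; rewrite /r !inE; case: eqVneq => [->|ne] /=.
    by split => // x; have /andP[] := q01 x.
  exact: fg.
apply: le_trans (IH sp); rewrite /pair_gap.
have E h : avg (fun x => q x * densify e0 h x) = avg (fun x => \prod_(e in H) r h e x).
  rewrite avg_densify //; apply: eq_avg => x; rewrite (prod_split e0H) {1}/r eqxx.
  by congr (_ * _); apply: eq_bigr => e /andP[_ ne]; rewrite /r (negbTE ne).
by rewrite !E.
Qed.

(** One factor [F1 - G1] of the square is split into bounded tests, [G1] and the truncation of [F1],
    and the excess of [F1] over 1. The excess is controlled by the distance of the majorant [N1]
    from 1. *)
Lemma avg_gap_sq : avg (fun x => (F1 x - G1 x) ^+ 2) <=
  2 * eps' + (3 * gamma * (1 + a^-1) + a).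
Proof.
pose F2 x := Num.min (F1 x) 1.
have F2dep : depends_on e0 F2.
  by move=> x y xy; rewrite /F2 /F1 (densify_dep f xy).
have F201 x : 0 <= F2 x <= 1.
  by rewrite /F2 le_min F1_ge0 ler01 /= ge_min lexx orbT.
have G101 x : 0 <= G1 x <= 1 by rewrite G1_ge0 G1_le1.
have := replace_edge F2dep F201; have := replace_edge (densify_dep g) G101.
rewrite -/G1 !ler_norml => /andP[g1 g2] /andP[f1 f2].
have ex : avg (fun x => (F1 x - G1 x) * (F1 x - F2 x)) <= 3 * gamma * (1 + a^-1) + a.
  (* With [t = |N1 x - 1|] the integrand is at most [t ^+ 2 + 2 * t], and the linear term is
     absorbed by [2 * t <= t ^+ 2 / a + a]. *)
  apply: (@le_trans _ _ (avg (fun x => (N1 x - 1) ^+ 2 * (1 + a^-1) + a))).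
    apply: ler_avg => x.
    have F2E : F1 x - F2 x <= `|N1 x - 1|.
      rewrite /F2 minEle; case: ifP => h; first by rewrite subrr.
      by apply: le_trans (ler_norm _); rewrite lerD2r F1_le.
    have F20 : 0 <= F1 x - F2 x by rewrite subr_ge0 /F2 ge_min lexx.
    have D1 : F1 x - G1 x <= `|N1 x - 1| + 2.
      have := ler_norm (N1 x - 1); have := F1_le x; have := G1_ge0 x; lra.
    apply: (@le_trans _ _ ((`|N1 x - 1| + 2) * `|N1 x - 1|)).
      apply: (@le_trans _ _ ((`|N1 x - 1| + 2) * (F1 x - F2 x))).
        by apply: ler_wpM2r.
      by apply: ler_wpM2l => //; rewrite addr_ge0.
    rewrite -[X in _ <= X * _ + _](@real_normK _ (N1 x - 1)) ?num_real //.
    move: (`|N1 x - 1|) => t.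
    rewrite -subr_ge0 (_ : _ - _ = (t - a) ^+ 2 / a); first by rewrite divr_ge0 ?sqr_ge0 ?ltW.
    by field; rewrite gt_eqF.
  rewrite avgD avgZr avg_const ?card_prod_space_gt0 // lerD2r ler_wpM2r ?avg_density_sq //.
  by rewrite addr_ge0 // invr_ge0 ltW.
have -> : avg (fun x => (F1 x - G1 x) ^+ 2) =
    (avg (fun x => F2 x * F1 x) - avg (fun x => F2 x * G1 x)) +
    avg (fun x => (F1 x - G1 x) * (F1 x - F2 x)) -
    (avg (fun x => G1 x * F1 x) - avg (fun x => G1 x * G1 x)).
  by rewrite -!avgB -!avgD -avgB; apply: eq_avg => x; ring.
by lra.
Qed.

(** Replacing [f e0] by [g e0] against the bounded density [G1] costs [kappa]. The rest, [Y], tests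
    [F1 - G1] against [f e0]: Cauchy-Schwarz with [f e0] as weight gives a square, in which [nu e0]
    is exchanged for 1 by three uses of [nu_densify]. *)
Lemma pair_gap_step : exists2 Y, pair_gap f g <= kappa + `|Y| &
  Y ^+ 2 <= 2 * (2 * eps' + (3 * gamma * (1 + a^-1) + a) + 4 * rho).
Proof.
have [f0dep g0dep _ _] := fg e0H; rewrite e0S => -[fnu cut].
have X0 := card_prod_space_gt0 W0.
exists (avg (fun x => f e0 x * (1 * (F1 x - G1 x)))).
  have E (h : {set J} -> X -> R) : depends_on e0 (h e0) ->
      avg (fun x => \prod_(e in H) h e x) = avg (fun x => h e0 x * densify e0 h x).
    by move=> dh; rewrite avg_densify //; apply: eq_avg => x; apply: prod_split.
  rewrite /pair_gap !E //.
  have -> : avg (fun x => f e0 x * densify e0 f x) - avg (fun x => g e0 x * densify e0 g x) =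
      avg (fun x => (f e0 x - g e0 x) * G1 x) +
      avg (fun x => f e0 x * (1 * (F1 x - G1 x))).
    by rewrite -avgB -avgD; apply: eq_avg => x; rewrite /F1 /G1; ring.
  apply: le_trans (ler_normD _ _) _; rewrite lerD2r.
  apply: cut_densify => // x y xy; by rewrite (f0dep x y xy) (g0dep x y xy).
apply: le_trans (cauchy_schwarz_avg _ _ (fun x => f_ge0 x e0H)) _.
have nu1 : avg (nu e0) <= 2.
  have aL : admissible H (fun e => if e == e0 then [:: set0] else [::]).
    move=> e eH; case: (e == e0); split => // w; rewrite inE => /eqP ->; exact: sub0set.
  have -> : avg (nu e0) = avg (monomial H nu (fun e => if e == e0 then [:: set0] else [::])).
    rewrite -(avg_fst W0); apply: eq_avg => p; rewrite /monomial (bigD1 e0) //= eqxx big_seq1.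
    rewrite big1; last by move=> e /andP[_ /negbTE ->]; rewrite big_nil.
    by rewrite mulr1; congr nu; apply/ffunP => j; rewrite mixE inE.
  have := avg_monomial LF aL; have := gamma_le1 gamma_le.
  by rewrite ler_norml => ? /andP[? ?]; lra.
apply: ler_pM.
- by apply: avg_ge0 => x; rewrite mulr_ge0 ?sqr_ge0 ?f_ge0.
- by apply: avg_ge0 => x; rewrite mulr_ge0 ?sqr_ge0 ?f_ge0.
- by apply: le_trans nu1; apply: ler_avg => x; rewrite expr1n mulr1.
apply: (@le_trans _ _ (avg (fun x => nu e0 x * (F1 x - G1 x) ^+ 2))).
  by apply: ler_avg => x; rewrite ler_wpM2r ?sqr_ge0.
have -> : avg (fun x => nu e0 x * (F1 x - G1 x) ^+ 2) =
  avg (fun x => (F1 x - G1 x) ^+ 2) + (avg (fun x => (nu e0 x - 1) * (F1 x * F1 x)) -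
   2 * avg (fun x => (nu e0 x - 1) * (F1 x * G1 x)) + avg (fun x => (nu e0 x - 1) * (G1 x * G1 x))).
  by rewrite -avgZ -avgB -!avgD; apply: eq_avg => x; ring.
have gm e x : e \in H -> e != e0 -> 0 <= g e x <= majorant nu (fun=> false) e x.
  by move=> eH _; apply: g01.
have h1 := nu_densify fdep fdep pair_majorant pair_majorant.
have h2 := nu_densify fdep gdep pair_majorant gm.
have h3 := nu_densify gdep gdep gm gm.
rewrite -/F1 -/G1 in h1 h2 h3.
move: h1 h2 h3; rewrite !ler_norml => /andP[? ?] /andP[? ?] /andP[? ?].
by have := avg_gap_sq; lra.
Qed.

End Step.

Lemma relative_counting (m : nat) (eps : R) : 0 < eps -> exists gamma0 kappa : R,
  [/\ 0 < gamma0, 0 < kappa &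
  forall (W : J -> finType) (nu : {set J} -> {dffun forall j, W j} -> R) gamma
    (S : {set {set J}}) (f g : {set J} -> {dffun forall j, W j} -> R),
  (forall j, (0 < #|W j|)%N) ->
  (forall e, e \in H -> depends_on e (nu e)) ->
  (forall e x, e \in H -> 0 <= nu e x) ->
  linear_forms H nu gamma -> gamma <= gamma0 -> S \subset H -> (#|S| <= m)%N ->
  sparse_pair nu S kappa f g -> pair_gap f g <= eps].
Proof.
elim: m eps => [|m IHm] eps eps0.
  exists 1, 1; split => // W nu gamma S f g W0 _ _ _ _ _.
  rewrite leqn0 cards_eq0 => /eqP -> fg; rewrite /pair_gap.
  rewrite (_ : avg _ = avg (fun x => \prod_(e in H) g e x)) ?subrr ?normr0 ?ltW //.
  by apply: eq_avg => x; apply: eq_bigr => e /fg[_ _ _ _]; rewrite inE; apply.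
(* The goal for [Y] is [eps / 2]. With the shares below, the bound of [pair_gap_step] on [Y ^+ 2] is
   at most [2 * (t / 8 + t / 8 + t / 16 + t / 8)], which is less than [t]. *)
pose t := eps ^+ 2 / 4.
have t0 : 0 < t by rewrite divr_gt0 // exprn_gt0.
have t16 : 0 < t / 16 by rewrite divr_gt0.
have t32 : 0 < t / 32 by rewrite divr_gt0.
have [g1 [k1 [g10 k10 H1]]] := IHm _ t16.
have tol0 := @lf_tolerance_gt0 R d _ t32.
have a1 : 0 < 1 + (t / 16)^-1 by rewrite addr_gt0 // invr_gt0.
pose g2 := t / 24 / (1 + (t / 16)^-1).
have g20 : 0 < g2 by rewrite divr_gt0 // divr_gt0.
exists (Num.min g1 (Num.min (lf_tolerance d (t / 32)) g2)), (Num.min k1 (eps / 2)).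
split.
- by rewrite lt_min g10 lt_min tol0 g20.
- by rewrite lt_min k10 divr_gt0.
move=> W nu gamma S f g W0 nu_dep nu_ge0 LF gle SH Sm fg.
have /and3P[gg1 ggt gg2] : [&& gamma <= g1, gamma <= lf_tolerance d (t / 32) & gamma <= g2].
  by move: gle; rewrite le_min => /andP[->]; rewrite le_min.
have [S0|/set0Pn[e0 e0S]] := eqVneq S set0.
  rewrite /pair_gap (_ : avg _ = avg (fun x => \prod_(e in H) g e x)) ?subrr ?normr0 ?ltW //.
  by apply: eq_avg => x; apply: eq_bigr => e /fg[_ _ _ _]; rewrite S0 inE; apply.
have e0H := subsetP SH _ e0S.
set kappa := Num.min k1 (eps / 2) in fg.
have kk1 : kappa <= k1 by rewrite ge_min lexx.
have ke : kappa <= eps / 2 by rewrite ge_min lexx orbT.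
have IH f' g' : sparse_pair nu (S :\ e0) kappa f' g' -> pair_gap f' g' <= t / 16.
  move=> fg'; apply: (H1 W nu gamma (S :\ e0) f' g' W0 nu_dep nu_ge0 LF gg1).
  - by apply: subset_trans SH; apply: subsetDl.
  - by move: Sm; rewrite (cardsD1 e0) e0S.
  move=> e eH; have [fd gd f0 g01 fgS] := fg' e eH; split => //.
  case: ifP fgS => // _ [fn cut]; split => // A fA.
  exact: le_trans (cut A fA) kk1.
have [Y gap Ysq] := pair_gap_step W0 nu_dep nu_ge0 LF t32 ggt t16 e0S e0H IH fg.
apply: le_trans gap _.
suff : `|Y| <= eps / 2 by lra.
rewrite -ler_sqr ?nnegrE ?normr_ge0 ?divr_ge0 ?(ltW eps0) // real_normK ?num_real //.
apply: le_trans Ysq _.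
have -> : (eps / 2) ^+ 2 = t by rewrite /t; field.
have : 3 * gamma * (1 + (t / 16)^-1) <= t / 8.
  have : gamma * (1 + (t / 16)^-1) <= t / 24 by rewrite -ler_pdivlMr.
  lra.
lra.
Qed.

End RelativeCounting.

(** * The relative removal lemma *)

Section LowerCells.
Variables (R : realType) (J : finType) (W : J -> finType).
Local Notation X := ({dffun forall j : J, W j}).

Lemma size_lower_sets (G : face_system W) e m : (forall s, size (G s) <= m)%N ->
  (size (lower_sets G e) <= #|{set J}| * m)%N.
Proof.
move=> Gm; rewrite /lower_sets; set s := enum _.
apply: (@leq_trans (size s * m)); last first.
  by rewrite leq_mul2r -cardE max_card orbT.
by elim: s => //= f s IH; rewrite size_cat mulSn leq_add.
Qed.

(** A proper subface of [e] misses some [k] in [e], so its condition fits into a set independent of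
    coordinate [k]. *)
Lemma lower_cell_faces (G : face_system W) e x0 : face_measurable G ->
  exists2 S, face_sets e S &
    forall x, ind_faces R e S x = (color (lower_sets G e) x == color (lower_sets G e) x0)%:R.
Proof.
move=> mG.
exists (fun k => [set x | [forall f : {set J}, (f \subset e :\ k) ==>
   (color (G f) x == color (G f) x0)]]).
  move=> k ke x y xy; rewrite !inE; apply: eq_forallb => f.
  case: (boolP (f \subset e :\ k)) => //= fe.
  by rewrite (depends_on_color mG (x := x) (y := y)) // => j /(subsetP fe)/xy.
move=> x; rewrite ind_facesE; congr (nat_of_bool _)%:R; apply/forall_inP/lower_colorP.
  move=> h f /properP[fe [k ke kf]]; have := h k ke; rewrite inE => /forallP/(_ f).
  rewrite subsetD1 fe kf => /eqP; exact.
move=> h k ke; rewrite inE; apply/forallP => f; apply/implyP => fek.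
by apply/eqP/h; apply: sub_proper_trans fek (properD1 ke).
Qed.

End LowerCells.

Lemma le_of_gap (R : realType) (x y c : R) : `|x - y| <= c -> x <= c -> y <= 2 * c.
Proof. by rewrite ler_norml => /andP[? ?] ?; lra. Qed.

Section RelativeRemoval.
Variables (R : realType) (J : finType) (d : nat) (H : {set {set J}}).
Hypothesis H_card : forall e, e \in H -> #|e| = d.

(** The mass of [E e] outside [E' e] is split along [f = (f - g) + g]. The complement of [E' e] is a
    union of boundedly many lower cells, each a test for the cut norm, so [f - g] contributes
    little; and on it [g] reaches [eta] only inside [F e :\: E' e], which dense removal makes
    small. *)
Lemma relative_removal (eps : R) : 0 < eps -> exists (delta gamma0 : R) (M : nat),
  [/\ 0 < delta, 0 < gamma0 &
  forall (W : J -> finType) (nu : {set J} -> {dffun forall j, W j} -> R) gamma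
    (E : {set J} -> {set {dffun forall j : J, W j}}),
  (forall j, (0 < #|W j|)%N) ->
  (forall e, e \in H -> depends_on e (nu e)) ->
  (forall e x, e \in H -> 0 <= nu e x) ->
  linear_forms H nu gamma -> gamma <= gamma0 ->
  (forall e, e \in H -> depends_on e (fun x => x \in E e)) ->
  avg (fun x => \prod_(e in H) ((x \in E e)%:R * nu e x)) <= delta ->
  exists (G : face_system W) (E' : {set J} -> {set {dffun forall j : J, W j}}),
    [/\ face_measurable G, forall s, (size (G s) <= M)%N,
      forall e, e \in H -> invariant_under (color (lower_sets G e)) (fun x => x \in E' e),
      forall x, exists2 e, e \in H & x \notin E' e &
      forall e, e \in H -> avg (fun x => (x \in E e :\: E' e)%:R * nu e x) <= eps]].
Proof.
move=> eps0; have eps4 : 0 < eps / 4 by rewrite divr_gt0.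
pose eta := Num.min (eps / 4) 1.
have eta0 : 0 < eta by rewrite lt_min eps4 ltr01.
have eta1 : eta <= 1 by rewrite ge_min lexx orbT.
have etae : eta <= eps / 4 by rewrite ge_min lexx.
clearbody eta.
have [c [M [c0 dense]]] := dense_removal H_card eps4.
have [Q Q0 QE] : exists2 Q : R, 0 < Q & forall k, (2 ^ (#|{set J}| * M))%:R * k = Q * k.
  by eexists; last by []; rewrite ltr0n expn_gt0.
have [delta delta0 delta_lt] : exists2 delta : R, 0 < delta & 2 * delta < eta ^+ #|H| * c.
  have : 0 < eta ^+ #|H| by rewrite exprn_gt0.
  move: (eta ^+ #|H|) => en en0; have := mulr_gt0 en0 c0.
  by exists (en * c / 4); lra.
have [g1 [k1 [g10 k10 count]]] := relative_counting H_card #|H| delta0.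
(* One demand comes from the counting lemma, the other from summing the cut error over at most [Q]
   lower cells. *)
pose kappa := Num.min k1 (eps / 4 / Q).
have kappa0 : 0 < kappa by rewrite lt_min k10 divr_gt0.
have kk1 : kappa <= k1 by rewrite ge_min lexx.
have kQ : Q * kappa <= eps / 4.
  by rewrite mulrC -ler_pdivlMr // ge_min lexx orbT.
clearbody kappa.
have [M1 [g2 [g20 weak]]] := weak_regularity J #|{set J}| 0 kappa0.
pose rho := Num.min g2 1.
have rho0 : 0 < rho by rewrite lt_min g20 ltr01.
have rho1 : rho <= 1 by rewrite ge_min lexx orbT.
have rhog : rho <= g2 by rewrite ge_min lexx.
clearbody rho.
have tol0 := @lf_tolerance_gt0 R d _ rho0.
exists delta, (Num.min g1 (lf_tolerance d rho)), M; split => //.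
  by rewrite lt_min g10 tol0.
move=> W nu gamma E W0 nu_dep nu_ge0 LF gle Edep small.
have /andP[gg1 ggt] : (gamma <= g1) && (gamma <= lf_tolerance d rho).
  by move: gle; rewrite le_min.
have X0 := card_prod_space_gt0 W0.
(* Set to 0 off [H], so that weak regularity can be run over all sets of coordinates. *)
pose f (e : {set J}) x : R := if e \in H then (x \in E e)%:R * nu e x else 0.
have f_ge0 e x : 0 <= f e x.
  by rewrite /f; case: ifP => // eH; rewrite mulr_ge0 ?nu_ge0.
have f_nu e x : e \in H -> f e x <= nu e x.
  by move=> eH; rewrite /f eH; case: (x \in E e); rewrite ?mul1r // mul0r nu_ge0.
have f_dep e : e \in H -> depends_on e (f e).
  by move=> eH x y xy; rewrite /f eH (Edep e eH x y xy) (nu_dep e eH x y xy).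
have cutnu e (eH : e \in H) := nu_cut H_card W0 LF rho0 ggt eH.
have f_mean e : mean_bounded (f e) e rho.
  move=> S fS; have [eH|eH] := boolP (e \in H); last first.
    rewrite (@eq_avg _ _ _ (fun=> 0)) ?avg0; last by move=> x; rewrite /f (negbTE eH) mul0r.
    apply: addr_ge0; last exact: ltW.
    by apply: avg_ge0 => x; rewrite ind_facesE ler0n.
  apply: (@le_trans _ _ (avg (fun x => ind_faces R e S x + (nu e x - 1) * ind_faces R e S x))).
    apply: ler_avg => x.
    have -> : ind_faces R e S x + (nu e x - 1) * ind_faces R e S x = nu e x * ind_faces R e S x.
      by ring.
    by apply: ler_wpM2r; [rewrite ind_facesE ler0n|apply: f_nu].
  rewrite avgD lerD2l; apply: le_trans (cutnu e eH S fS); exact: ler_norm.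
have f_avg e : avg (f e) <= 2.
  have fT : face_sets e (fun=> [set: {dffun forall j, W j}]).
    by move=> k _ x y _; rewrite !inE.
  have := f_mean e _ fT.
  have i1 x : ind_faces R e (fun=> setT) x = 1.
    by rewrite /ind_faces big1 // => k _; rewrite inE.
  rewrite (@eq_avg _ _ _ (f e)); last by move=> x; rewrite i1 mulr1.
  rewrite (@eq_avg _ _ (ind_faces R e _) (fun=> 1)) // avg_const // => h.
  by apply: le_trans h _; rewrite -[leRHS]/(1 + 1) lerD2l.
have rho_bounds : 0 <= rho <= g2 by rewrite (ltW rho0) rhog.
pose Gnil : face_system W := fun=> [::].
have mnil : face_measurable Gnil by [].
have snil s : (size (Gnil s) <= 0)%N by [].
have [G1 [mG1 _ _ cutG1]] := weak W W0 {set J} id f rho (leqnn _) f_ge0 f_avg rho_bounds f_mean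
  Gnil mnil snil.
pose g e x := trunc (face_condexp G1 e (f e) x).
have g01 e x : 0 <= g e x <= 1.
  rewrite /g /trunc le_min condexp_ge0 // ler01 /= ge_min lexx orbT //.
have g_dep e : depends_on e (g e).
  by move=> x y xy; rewrite /g (depends_on_condexp _ mG1 xy).
have cutfg e : cut_le (fun x => f e x - g e x) e kappa by apply: cutG1.
have sp : sparse_pair H nu H k1 f g.
  move=> e eH; split => //; first exact: f_dep.
  rewrite eH; split; first by move=> x; apply: f_nu.
  by move=> S fS; apply: le_trans (cutfg e S fS) kk1.
have gap := count W nu gamma H f g W0 nu_dep nu_ge0 LF gg1 (subxx _) (leqnn _) sp.
(* On the common part of these sets the product of the [g e] is at least [eta ^+ #|H|], so by
   counting that part is smaller than [c]. *)
pose F (e : {set J}) := [set x | eta <= g e x].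
have Fdep e : e \in H -> depends_on e (fun x => x \in F e).
  by move=> eH x y xy; rewrite !inE (g_dep e x y xy).
have Fsmall : avg (fun x => \prod_(e in H) (x \in F e)%:R : R) < c.
  have en0 : 0 < eta ^+ #|H| by rewrite exprn_gt0.
  have fE : avg (fun x => \prod_(e in H) f e x) <= delta.
    apply: le_trans small; apply: ler_avg => x; rewrite le_eqVlt; apply/orP; left.
    by apply/eqP; apply: eq_bigr => e eH; rewrite /f eH.
  have gE : avg (fun x => \prod_(e in H) g e x) <= 2 * delta.
    exact: le_of_gap gap fE.
  rewrite -(ltr_pM2l en0); apply: le_lt_trans delta_lt; apply: le_trans gE; rewrite -avgZ; apply: ler_avg => x.
  rewrite -prodr_const -big_split /=; apply: ler_prod => e eH; have /andP[g0 _] := g01 e x.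
  by rewrite inE; case: (lerP eta (g e x)) => h; rewrite ?mulr1 ?mulr0 ?h ?lexx ?g0 ?(ltW eta0).
clear delta_lt.
have [G [E' [mG sG inv meet err]]] := dense W W0 F Fdep Fsmall.
exists G, E'; split => // e eH.
have -> : avg (fun x => (x \in E e :\: E' e)%:R * nu e x) =
    avg (fun x => (f e x - g e x) * (x \notin E' e)%:R) + avg (fun x => g e x * (x \notin E' e)%:R).
  rewrite -avgD; apply: eq_avg => x; rewrite -mulrDl subrK /f eH inE.
  by case: (x \in E' e); case: (x \in E e); rewrite ?mulr1 ?mulr0 ?mul0r.
have first : avg (fun x => (f e x - g e x) * (x \notin E' e)%:R) <= eps / 4.
  apply: le_trans kQ; apply: le_trans (ler_norm _) _.
  rewrite -QE -(card_fcolor (#|{set J}| * M)).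
  pose col := fcolor (#|{set J}| * M) (lower_sets G e).
  have colE x y : (col x == col y) = (color (lower_sets G e) x == color (lower_sets G e) y).
    exact/fcolor_eq/size_lower_sets.
  apply: (norm_avg_cells_le (c := col)); first exact: ltW.
    by move=> x y /eqP; rewrite colE => /eqP/(inv e eH) ->.
  move=> x0; have [S fS SE] := lower_cell_faces R e x0 mG.
  apply: le_trans (cutfg e S fS); rewrite le_eqVlt; apply/orP; left; apply/eqP.
  by congr (`|_|); apply: eq_avg => x; rewrite SE colE.
have second : avg (fun x => g e x * (x \notin E' e)%:R) <= eps / 4 + eps / 4.
  apply: (@le_trans _ _ (avg (fun x => (x \in F e :\: E' e)%:R + eta))).
    apply: ler_avg => x; rewrite !inE; have /andP[g0 g1'] := g01 e x.
    case: (x \in E' e); first by rewrite mulr0 /= add0r ltW.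
    by case: (lerP eta (g e x)) => h /=; lra.
  by rewrite avgD avg_const // lerD // err.
by lra.
Qed.

End RelativeRemoval.

(** * Translation to the algebras and weights of the statement *)

Section Projections.
Variables (J : finType) (V : nat -> J -> finType) (N : nat).
Local Notation X := (VJ V N).
Implicit Types (e : {set J}) (x y : X) (S : {set X}).

Lemma proj_eqP e x y : proj e x = proj e y <-> {in e, forall j, x j = y j}.
Proof.
split => [/ffunP h j je|h]; last by apply/ffunP => -[j je]; rewrite !ffunE; apply: h.
by have := h (exist _ j je); rewrite !ffunE.
Qed.

Lemma depends_on_proj (Y : Type) e (F : Ve V N e -> Y) : depends_on e (fun x => F (proj e x)).
Proof. by move=> x y /proj_eqP ->. Qed.

Lemma in_A_depends e S : in_A e S -> depends_on e (fun x => x \in S).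
Proof. by move=> [E ->] x y /proj_eqP xy; rewrite !inE xy. Qed.

Lemma depends_in_A e S : depends_on e (fun x => x \in S) -> in_A e S.
Proof.
move=> dS; exists [set proj e x | x in S]; apply/setP => x; rewrite inE.
apply/idP/imsetP => [xS|[y yS /proj_eqP xy]]; first by exists x.
by rewrite (dS x y xy).
Qed.

End Projections.

Section SigmaAlgebras.
Variable T : finType.
Implicit Types (B : {set {set T}}) (S : {set T}).

Lemma is_sigmaP B : reflect [/\ set0 \in B, forall S, S \in B -> ~: S \in B &
    forall S1 S2, S1 \in B -> S2 \in B -> S1 :|: S2 \in B] (is_sigma B).
Proof.
apply: (iffP and3P) => -[B0 BC BU]; split => //.
- by move=> S SB; apply: (forall_inP BC).
- by move=> S1 S2 S1B S2B; apply: (forall_inP (forall_inP BU S1 S1B)).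
- by apply/forall_inP.
- by apply/forall_inP => S1 S1B; apply/forall_inP => S2 S2B; apply: BU.
Qed.

Lemma sigma_bigcup B (I : finType) (P : pred I) (F : I -> {set T}) : is_sigma B ->
  (forall i, P i -> F i \in B) -> \bigcup_(i | P i) F i \in B.
Proof.
move=> /is_sigmaP[B0 _ BU] FB; exact: (big_ind (fun S => S \in B)).
Qed.

Lemma sigma_bigcap B (I : finType) (P : pred I) (F : I -> {set T}) : is_sigma B ->
  (forall i, P i -> F i \in B) -> \bigcap_(i | P i) F i \in B.
Proof.
move=> Bs FB; have /is_sigmaP[_ BC _] := Bs.
rewrite -[X in X \in B]setCK; apply: (BC); rewrite setC_bigcap.
by apply: sigma_bigcup => // i Pi; apply: BC; apply: FB.
Qed.

Definition color_algebra (C : finType) (c : T -> C) : {set {set T}} :=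
  [set [set x | c x \in Q] | Q : {set C}].

Lemma color_algebra_sigma (C : finType) (c : T -> C) : is_sigma (color_algebra c).
Proof.
apply/is_sigmaP; split.
- by apply/imsetP; exists set0 => //; apply/setP => x; rewrite !inE.
- by move=> _ /imsetP[Q _ ->]; apply/imsetP; exists (~: Q) => //; apply/setP => x; rewrite !inE.
move=> _ _ /imsetP[Q _ ->] /imsetP[Q' _ ->]; apply/imsetP; exists (Q :|: Q') => //.
by apply/setP => x; rewrite !inE.
Qed.

Lemma card_color_algebra (C : finType) (c : T -> C) :
  (#|color_algebra c| <= 2 ^ #|C|)%N.
Proof.
apply: leq_trans (leq_imset_card _ _) _.
by rewrite -[leqRHS]/(2 ^ #|C|)%N -(cardsT C) -card_powerset powersetT cardsT.
Qed.

Lemma color_class (C : finType) (c : T -> C) x : [set y | c y == c x] \in color_algebra c.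
Proof. by apply/imsetP; exists [set c x] => //; apply/setP => y; rewrite !inE. Qed.

Lemma color_algebra_inv (C : finType) (c : T -> C) S : S \in color_algebra c ->
  invariant_under c (fun x => x \in S).
Proof. by move=> /imsetP[Q _ ->] x y xy; rewrite !inE xy. Qed.

End SigmaAlgebras.

Section PseudorandomLinearForms.
Variables (R : realType) (J : finType) (V : nat -> J -> finType).
Variables (nu : forall N e, Ve V N e -> R) (H : {set {set J}}).

Definition lifted N (e : {set J}) (x : VJ V N) : R := nu (proj e x).

Definition cube_set (e : {set J}) (w : cube e) : {set J} :=
  [set val i | i : {j : J | j \in e} & w i].

Lemma mem_cube_set e (w : cube e) (i : {j : J | j \in e}) : (val i \in cube_set w) = w i.
Proof.
apply/imsetP/idP => [[i' + /val_inj ->]|wi]; first by rewrite inE.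
by exists i; rewrite // inE.
Qed.

Lemma cube_set_sub e (w : cube e) : cube_set w \subset e.
Proof. by apply/subsetP => j /imsetP[i _ ->]; apply: valP. Qed.

Lemma cubept_mix N e (p : VJ V N * VJ V N) (w : cube e) :
  cubept (proj e p.1) (proj e p.2) w = proj e (mix (cube_set w) p.2 p.1).
Proof.
by apply/ffunP => i; rewrite !ffunE mem_cube_set; case: (w i).
Qed.

Lemma prod_cube e (F : {set J} -> R) :
  \prod_(w : cube e) F (cube_set w) = \prod_(w : {set J} | w \subset e) F w.
Proof.
rewrite [RHS](reindex (@cube_set e)) /=.
  by apply: eq_bigl => w; rewrite cube_set_sub.
exists (fun w : {set J} => [ffun i : {j : J | j \in e} => val i \in w]).
  by move=> w _; apply/ffunP => i; rewrite ffunE mem_cube_set.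
move=> w; rewrite inE => /subsetP we; apply/setP => j; apply/imsetP/idP.
  by case=> i; rewrite inE ffunE => iw ->.
by move=> jw; exists (exist _ j (we j jw)); rewrite // inE ffunE.
Qed.

Hypothesis pseudo : forall n : forall e : {set J}, cube e -> bool,
  tends_to (fun N => avg (fun p : VJ V N * VJ V N =>
    \prod_(e in H) \prod_(w : cube e)
      (if n e w then nu (cubept (proj e p.1) (proj e p.2) w) else 1))) 1.

(* Finitely many exponent patterns occur, so the convergence is uniform in them. *)
Lemma eventually_linear_forms (gamma : R) : 0 < gamma ->
  exists N0, forall N, (N0 <= N)%N -> linear_forms H (@lifted N) gamma.
Proof.
move=> gamma0.
have /choice[N0 HN0] (phi : {ffun {set J} * {set J} -> bool}) : exists N0, forall N, (N0 <= N)%N ->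
    `|avg (fun p : VJ V N * VJ V N => \prod_(e in H) \prod_(w : cube e)
      (if phi (e, cube_set w) then nu (cubept (proj e p.1) (proj e p.2) w) else 1)) - 1| <= gamma.
  exact: (pseudo (fun e w => phi (e, cube_set w)) gamma0).
exists (\max_(phi : {ffun {set J} * {set J} -> bool}) N0 phi) => N NN n.
pose phi : {ffun {set J} * {set J} -> bool} := [ffun q => n q.1 q.2].
have := HN0 phi N (leq_trans (leq_bigmax phi) NN).
apply: le_trans; rewrite le_eqVlt; apply/orP; left; apply/eqP; congr (`|_ - 1|).
apply: eq_avg => p; apply: eq_bigr => e eH.
rewrite -(prod_cube e (fun w => if n e w then lifted e (mix w p.2 p.1) else 1)).
apply: eq_bigr => w _; rewrite ffunE /=; case: (n e _) => //.
by rewrite cubept_mix.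
Qed.

End PseudorandomLinearForms.

(** * Removal at a fixed tolerance and the choice of the error functions *)

Section Main.
Variables (R : realType) (J : finType) (d : nat) (H : {set {set J}}).
Variables (V : nat -> J -> finType) (nu : forall (N : nat) (e : {set J}), Ve V N e -> R).
Hypothesis H_card : forall e, e \in H -> #|e| = d.
Hypothesis V0 : forall N j, (0 < #|V N j|)%N.
Hypothesis nu_ge0 : forall N e (y : Ve V N e), e \in H -> 0 <= nu y.
Hypothesis pseudo : forall n : forall e : {set J}, cube e -> bool,
  tends_to (fun N => avg (fun p : VJ V N * VJ V N =>
    \prod_(e in H) \prod_(w : cube e)
      (if n e w then nu (cubept (proj e p.1) (proj e p.2) w) else 1))) 1.

Definition removal_outcome (eps : R) (C N : nat) (E : {set J} -> {set VJ V N}) :=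
  exists (E' : {set J} -> {set VJ V N}) (B : {set J} -> {set {set VJ V N}}),
    (forall e, e \in H -> in_A e (E' e)) /\
    \bigcap_(e in H) E' e = set0 /\
    (forall e, e \in H ->
       avg (fun x : VJ V N => (x \in E e :\: E' e)%:R * nu (proj e x)) <= eps) /\
    (forall e' : {set J}, (#|e'| < d)%N ->
       is_sigma (B e') /\ (forall S, S \in B e' -> in_A e' S) /\ (#|B e'| <= C)%N) /\
    (forall e, e \in H ->
       E' e \in sigma_gen (\bigcup_(e' : {set J} | e' \proper e) B e')).

Definition weighted_meet N (E : {set J} -> {set VJ V N}) : R :=
  avg (fun x : VJ V N => \prod_(e in H) ((x \in E e)%:R * nu (proj e x))).

Lemma uniform_removal (eps : R) : 0 < eps -> exists (delta : R) (C N0 : nat), 0 < delta /\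
  forall N (E : {set J} -> {set VJ V N}), (N0 <= N)%N ->
    (forall e, e \in H -> in_A e (E e)) -> weighted_meet E <= delta ->
    removal_outcome eps C E.
Proof.
move=> eps0; have [delta [gamma0 [M [delta0 gamma00 main]]]] := relative_removal H_card eps0.
have [N0 HN0] := eventually_linear_forms pseudo gamma00.
(* At most [M] generating sets per face give [2 ^ M] colours, hence an algebra of at most
   [2 ^ (2 ^ M)] sets. *)
exists delta, (2 ^ (2 ^ M))%N, N0; split => // N E NN EA small.
have dep e : e \in H -> depends_on e (@lifted R J V nu N e).
  by move=> _; apply: (depends_on_proj (fun y => nu y)).
have ge0 e x : e \in H -> 0 <= @lifted R J V nu N e x by move=> eH; apply: nu_ge0.
have Edep e : e \in H -> depends_on e (fun x => x \in E e).
  by move=> eH; apply: in_A_depends; apply: EA.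
have [G [E' [mG sG inv meet err]]] :=
  main (V N) _ gamma0 E (V0 N) dep ge0 (HN0 N NN) (lexx _) Edep small.
pose c e := fcolor M (G e).
have cE e x y : (c e x == c e y) = (color (G e) x == color (G e) y) by exact: fcolor_eq.
exists E', (fun e => color_algebra (c e)); split; last split; last split; last split.
- move=> e eH; apply: depends_in_A => x y xy; apply: (inv e eH).
  apply/eqP/lower_colorP => f fe; apply: (depends_on_color mG) => j jf.
  exact/xy/(subsetP (proper_sub fe)).
- apply/setP => x; rewrite inE; apply/negP => /bigcapP xE.
  by have [e eH] := meet x; rewrite xE.
- exact: err.
- move=> e _; split; first exact: color_algebra_sigma.
  split; last by have := card_color_algebra (c e); rewrite card_fcolor.
  move=> S /color_algebra_inv Sinv; apply: depends_in_A => x y xy; apply: Sinv.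
  by apply/eqP; rewrite cE (depends_on_color mG xy).
move=> e eH; rewrite inE; apply/forallP => B; apply/implyP => /andP[Bs sub].
have cell (f : {set J}) x : f \proper e -> [set y | c f y == c f x] \in B.
  move=> fe; apply: (subsetP sub); apply/bigcupP; exists f => //.
  exact: color_class.
(* By invariance [E' e] is the union of the lower cells of its points, and each cell is an
   intersection of colour classes. *)
have -> : E' e = \bigcup_(x in E' e) \bigcap_(f : {set J} | f \proper e) [set y | c f y == c f x].
  apply/setP => y; apply/idP/bigcupP => [yE|[x xE /bigcapP xy]].
    by exists y => //; apply/bigcapP => f _; rewrite inE.
  rewrite (inv e eH y x) //; apply/eqP/lower_colorP => f fe.
  by have := xy f fe; rewrite inE cE => /eqP.
by apply: sigma_bigcup => // x _; apply: sigma_bigcap => // f; apply: cell.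
Qed.

Lemma eventually_mean_le2 : exists N0, forall N, (N0 <= N)%N -> forall e, e \in H ->
  avg (fun x : VJ V N => nu (proj e x)) <= 2.
Proof.
have [N0 HN0] := eventually_linear_forms pseudo (ltr01 : 0 < (1 : R)).
exists N0 => N NN e eH.
have aL : admissible H (fun f => if f == e then [:: set0] else [::]).
  by move=> f fH; case: (f == e); split => // w; rewrite inE => /eqP ->; apply: sub0set.
have := avg_monomial (HN0 N NN) aL; rewrite ler_norml => /andP[_].
rewrite lerBlDr; apply: le_trans; rewrite -(avg_fst (V0 N)) le_eqVlt; apply/orP; left.
apply/eqP; apply: eq_avg => p; rewrite /monomial (bigD1 e) //= eqxx big_seq1.
rewrite big1 ?mulr1; last by move=> f /andP[_ /negbTE ->]; rewrite big_nil.
by rewrite /lifted; congr (nu (proj e _)); apply/ffunP => j; rewrite mixE inE.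
Qed.

(** Covers those [delta] that are too large for every tolerance: with empty sets the error is the
    mean of a weight, eventually at most 2. A meet below 1 forces [H] to be nonempty, without which
    the intersection would be everything. *)
Lemma trivial_removal : exists N0, forall N (E : {set J} -> {set VJ V N}), (N0 <= N)%N ->
    weighted_meet E < 1 -> removal_outcome 2 2 E.
Proof.
have [N0 HN0] := eventually_mean_le2; exists N0 => N E NN small.
have H0 : H != set0.
  apply: contraTneq small => H0; rewrite -leNgt /weighted_meet.
  rewrite (@eq_avg _ _ _ (fun=> 1)) ?avg_const ?(card_prod_space_gt0 (V0 N)) //.
  by move=> x; rewrite H0 big_set0.
exists (fun=> set0), (fun=> [set set0; setT]); split; last split; last split; last split.
- by move=> e _; apply: depends_in_A => x y _; rewrite !inE.
- have [e eH] := set0Pn _ H0; apply/setP => x; rewrite inE; apply/negP => /bigcapP/(_ e eH).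
  by rewrite inE.
- move=> e eH; apply: le_trans (HN0 N NN e eH); apply: ler_avg => x.
  by case: (_ \in _); rewrite ?mul1r // mul0r nu_ge0.
- move=> e _; split; last split.
  + apply/is_sigmaP; split; first by rewrite !inE eqxx.
      by move=> S; rewrite !inE => /orP[] /eqP ->; rewrite ?setC0 ?setCT eqxx ?orbT.
    by move=> S1 S2; rewrite !inE => /orP[] /eqP -> /orP[] /eqP ->;
      rewrite ?set0U ?setTU ?setU0 eqxx ?orbT.
  + by move=> S; rewrite !inE => /orP[] /eqP ->; apply: depends_in_A => x y _; rewrite !inE.
  + by rewrite cards2; case: (_ != _).
by move=> e _; rewrite inE; apply/forallP => B; apply/implyP => /andP[/is_sigmaP[]].
Qed.

End Main.

(* The tolerance [1 / k] is used for the largest [k] whose threshold admits [delta]. *)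
Lemma diagonal_level (R : realType) (thr : nat -> R) : (forall k, 0 < thr k) ->
  exists s : R -> nat,
    (forall delta k, 0 < delta -> s delta = k.+1 -> delta <= thr k) /\
    tends_to0_at0 (fun delta => if s delta is k.+1 then k.+1%:R^-1 else 2).
Proof.
move=> thr0.
(* The successor reserves 0 for the case that no [k] qualifies; the range grows as [delta] tends to
   0, so that every [k] becomes eligible. *)
pose s (delta : R) := \max_(k < Num.bound delta^-1 | delta <= thr k) k.+1.
exists s; split => [delta k d0 sk|eps eps0].
  have : (0 < #|[pred k : 'I_(Num.bound delta^-1) | (delta <= thr k)%R]|)%N.
    apply: contraPT sk; rewrite lt0n negbK => /eqP/card0_eq none.
    by rewrite /s big_pred0 // => i; have := none i; rewrite inE.
  move=> /(eq_bigmax_cond (fun k : 'I__ => k.+1))[i]; rewrite inE => di E.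
  by move: sk; rewrite /s E => -[<-].
have [k ke] : exists k : nat, k.+1%:R^-1 <= eps.
  exists (Num.bound eps^-1); rewrite -[leRHS]invrK lef_pV2 ?posrE ?invr_gt0 //.
  have := archi_boundP (ltW (_ : 0 < eps^-1)); rewrite invr_gt0 => /(_ eps0) h.
  by apply: le_trans (ltW h) _; rewrite ler_nat.
(* The second bound places [k] inside the range searched by [s]. *)
exists (Num.min (thr k) k.+1%:R^-1); split; first by rewrite lt_min thr0 invr_gt0 ltr0n.
move=> delta d0; rewrite lt_min => /andP[dthr dk].
have kb : (k < Num.bound delta^-1)%N.
  have h := archi_boundP (ltW (_ : 0 < delta^-1)); rewrite invr_gt0 in h.
  rewrite -(ltr_nat R); apply: lt_trans (h d0); apply: (@lt_trans _ _ k.+1%:R).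
    by rewrite ltr_nat.
  by rewrite -[ltLHS]invrK ltf_pV2 ?posrE ?invr_gt0 ?ltr0n.
have : (k.+1 <= s delta)%N.
  exact: (leq_bigmax_cond (F := fun k : 'I__ => k.+1) (Ordinal kb) (ltW dthr)).
case: (s delta) => // m km; rewrite ger0_norm ?invr_ge0 ?ler0n //.
by apply: le_trans ke; rewrite lef_pV2 ?posrE ?ltr0n // ler_nat.
Qed.

Theorem mainTheorem3 (R : realType) (J : finType) (d : nat) (H : {set {set J}})
  (V : nat -> J -> finType) (nu : forall (N : nat) (e : {set J}), Ve V N e -> R) :
  (1 <= d)%N ->
  (forall e, e \in H -> #|e| = d) ->
  (forall N j, (0 < #|V N j|)%N) ->
  system_of_measures nu H ->
  pseudorandom nu H ->
  exists (c1 : R -> R) (c2 : R -> nat -> R) (C : R -> nat) (N0 : R -> nat),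
    tends_to0_at0 c1 /\
    (forall delta : R, tends_to (c2 delta) 0) /\
    forall (delta : R) (N : nat) (E : {set J} -> {set VJ V N}),
      0 < delta -> delta < 1 -> (N0 delta <= N)%N ->
      (forall e, e \in H -> in_A e (E e)) ->
      avg (fun x : VJ V N =>
             \prod_(e in H) ((x \in E e)%:R * nu N e (proj e x))) <= delta ->
      exists (E' : {set J} -> {set VJ V N}) (B : {set J} -> {set {set VJ V N}}),
        (forall e, e \in H -> in_A e (E' e)) /\
        \bigcap_(e in H) E' e = set0 /\
        (forall e, e \in H ->
           avg (fun x : VJ V N => (x \in E e :\: E' e)%:R * nu N e (proj e x))
             <= c1 delta + c2 delta N) /\
        (forall e' : {set J}, (#|e'| < d)%N ->
           is_sigma (B e') /\
           (forall S, S \in B e' -> in_A e' S) /\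
           (#|B e'| <= C delta)%N) /\
        (forall e, e \in H ->
           E' e \in sigma_gen (\bigcup_(e' : {set J} | e' \proper e) B e')).
Proof.
move=> _ H_card V0 [nu_ge0 _] [_ [pseudo _]].
have pos (k : nat) : 0 < k.+1%:R^-1 :> R by rewrite invr_gt0 ltr0Sn.
have /choice[thr /choice[C /choice[N0 /all_and2[thr0 main]]]] (k : nat) :=
  uniform_removal H_card V0 nu_ge0 pseudo (pos k).
have [N1 triv] := trivial_removal d V0 nu_ge0 pseudo.
have [s [s_thr s_lim]] := diagonal_level thr0.
(* The value 0 of [s] selects [trivial_removal] with its error 2. The second error function can be
   zero because the threshold for [N] depends on [delta]. *)
exists (fun delta => if s delta is k.+1 then k.+1%:R^-1 else 2), (fun _ _ => 0),
  (fun delta => if s delta is k.+1 then C k else 2),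
  (fun delta => if s delta is k.+1 then N0 k else N1).
split; first exact: s_lim.
split; first by move=> delta eps eps0; exists 0%N => N _; rewrite subrr normr0 ltW.
move=> delta N E d0 d1 NN EA small; rewrite addr0.
move: NN; case Es : (s delta) => [|k] NN.
  by apply: triv => //; apply: le_lt_trans small d1.
apply: main => //; apply: le_trans small _; exact: s_thr d0 Es.
Qed.
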